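(* Let $f:(\mathbb C^n,0)\to(\mathbb C,0)$ be a holomorphic function-germ and $F:(\mathbb C^m,0)\to(\mathbb C^n,0)$ a holomorphic map-germ, and for $j\ge 0$ let $\beta_j=\dim_{\mathbb C}\operatorname{Tor}_j^{\mathcal O_{\mathbb C^n}}(\mathcal O_{\mathbb C^n}/J_f,\mathcal O_{\mathbb C^m})$, where $\mathcal O_{\mathbb C^m}$ is an $\mathcal O_{\mathbb C^n}$-module via $F$. If $f\circ F$ has isolated singularity, then $$\tau_{\mathcal K_f}F=\mu(f\circ F)-\beta_0+\beta_1 .$$
   Context: All germs are holomorphic. $\mathcal O_{\mathbb C^k}$ is the ring of germs at $0$ of holomorphic functions on $\mathbb C^k$, and $\theta_{\mathbb C^k}$ is the $\mathcal O_{\mathbb C^k}$-module of germs at $0$ of holomorphic vector fields. $J_f\subset\mathcal O_{\mathbb C^n}$ (resp. $J_{f\circ F}\subset\mathcal O_{\mathbb C^m}$) is the ideal generated by the first-order partial derivatives of $f$ (resp. $f\circ F$). $\theta(F)\cong\mathcal O_{\mathbb C^m}^n$ is the module of germs of vector fields along $F$, and $tF:\theta_{\mathbb C^m}\to\theta(F)$ is $\xi\mapsto dF(\xi)$. $\operatorname{Der}(-\log f)=\{\chi\in\theta_{\mathbb C^n}:\chi\cdot f=0\}$, and $F^*(\operatorname{Der}(-\log f))\subset\theta(F)$ is the $\mathcal O_{\mathbb C^m}$-submodule generated by the composites $\chi\circ F$, $\chi\in\operatorname{Der}(-\log f)$. Set $T^1_{\mathcal K_f}F=\theta(F)/\bigl(tF(\theta_{\mathbb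 C^m})+F^*(\operatorname{Der}(-\log f))\bigr)$ and $\tau_{\mathcal K_f}F=\dim_{\mathbb C}T^1_{\mathcal K_f}F$. $\mu(f\circ F)=\dim_{\mathbb C}\mathcal O_{\mathbb C^m}/J_{f\circ F}$ is the Milnor number; $f\circ F$ has isolated singularity if this is finite. *)

(* Defs.v *)
From HB Require Import structures.
From mathcomp Require Import all_boot all_order all_algebra.
From mathcomp Require Import finmap complex ring_quotient generic_quotient.
From mathcomp Require Import boolp classical_sets functions cardinality fsbigop reals.
From mathcomp Require Import topology normedtype derive.
From mathcomp Require Import summability lra ring zify.
Set Implicit Arguments.
Unset Strict Implicit.
Unset Printing Implicit Defensive.
Import Order.TTheory GRing.Theory Num.Theory numFieldNormedType.Exports.
Local Open Scope classical_set_scope.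
Local Open Scope ring_scope.

(* Packed as a numClosedFieldType, because the topology of a numFieldType is
   found by canonical inference only through its packed form, not on R[i]. *)
Definition Cplx (R : realType) : numClosedFieldType := R[i]%C.

#[local] Existing Instance totally_filter.

Section Summation.
Variable R : realType.
Local Notation C := (Cplx R).

Definition nm (z : C) : R := complex.Re `|z|.

Lemma nmE z : `|z| = (nm z)%:C%C :> C.
Proof.
have : `|z| \is Num.real by exact: normr_real.
by rewrite /nm; case: (`|z|) => a b; rewrite complex_real /= => /eqP ->.
Qed.

Lemma nm_ltc z (e : R) : (`|z| < (e%:C)%C :> C) = (nm z < e).
Proof. by rewrite nmE ltcR. Qed.

Lemma nm_ge0 z : 0 <= nm z.
Proof. by rewrite -lecR -nmE normr_ge0. Qed.

Lemma nmD x y : nm (x + y) <= nm x + nm y.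
Proof. by rewrite -lecR rmorphD /= -!nmE ler_normD. Qed.

Lemma nmN x : nm (- x) = nm x.
Proof. by rewrite /nm normrN. Qed.

Lemma nmB x y : nm (x - y) = nm (y - x).
Proof. by rewrite /nm distrC. Qed.

Lemma nmM x y : nm (x * y) = nm x * nm y.
Proof.
by apply: (@complexI R); rewrite rmorphM /= -!nmE normrM.
Qed.

Lemma nm0 : nm 0 = 0.
Proof. by rewrite /nm normr0. Qed.

Lemma nm1 : nm 1 = 1.
Proof. by rewrite /nm normr1. Qed.

Lemma nm_real (r : R) : 0 <= r -> nm (r%:C)%C = r.
Proof. by move=> r0; rewrite /nm ger0_norm ?lecR. Qed.

Lemma nm_nat n : nm n%:R = n%:R.
Proof. by rewrite /nm normr_nat -[n%:R](rmorph_nat (real_complex R)). Qed.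

Lemma nmX x n : nm (x ^+ n) = nm x ^+ n.
Proof. by elim: n => [|n IH]; rewrite ?nm1// !exprS nmM IH. Qed.

Lemma nm_prod (I : Type) (s : seq I) (P : pred I) (f : I -> C) :
  nm (\prod_(i <- s | P i) f i) = \prod_(i <- s | P i) nm (f i).
Proof. by elim/big_rec2: _ => [|i y1 y2 _ <-]; rewrite ?nm1 ?nmM. Qed.

Lemma nm_sum (I : Type) (s : seq I) (f : I -> C) :
  nm (\sum_(i <- s) f i) <= \sum_(i <- s) nm (f i).
Proof.
elim/big_rec2: _ => [|i y1 y2 _ h]; first by rewrite nm0.
by rewrite (le_trans (nmD _ _))// lerD2l.
Qed.

Lemma nm_eq0 x : (forall e : R, 0 < e -> nm x < e) -> x = 0.
Proof.
move=> h; apply/eqP; rewrite -normr_eq0 nmE; apply/eqP.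
have -> : nm x = 0; last by [].
apply/eqP; rewrite eq_le nm_ge0 andbT leNgt; apply/negP => /[dup] x0 /h.
by rewrite ltxx.
Qed.

Lemma nm_ReIm x : nm x <= `|complex.Re x| + `|complex.Im x|.
Proof.
case: x => a b /=.
rewrite (_ : (a +i* b)%C = (a%:C)%C + 'i%C * (b%:C)%C :> C); last first.
  by exact: (complexE (a +i* b)%C).
rewrite (le_trans (nmD _ _))// nmM.
rewrite (_ : nm 'i%C = 1); last by rewrite /nm normc_def /= expr0n expr1n add0r sqrtr1.
by rewrite mul1r /nm !normc_def /= !expr0n !addr0 !sqrtr_sqr.
Qed.

Lemma Re_nm x : `|complex.Re x| <= nm x.
Proof.
rewrite /nm; case: x => a b; rewrite normc_def /= -sqrtr_sqr ler_wsqrtr//.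
by rewrite lerDl sqr_ge0.
Qed.

Lemma Im_nm x : `|complex.Im x| <= nm x.
Proof.
rewrite /nm; case: x => a b; rewrite normc_def /= -sqrtr_sqr ler_wsqrtr//.
by rewrite lerDr sqr_ge0.
Qed.

Section has_sum.
Local Open Scope fset_scope.
Local Open Scope ring_scope.

Definition has_sum (I : choiceType) (f : I -> C) (s : C) :=
  forall e : R, 0 < e -> exists A0 : {fset I}, forall A : {fset I},
    A0 `<=` A -> nm (\sum_(i <- A) f i - s) < e.

Lemma has_sumP (I : choiceType) (f : I -> C) (s : C) :
  (partial_sum f @ totally --> s) <-> has_sum f s.
Proof.
have E (A : {fset I}) : partial_sum f A = \sum_(i <- A) f i.
  by rewrite /partial_sum [RHS]big_seq_fsetE.
split => [/cvgrPdist_lt h e e0|h].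
  have /h[A0 _ hA] : 0 < (e%:C)%C :> C by rewrite ltcR.
  exists A0 => A /hA /=; rewrite E distrC nm_ltc//.
apply/cvgrPdist_lt => e e0.
have eE : e = ((complex.Re e)%:C)%C.
  case: e e0 => a b; rewrite ltcE /= => /andP[/eqP -> _]//.
have /h[A0 hA] : 0 < complex.Re e by rewrite -ltcR -eE.
exists A0 => // A /hA /=; rewrite E -nm_ltc -eE distrC//.
Qed.

Definition absbnd (I : choiceType) (f : I -> C) (M : R) :=
  forall A : {fset I}, \sum_(i <- A) nm (f i) <= M.

Lemma ler_sum_fset (I : choiceType) (f : I -> R) (A B : {fset I}) :
  A `<=` B -> (forall i, 0 <= f i) -> \sum_(i <- A) f i <= \sum_(i <- B) f i.
Proof.
move=> AB f0; rewrite [leRHS](big_fsetID _ (mem A))/= [X in _ <= X + _](_ : _ = \sum_(i <- A) f i).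
  by rewrite lerDl sumr_ge0.
by apply: eq_fbigl => i; rewrite !inE/= andb_idl//; exact/fsubsetP.
Qed.

Lemma sum_fsetD (V : zmodType) (I : choiceType) (f : I -> V) (A B : {fset I}) :
  A `<=` B -> \sum_(i <- B) f i - \sum_(i <- A) f i = \sum_(i <- B `\` A) f i.
Proof.
move=> AB; rewrite [X in X - _](big_fsetID _ (mem A))/=.
rewrite [X in X + _ - _](_ : _ = \sum_(i <- A) f i); last first.
  by apply: eq_fbigl => i; rewrite !inE/= andb_idl//; exact/fsubsetP.
rewrite addrC addrA addNr add0r.
by apply: eq_fbigl => i; rewrite !inE/= andbC.
Qed.

Lemma has_sum_unique (I : choiceType) (f : I -> C) s t :
  has_sum f s -> has_sum f t -> s = t.
Proof.
move=> fs ft; apply/eqP; rewrite -subr_eq0; apply/eqP/nm_eq0 => e e0.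
have e2 : 0 < e / 2 by lra.
have [A hA] := fs _ e2; have [B hB] := ft _ e2.
have := hA (A `|` B) (fsubsetUl _ _); have := hB (A `|` B) (fsubsetUr _ _).
set u := \sum_(_ <- _) _ => h1 h2.
rewrite (_ : s - t = (s - u) + (u - t)); last by rewrite addrA subrK.
rewrite (le_lt_trans (nmD _ _))// nmB; lra.
Qed.

Lemma has_sumD (I : choiceType) (f g : I -> C) s t :
  has_sum f s -> has_sum g t -> has_sum (fun i => f i + g i) (s + t).
Proof.
move=> fs ft e e0; have e2 : 0 < e / 2 by lra.
have [A hA] := fs _ e2; have [B hB] := ft _ e2.
exists (A `|` B) => D; rewrite fsubUset => /andP[/hA h1 /hB h2].
rewrite big_split/= opprD addrACA (le_lt_trans (nmD _ _))//; lra.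
Qed.

Lemma has_sumZ (I : choiceType) (f : I -> C) s a :
  has_sum f s -> has_sum (fun i => a * f i) (a * s).
Proof.
move=> fs e e0.
have a0 := nm_ge0 a.
have e2 : 0 < e / (nm a + 1) by rewrite divr_gt0//; lra.
have [A hA] := fs _ e2; exists A => D /hA.
rewrite -mulr_sumr -mulrBr nmM ltr_pdivlMr; last by lra.
have := nm_ge0 (\sum_(i <- D) f i - s); nra.
Qed.

Lemma has_sumN (I : choiceType) (f : I -> C) s :
  has_sum f s -> has_sum (fun i => - f i) (- s).
Proof.
move=> /(has_sumZ (-1)); rewrite mulN1r => h e /h[A hA].
by exists A => D /hA; under eq_bigr do rewrite mulN1r.
Qed.

Lemma has_sum_ext (I : choiceType) (f g : I -> C) s :
  (forall i, f i = g i) -> has_sum f s -> has_sum g s.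
Proof. by move=> fg; rewrite (_ : f = g)//; apply/funext. Qed.

Lemma has_sum_supp (I : choiceType) (f : I -> C) (A : {fset I}) :
  (forall i, i \notin A -> f i = 0) -> has_sum f (\sum_(i <- A) f i).
Proof.
move=> fA e e0; exists A => B AB; rewrite sum_fsetD//.
rewrite big_seq big1 ?nm0// => i; rewrite inE => /andP[iA _]; exact: fA.
Qed.

Lemma has_sum_le (I : choiceType) (f : I -> C) s (K : R) :
  has_sum f s -> absbnd f K -> nm s <= K.
Proof.
move=> fs fK; apply/ler_addgt0Pl => e e0; have [A /(_ A) hA] := fs _ e0.
have {hA} := hA (fsubset_refl _); rewrite nmB => hA.
rewrite -[s](subrK (\sum_(i <- A) f i)) (le_trans (nmD _ _))// lerD//; first exact: ltW.
exact: le_trans (nm_sum _ _) (fK _).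
Qed.

Lemma has_sum_real_bound (I : choiceType) (f : I -> C) (p : C -> R) (e : R)
    (D : {fset I}) (A0 : {fset I}) :
  (forall x, `|p x| <= nm x) ->
  (forall (B : {fset I}), p (\sum_(i <- B) f i) = \sum_(i <- B) p (f i)) ->
  (forall B : {fset I}, [disjoint A0 & B] -> nm (\sum_(i <- B) f i) <= e) ->
  [disjoint A0 & D] ->
  \sum_(i <- D) `|p (f i)| <= e *+ 2.
Proof.
move=> pnm pS hB AD.
rewrite (big_fsetID _ [pred i | 0 <= p (f i)])/= mulr2n lerD//.
  set B := [fset _ | _ in _ & _].
  rewrite (_ : \sum_(i <- B) _ = \sum_(i <- B) p (f i)); last first.
    by rewrite big_seq [RHS]big_seq; apply: eq_bigr => i; rewrite !inE => /andP[_ /ger0_norm].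
  rewrite -pS (le_trans (ler_norm _))// (le_trans (pnm _))// hB//.
  apply: fdisjointWr AD; apply/fsubsetP => i; rewrite !inE => /andP[]//.
set B := [fset _ | _ in _ & _].
rewrite (_ : \sum_(i <- B) _ = - \sum_(i <- B) p (f i)); last first.
  rewrite -sumrN big_seq [RHS]big_seq; apply: eq_bigr => i; rewrite !inE => /andP[_].
  by rewrite -ltNge => /ltr0_norm.
rewrite -pS (le_trans (ler_norm _))// normrN (le_trans (pnm _))// hB//.
apply: fdisjointWr AD; apply/fsubsetP => i; rewrite !inE => /andP[]//.
Qed.

Lemma has_sum_absbnd (I : choiceType) (f : I -> C) s :
  has_sum f s -> exists M, absbnd f M.
Proof.
move=> /(_ 1 ltr01) [A0 hA].
have h (B : {fset I}) : [disjoint A0 & B] -> nm (\sum_(i <- B) f i) <= 2.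
  move=> dB; have h1 := hA A0 (fsubset_refl _).
  have := hA (A0 `|` B) (fsubsetUl _ _) => h2.
  rewrite (_ : \sum_(i <- B) f i = (\sum_(i <- A0 `|` B) f i - s)
      - (\sum_(i <- A0) f i - s)).
    by rewrite (le_trans (nmD _ _))// nmN; lra.
  rewrite opprB addrA subrK sum_fsetD ?fsubsetUl//.
  by rewrite fsetDUl fsetDv fset0U; move: dB; rewrite fdisjoint_sym => /fsetDidPl ->.
exists (\sum_(i <- A0) nm (f i) + 2 *+ 2 + 2 *+ 2) => A.
rewrite (big_fsetID _ (mem A0))/= -addrA lerD//.
  apply: ler_sum_fset => [|i]; last exact: nm_ge0.
  by apply/fsubsetP => i; rewrite !inE => /andP[].
set D := [fset _ | _ in _ & _].
have dD : [disjoint A0 & D].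
  by apply/fdisjointP => i iA; rewrite !inE/= iA andbF.
apply: (@le_trans _ _ (\sum_(i <- D) (`|complex.Re (f i)| + `|complex.Im (f i)|))).
  by apply: ler_sum => i _; exact: nm_ReIm.
rewrite big_split/= lerD//.
  apply: (@has_sum_real_bound I f (@complex.Re R) 2 D A0) => //; first exact: Re_nm.
  by move=> B; rewrite raddf_sum.
apply: (@has_sum_real_bound I f (@complex.Im R) 2 D A0) => //; first exact: Im_nm.
by move=> B; rewrite raddf_sum.
Qed.

Lemma absbnd_tail (I : choiceType) (f : I -> C) M (e : R) : 0 < e ->
  absbnd f M -> exists B : {fset I}, forall D, [disjoint B & D] ->
   \sum_(i <- D) nm (f i) <= e.
Proof.
move=> e0 fM.
pose S := range (fun A : {fset I} => \sum_(i <- A) nm (f i)).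
have hS : has_sup S.
  by split; [exists (\sum_(i <- fset0) nm (f i)), fset0 | exists M => _ [A _ <-]].
have [_ [B _ <-] hB] := sup_adherent e0 hS.
exists B => D dD; have : \sum_(i <- B `|` D) nm (f i) <= sup S.
  by apply: sup_upper_bound => //; exists (B `|` D).
have := sum_fsetD (fun i => nm (f i)) (fsubsetUl B D).
rewrite fsetDUl fsetDv fset0U; move: dD; rewrite fdisjoint_sym => /fsetDidPl ->.
lra.
Qed.

Lemma has_sum_nneg (I : choiceType) (f : I -> R) (M : R) :
  (forall i, 0 <= f i) -> (forall A : {fset I}, \sum_(i <- A) f i <= M) ->
  exists s : R, has_sum (fun i => (f i)%:C%C) s%:C%C.
Proof.
move=> f0 fM.
pose S := range (fun A : {fset I} => \sum_(i <- A) f i).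
have hS : has_sup S.
  by split; [exists (\sum_(i <- fset0) f i), fset0 | exists M => _ [A _ <-]].
exists (sup S) => e e0; have [_ [B _ <-] hB] := sup_adherent e0 hS.
exists B => A BA; rewrite -rmorph_sum nmB -rmorphB nm_real.
  rewrite ltrBlDl -ltrBlDr (lt_le_trans hB)//; exact: ler_sum_fset.
by rewrite subr_ge0; apply: sup_upper_bound => //; exists A.
Qed.

Lemma has_sum_real (I : choiceType) (f : I -> R) (M : R) :
  (forall A : {fset I}, \sum_(i <- A) `|f i| <= M) ->
  exists s : R, has_sum (fun i => (f i)%:C%C) s%:C%C.
Proof.
move=> fM.
have [A|s1 h1] := @has_sum_nneg I (fun i => `|f i|) M (fun i => normr_ge0 _); first exact: fM.
have [i|A|s2 h2] := @has_sum_nneg I (fun i => `|f i| - f i) (M *+ 2).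
- by rewrite subr_ge0 ler_norm.
- apply: (@le_trans _ _ (\sum_(i <- A) (`|f i| + `|f i|))).
    by apply: ler_sum => i _; rewrite lerD2l -normrN ler_norm.
  by rewrite big_split/= mulr2n lerD.
exists (s1 - s2); rewrite rmorphB/=.
apply: has_sum_ext (has_sumD h1 (has_sumN h2)) => i /=.
by rewrite -rmorphB/=; congr (_%:C)%C; rewrite opprB addrC subrK.
Qed.

Lemma absbnd_has_sum (I : choiceType) (f : I -> C) (M : R) :
  absbnd f M -> exists s, has_sum f s.
Proof.
move=> fM.
have [A|s1 h1] := @has_sum_real I (fun i => complex.Re (f i)) M.
  by rewrite (le_trans _ (fM A))// ler_sum// => i _; exact: Re_nm.
have [A|s2 h2] := @has_sum_real I (fun i => complex.Im (f i)) M.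
  by rewrite (le_trans _ (fM A))// ler_sum// => i _; exact: Im_nm.
exists (s1%:C%C + 'i%C * s2%:C%C).
by apply: has_sum_ext (has_sumD h1 (has_sumZ 'i%C h2)) => i; rewrite [RHS]complexE.
Qed.

Lemma sum_fsetM (V : nmodType) (I J : choiceType) (u : I -> J -> V)
   (A : {fset I}) (B : {fset J}) :
  \sum_(p <- A `*` B) u p.1 p.2 = \sum_(i <- A) \sum_(j <- B) u i j.
Proof.
rewrite -(big_allpairs (r1 := A) (r2 := B) (F := fun p => u p.1 p.2)).
apply: perm_big; apply: uniq_perm; first exact: fset_uniq.
  by apply: allpairs_uniq => // -[a b] [c d].
move=> [i j]; rewrite in_fsetM; apply/andP/allpairsP => /= [[iA jB]|[[i' j'] /= [? ? [-> ->]]]//].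
by exists (i, j).
Qed.

Lemma has_sum_many (I J : choiceType) (v : J -> I -> C) (c : J -> C) (e : R)
    (A : {fset J}) (B0 : {fset I}) : 0 < e ->
  (forall j, has_sum (v j) (c j)) ->
  exists2 B : {fset I}, B0 `<=` B &
    \sum_(j <- A) nm (\sum_(i <- B) v j i - c j) < e.
Proof.
move=> e0 vc.
pose e' := e / (size A).+1%:R.
have e'0 : 0 < e' by rewrite divr_gt0.
have /choice[Bf hB] := fun j => vc j _ e'0.
pose B := B0 `|` \bigcup_(j <- A) Bf j.
exists B; first exact: fsubsetUl.
apply: (@le_lt_trans _ _ (\sum_(j <- A) e')).
  rewrite big_seq [leRHS]big_seq; apply: ler_sum => j jA; apply/ltW/hB.
  by rewrite (fsubset_trans _ (fsubsetUr _ _))// bigfcup_sup.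
rewrite big_const_seq count_predT iter_addr_0 -mulr_natr /e' -mulrA mulrC.
rewrite gtr_pMl// mulrC ltr_pdivrMr// mul1r ltr_nat//.
Qed.

Lemma absbnd_cols (I J : choiceType) (u : I -> J -> C) (c : J -> C) M :
  absbnd (fun p : I * J => u p.1 p.2) M ->
  (forall j, has_sum (u^~ j) (c j)) -> absbnd c M.
Proof.
move=> uM uc A; apply/ler_addgt0Pl => e e0.
have [B _ hB] := has_sum_many A fset0 e0 uc.
apply: (@le_trans _ _ (\sum_(j <- A) (nm (\sum_(i <- B) u i j - c j)
   + \sum_(i <- B) nm (u i j)))).
  apply: ler_sum => j _; rewrite nmB.
  rewrite -[X in nm X <= _](subrK (\sum_(i <- B) u i j)) (le_trans (nmD _ _))//.
  by rewrite lerD2l nm_sum.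
rewrite big_split/= lerD//; first exact: ltW.
rewrite exchange_big/= -(sum_fsetM (fun i j => nm (u i j))).
exact: uM.
Qed.

Lemma has_sum_fubini (I J : choiceType) (u : I -> J -> C) (r : I -> C) (c : J -> C)
    (s : C) (M : R) :
  absbnd (fun p : I * J => u p.1 p.2) M ->
  (forall i, has_sum (u i) (r i)) -> (forall j, has_sum (u^~ j) (c j)) ->
  has_sum r s -> has_sum c s.
Proof.
move=> uM ur uc rs e e0.
have e5 : 0 < e / 6 by lra.
have [B hB] := absbnd_tail e5 uM.
have [A0 hA0] := rs _ e5.
exists [fset p.2 | p in B] => A2 BA2.
pose A1 := A0 `|` [fset p.1 | p in B].
have [B' A2B' hB'] := has_sum_many A1 A2 e5 ur.
have [A1' A1A1' hA1'] := has_sum_many A2 A1 e5 uc.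
have h1 := hA0 A1 (fsubsetUl _ _).
have key (P1 : {fset I}) (P2 : {fset J}) : A1 `<=` P1 -> A2 `<=` P2 ->
    nm (\sum_(i <- P1) \sum_(j <- P2) u i j - \sum_(p <- B) u p.1 p.2) <= e / 6.
  move=> AP1 AP2; rewrite -sum_fsetM sum_fsetD; last first.
    apply/fsubsetP => p pB; rewrite in_fsetM; apply/andP; split.
      apply: (fsubsetP AP1); rewrite inE; apply/orP; right.
      by apply/imfsetP; exists p.
    by apply: (fsubsetP AP2); apply: (fsubsetP BA2); apply/imfsetP; exists p.
  rewrite (le_trans (nm_sum _ _))// hB//.
  by apply/fdisjointP => p pB; rewrite inE pB.
have k1 := key A1 B' (fsubset_refl _) A2B'.
have k2 := key A1' A2 A1A1' (fsubset_refl _).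
have h2 : nm (\sum_(i <- A1) \sum_(j <- B') u i j - \sum_(i <- A1) r i) < e / 6.
  by rewrite -sumrB (le_lt_trans (nm_sum _ _)).
have h3 : nm (\sum_(i <- A1') \sum_(j <- A2) u i j - \sum_(j <- A2) c j) < e / 6.
  by rewrite exchange_big -sumrB (le_lt_trans (nm_sum _ _)).
move: h1 h2 h3 k1 k2.
move: (\sum_(i <- A1) \sum_(j <- B') u i j) (\sum_(i <- A1) r i)
  (\sum_(i <- A1') \sum_(j <- A2) u i j) (\sum_(j <- A2) c j)
  (\sum_(p <- B) u p.1 p.2) => x y z t w.
rewrite [nm (z - t)]nmB [nm (x - w)]nmB => h1 h2 h3 k1 k2.
rewrite (_ : t - s = (t - z) + ((z - w) + ((w - x) + ((x - y) + (y - s))))); last by ring.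
have := nmD (t - z) ((z - w) + ((w - x) + ((x - y) + (y - s)))).
have := nmD (z - w) ((w - x) + ((x - y) + (y - s))).
have := nmD (w - x) ((x - y) + (y - s)).
have := nmD (x - y) (y - s).
lra.
Qed.

End has_sum.
End Summation.

Notation multiindex k := {ffun 'I_k -> nat}.

Definition monomial (K : comNzRingType) k (x : 'rV[K]_k) (a : multiindex k) : K :=
  \prod_i x ord0 i ^+ a i.

Section PowerSeries.
Variable R : realType.
Local Notation C := (Cplx R).

Section has_sum2.
Local Open Scope fset_scope.
Local Open Scope ring_scope.

Lemma sum_fset_inj (I J : choiceType) (f : I -> R) (g : J -> R) (h : I -> J)
   (A : {fset I}) (B : {fset J}) : (forall j, 0 <= g j) ->
   {in A &, injective h} -> {in A, forall i, h i \in B} ->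
   {in A, forall i, f i <= g (h i)} ->
   \sum_(i <- A) f i <= \sum_(j <- B) g j.
Proof.
move=> g0 hI hB fg.
apply: (@le_trans _ _ (\sum_(j <- [fset h i | i in A]) g j)).
  by rewrite big_imfset//= big_seq [leRHS]big_seq; exact: ler_sum.
by apply: ler_sum_fset => //; apply/fsubsetP => j /imfsetP[i /= iA ->]; exact: hB.
Qed.

Lemma absbnd_inj (I J : choiceType) (f : I -> C) (g : J -> C) (h : I -> J) M :
  (forall i i', f i != 0 -> f i' != 0 -> h i = h i' -> i = i') ->
  (forall i, nm (f i) <= nm (g (h i))) -> absbnd g M -> absbnd f M.
Proof.
move=> hI fg gM A.
rewrite (big_fsetID _ [pred i | f i != 0])/= [X in _ + X]big_seq [X in _ + X]big1; last first.
  by move=> i; rewrite !inE => /andP[_ /negPn/eqP ->]; rewrite nm0.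
rewrite addr0; apply: le_trans (gM [fset h i | i in A]).
apply: (sum_fset_inj (h := h)) => [j|i i'|i|i].
- exact: nm_ge0.
- by rewrite !inE => /andP[_ i0] /andP[_ i'0]; exact: hI.
- by rewrite !inE => /andP[iA _]; apply/imfsetP; exists i.
- by move=> _; exact: fg.
Qed.

Lemma absbnd_le (I : choiceType) (f g : I -> C) M :
  (forall i, nm (f i) <= nm (g i)) -> absbnd g M -> absbnd f M.
Proof. by move=> fg gM A; rewrite (le_trans _ (gM A))// ler_sum. Qed.

Lemma absbndD (I : choiceType) (f g : I -> C) M N :
  absbnd f M -> absbnd g N -> absbnd (fun i => f i + g i) (M + N).
Proof.
move=> fM gN A; apply: le_trans (lerD (fM A) (gN A)).
by rewrite -big_split/= ler_sum// => i _; exact: nmD.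
Qed.

Lemma absbndZ (I : choiceType) (f : I -> C) a M :
  absbnd f M -> absbnd (fun i => a * f i) (nm a * M).
Proof.
move=> fM A; under eq_bigr do rewrite nmM.
by rewrite -mulr_sumr ler_wpM2l ?nm_ge0.
Qed.

Lemma absbnd_ge0 (I : choiceType) (f : I -> C) M : absbnd f M -> 0 <= M.
Proof. by move=> /(_ fset0); rewrite big_seq_fset0. Qed.

Lemma absbnd_supp1 (I : choiceType) (f : I -> C) i0 :
  (forall i, i != i0 -> f i = 0) -> absbnd f (nm (f i0)).
Proof.
move=> fi A; have [iA|iA] := boolP (i0 \in A).
  rewrite (big_fsetD1 i0)//= big_seq big1 ?addr0// => i.
  by rewrite !inE => /andP[ii0 _]; rewrite fi ?nm0.
rewrite big_seq big1 ?nm_ge0// => i jA; rewrite fi ?nm0//.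
by apply: contraNneq iA => <-.
Qed.

Lemma has_sum_supp1 (I : choiceType) (f : I -> C) i0 :
  (forall i, i != i0 -> f i = 0) -> has_sum f (f i0).
Proof.
move=> fi; have := @has_sum_supp R I f [fset i0]; rewrite big_seq_fset1.
by apply=> i; rewrite inE; exact: fi.
Qed.

Lemma has_sum_inj (I J : choiceType) (h : I -> J) (f : J -> C) s :
  injective h -> (forall j, (forall i, j <> h i) -> f j = 0) ->
  has_sum (fun i => f (h i)) s -> has_sum f s.
Proof.
move=> hI f0 hs e e0; have [A hA] := hs _ e0.
exists [fset h i | i in A] => B AB.
have [E hE] : exists E : {fset I}, forall i, (i \in E) = (h i \in B).
  have fin : finite_set [set i | h i \in B].
    apply: (@finite_preimage _ _ [set` B] h); last exact: finite_fset.
    by move=> i j _ _; exact: hI.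
  by exists (fset_set [set i | h i \in B]) => i; rewrite in_fset_set//; apply/idP/idP; rewrite inE.
have -> : \sum_(j <- B) f j = \sum_(i <- E) f (h i).
  transitivity (\sum_(j <- [fset h i | i in E]) f j); last first.
    by rewrite big_imfset//= => i j _ _; exact: hI.
  have sub : [fset h i | i in E] `<=` B.
    by apply/fsubsetP => j /imfsetP[i /= iE ->]; rewrite -hE.
  apply/eqP; rewrite -subr_eq0 sum_fsetD// big_seq big1// => j.
  rewrite inE => /andP[jE jB]; apply: f0 => i ji; case/negP: jE.
  by apply/imfsetP; exists i => //=; rewrite hE -ji.
apply: hA; apply/fsubsetP => i iA; rewrite hE; apply: (fsubsetP AB).
by apply/imfsetP; exists i.
Qed.

End has_sum2.

Section Rep.
Variable k : nat.
Implicit Types (x : 'rV[C]_k) (a b : multiindex k) (s M : R).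

Definition wt s a : R := \prod_i s ^+ a i.

Lemma monomialD x a b : monomial x (a + b) = monomial x a * monomial x b.
Proof.
by rewrite /monomial -big_split/=; apply: eq_bigr => i _; rewrite ffunE exprD.
Qed.

Lemma monomial0 x : monomial x 0 = 1.
Proof. by rewrite /monomial big1// => i _; rewrite ffunE expr0. Qed.

Lemma wtD s a b : wt s (a + b) = wt s a * wt s b.
Proof. by rewrite /wt -big_split/=; apply: eq_bigr => i _; rewrite ffunE exprD. Qed.

Lemma wt0 s : wt s 0 = 1.
Proof. by rewrite /wt big1// => i _; rewrite ffunE expr0. Qed.

Lemma wt_gt0 s a : 0 < s -> 0 < wt s a.
Proof. by move=> s0; rewrite prodr_gt0// => i _; rewrite exprn_gt0. Qed.

Lemma wt_ge0 s a : 0 <= s -> 0 <= wt s a.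
Proof. by move=> s0; rewrite prodr_ge0// => i _; rewrite exprn_ge0. Qed.

Lemma nm_monomial x a s : (forall i, nm (x ord0 i) <= s) -> nm (monomial x a) <= wt s a.
Proof.
move=> xs; rewrite nm_prod; apply: ler_prod => i _; rewrite nmX exprn_ge0 ?nm_ge0//=.
by rewrite lerXn2r ?nnegrE ?nm_ge0// (le_trans (nm_ge0 _) (xs i)).
Qed.

Lemma powle (t s : R) n : 0 < t -> t <= s -> t ^+ n <= s ^+ n.
Proof.
by move=> t0 ts; rewrite lerXn2r ?nnegrE// ltW//; exact: lt_le_trans t0 ts.
Qed.

Lemma wt_le (t s : R) a : 0 < t -> t <= s -> wt t a <= wt s a.
Proof.
move=> t0 ts; apply: ler_prod => i _; rewrite powle// andbT exprn_ge0//.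
exact: ltW.
Qed.

Definition Rep s M (g : 'rV[C]_k -> C) := exists c : multiindex k -> C,
  absbnd (fun a => c a * (wt s a)%:C%C) M /\
  forall x, (forall i, nm (x ord0 i) <= s) -> has_sum (fun a => c a * monomial x a) (g x).

Lemma nm_wt s (z : C) a : 0 < s -> nm (z * (wt s a)%:C%C) = nm z * wt s a.
Proof. by move=> s0; rewrite nmM nm_real// ltW// wt_gt0. Qed.

Lemma absbnd_monomial s M (c : multiindex k -> C) x : 0 < s ->
  (forall i, nm (x ord0 i) <= s) ->
  absbnd (fun a => c a * (wt s a)%:C%C) M -> absbnd (fun a => c a * monomial x a) M.
Proof.
move=> s0 xs; apply: absbnd_le => a; rewrite nm_wt// nmM ler_wpM2l ?nm_ge0//.
exact: nm_monomial.
Qed.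

Lemma Rep_ge0 s M g : Rep s M g -> 0 <= M.
Proof. by case=> c [/absbnd_ge0]. Qed.

Lemma Rep_bound s M g x : 0 < s -> Rep s M g -> (forall i, nm (x ord0 i) <= s) ->
  nm (g x) <= M.
Proof.
move=> s0 [c [cM cg]] xs; apply: has_sum_le (cg _ xs) _; exact: absbnd_monomial cM.
Qed.

Lemma Rep_ext s M g h :
  (forall x, (forall i, nm (x ord0 i) <= s) -> g x = h x) -> Rep s M g -> Rep s M h.
Proof. by move=> gh [c [cM cg]]; exists c; split=> // x xs; rewrite -gh//; exact: cg. Qed.

Lemma Rep_le s t M g : 0 < t -> t <= s -> Rep s M g -> Rep t M g.
Proof.
move=> t0 ts [c [cM cg]]; have s0 := lt_le_trans t0 ts; exists c; split; last first.
  by move=> x xt; apply: cg => i; exact: le_trans (xt i) ts.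
apply: absbnd_le cM => a; rewrite !nm_wt// ler_wpM2l ?nm_ge0//.
exact: wt_le.
Qed.

Lemma RepD s M N g h : Rep s M g -> Rep s N h -> Rep s (M + N) (fun x => g x + h x).
Proof.
move=> [c [cM cg]] [d [dM dh]]; exists (fun a => c a + d a); split.
  by have := absbndD cM dM; apply: absbnd_le => a; rewrite mulrDl.
move=> x xs; apply: has_sum_ext (has_sumD (cg _ xs) (dh _ xs)) => a.
by rewrite mulrDl.
Qed.

Lemma RepZ s M (a : C) g : Rep s M g -> Rep s (nm a * M) (fun x => a * g x).
Proof.
move=> [c [cM cg]]; exists (fun b => a * c b); split.
  by have := absbndZ a cM; apply: absbnd_le => b; rewrite mulrA.
by move=> x xs; apply: has_sum_ext (has_sumZ a (cg _ xs)) => b; rewrite mulrA.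
Qed.

Lemma Rep_cst s (z : C) : 0 < s -> Rep s (nm z) (fun=> z).
Proof.
move=> s0; pose c a : C := if a == 0 then z else 0.
have c0 a : a != 0 -> c a = 0 by rewrite /c => /negPf ->.
exists c; split.
  have := @absbnd_supp1 _ (fun a => c a * (wt s a)%:C%C) 0.
  rewrite nm_wt// wt0 mulr1 /c eqxx; apply=> a a0.
  by rewrite (negPf a0) mul0r.
move=> x xs; have := @has_sum_supp1 _ (fun a => c a * monomial x a) 0.
by rewrite /c eqxx monomial0 mulr1; apply => a /negPf ->; rewrite mul0r.
Qed.

Lemma Rep_series (J : choiceType) (a : J -> C) (g : J -> 'rV[C]_k -> C) (N : J -> R)
    s M (G : 'rV[C]_k -> C) : 0 < s ->
  (forall j, Rep s (N j) (g j)) ->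
  (forall A : {fset J}, \sum_(j <- A) nm (a j) * N j <= M) ->
  (forall x, (forall i, nm (x ord0 i) <= s) -> has_sum (fun j => a j * g j x) (G x)) ->
  Rep s M G.
Proof.
move=> s0 /choice[B hB] aM hG.
have uM : absbnd (fun p : J * multiindex k => a p.1 * B p.1 p.2 * (wt s p.2)%:C%C) M.
  move=> A.
  pose P1 := [fset p.1 | p in A]%fset; pose P2 := [fset p.2 | p in A]%fset.
  apply: (@le_trans _ _ (\sum_(p <- (P1 `*` P2)%fset)
      nm (a p.1 * B p.1 p.2 * (wt s p.2)%:C%C))).
    apply: ler_sum_fset => [|p]; last exact: nm_ge0.
    apply/fsubsetP => p pA; rewrite in_fsetM; apply/andP.
    by split; apply/imfsetP; exists p.
  rewrite (sum_fsetM (fun j b => nm (a j * B j b * (wt s b)%:C%C))).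
  apply: le_trans (aM P1); apply: ler_sum => j _.
  under eq_bigr do rewrite -mulrA nmM.
  by rewrite -mulr_sumr ler_wpM2l ?nm_ge0//; have [+ _] := hB j; apply.
have /choice[c hc] b : exists cb, has_sum (fun j => a j * B j b) cb.
  apply: (@absbnd_has_sum _ _ _ (M / wt s b)) => A.
  rewrite ler_pdivlMr ?wt_gt0// mulr_suml.
  apply: le_trans (uM [fset (j, b) | j in A]%fset).
  rewrite big_imfset/=; last by move=> ? ? _ _ [].
  by apply: ler_sum => j _; rewrite nm_wt.
exists c; split.
  apply: (@absbnd_cols _ _ _ (fun j b => a j * B j b * (wt s b)%:C%C)) => // b.
  by rewrite mulrC; apply: has_sum_ext (has_sumZ _ (hc b)) => j; rewrite mulrC.
move=> x xs.
apply: (@has_sum_fubini _ _ _ (fun j b => a j * B j b * monomial x b)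
   (fun j => a j * g j x) _ _ M _ _ _ (hG x xs)).
- apply: absbnd_le uM => -[j b] /=; rewrite nm_wt// nmM ler_wpM2l ?nm_ge0//.
  exact: nm_monomial.
- move=> j; have [_ /(_ x xs) h] := hB j.
  by apply: has_sum_ext (has_sumZ (a j) h) => b; rewrite mulrA.
- move=> b; rewrite mulrC; apply: has_sum_ext (has_sumZ _ (hc b)) => j.
  by rewrite mulrC.
Qed.

Lemma Rep_shift s M g a : 0 < s -> Rep s M g ->
  Rep s (wt s a * M) (fun x => monomial x a * g x).
Proof.
move=> s0 [c [cM cg]].
pose le b := [forall i, a i <= b i]%N.
pose sub b : multiindex k := [ffun i => b i - a i]%N.
have subK b : le b -> b = a + sub b.
  by move/forallP => ab; apply/ffunP => i; rewrite !ffunE /= natrDE subnKC.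
have addK b : sub (a + b) = b by apply/ffunP => i; rewrite !ffunE natrDE addKn.
have leD b : le (a + b) by apply/forallP => i; rewrite ffunE natrDE leq_addr.
pose d b := if le b then c (sub b) else 0.
exists d; split.
  have := absbndZ ((wt s a)%:C)%C cM; rewrite nm_real ?wt_ge0 1?ltW//.
  apply: (@absbnd_inj _ _ _ _ sub) => [b b'|b]; rewrite /d.
    case: ifP => [/subK hb _|_]; last by rewrite mul0r eqxx.
    case: ifP => [/subK hb' _|_]; last by rewrite mul0r eqxx.
    by rewrite hb {2}hb' => h; rewrite hb' -h {1}hb !addK.
  case: ifP => [/subK hb|_]; last by rewrite mul0r nm0 nm_ge0.
  by rewrite {2}hb wtD rmorphM/= mulrCA.
move=> x xs; apply: (@has_sum_inj _ _ (fun b => a + b)).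
- by move=> b b' h; rewrite -[b]addK h addK.
- move=> b bE; rewrite /d; case: ifP => [/subK hb|]; last by rewrite mul0r.
  by case: (bE (sub b)).
- apply: has_sum_ext (has_sumZ (monomial x a) (cg x xs)) => b.
  by rewrite /d leD addK monomialD mulrCA.
Qed.

Lemma RepM s M N g h : 0 < s -> Rep s M g -> Rep s N h ->
  Rep s (M * N) (fun x => g x * h x).
Proof.
move=> s0 [c [cM cg]] hN; have N0 := Rep_ge0 hN.
apply: (@Rep_series _ c (fun a x => monomial x a * h x) (fun a => wt s a * N)) => //.
- by move=> a; exact: Rep_shift.
- move=> A; under eq_bigr do rewrite mulrA.
  rewrite -mulr_suml ler_wpM2r//; apply: le_trans (cM A).
  by apply: ler_sum => a _; rewrite nm_wt.
- move=> x xs; rewrite mulrC; apply: has_sum_ext (has_sumZ (h x) (cg x xs)) => a.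
  by rewrite mulrC mulrA.
Qed.

Lemma RepX s M g n : 0 < s -> Rep s M g -> Rep s (M ^+ n) (fun x => g x ^+ n).
Proof.
move=> s0 gM; elim: n => [|n IH].
  by rewrite expr0 -(nm1 R); exact: Rep_cst.
rewrite exprS; apply: Rep_ext (RepM s0 gM IH) => x _.
by rewrite exprS.
Qed.

Lemma Rep_prod (I : Type) (r : seq I) s (M : I -> R) g : 0 < s ->
  (forall i, Rep s (M i) (g i)) ->
  Rep s (\prod_(i <- r) M i) (fun x => \prod_(i <- r) g i x).
Proof.
move=> s0 gM; elim: r => [|i r IH].
  rewrite big_nil; apply: (@Rep_ext _ _ (fun=> 1)) => [x _|]; first by rewrite big_nil.
  by rewrite -(nm1 R); exact: Rep_cst.
rewrite big_cons; apply: Rep_ext (RepM s0 (gM i) IH) => x _.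
by rewrite big_cons.
Qed.

Lemma Rep_small s t M g : 0 < t -> t <= s -> g 0 = 0 -> Rep s M g ->
  Rep t (t / s * M) g.
Proof.
move=> t0 ts g0 [c [cM cg]]; have s0 := lt_le_trans t0 ts; exists c; split; last first.
  by move=> x xt; apply: cg => i; exact: le_trans (xt i) ts.
have c0 : c 0 = 0.
  have h0 i : nm ((0 : 'rV[C]_k) ord0 i) <= s by rewrite mxE nm0 ltW.
  have := cg 0 h0; rewrite g0.
  have h1 : forall a, a != 0 -> c a * monomial (0 : 'rV[C]_k) a = 0.
    move=> a a0; have [i ai] : exists i, a i != 0%N.
      apply: contrapT => h; case/eqP: a0; apply/ffunP => i; rewrite ffunE; apply/eqP.
      by apply: contra_notT h => ai; exists i.
    rewrite /monomial (bigD1 i)//= mxE.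
    by case: (a i) ai => // n _; rewrite expr0n /= mul0r mulr0.
  by move/(has_sum_unique (has_sum_supp1 h1)); rewrite monomial0 mulr1.
have [t0' s0'] : 0 <= t /\ 0 <= s by rewrite !ltW.
have ts0 : 0 <= t / s by rewrite divr_ge0.
have := absbndZ ((t / s)%:C)%C cM; rewrite nm_real//.
apply: absbnd_le => a; rewrite nm_wt// mulrCA nmM.
have [->|a0] := eqVneq a 0; first by rewrite c0 nm0 !mul0r.
rewrite nmM !nm_real ?wt_ge0// ler_wpM2l ?nm_ge0//.
have [i ai] : exists i, a i != 0%N.
  apply: contrapT => h; case/eqP: a0; apply/ffunP => i; rewrite ffunE; apply/eqP.
  by apply: contra_notT h => ai; exists i.
rewrite /wt (bigD1 i)//= [X in _ <= _ * X](bigD1 i)//= mulrA.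
apply: ler_pM.
- by rewrite exprn_ge0// ltW.
- by rewrite prodr_ge0// => j _; rewrite exprn_ge0// ltW.
- case: (a i) ai => // n _; rewrite !exprS mulrA divfK ?gt_eqF// ler_wpM2l//.
  exact: powle.
- apply: ler_prod => j _; rewrite powle// andbT exprn_ge0//.
Qed.

End Rep.

Lemma Rep_comp m n (f : 'rV[C]_n -> C) (F : 'rV[C]_m -> 'rV[C]_n) (s r M : R) :
  0 < s -> 0 < r -> Rep r M f -> (forall i, Rep s r (fun x => F x ord0 i)) ->
  Rep s M (f \o F).
Proof.
move=> s0 r0 [c [cM cf]] FM.
apply: (@Rep_series _ _ c (fun a x => monomial (F x) a) (fun a => wt r a)) => //.
- by move=> a; apply: Rep_prod => // i; exact: RepX.
- move=> A; apply: le_trans (cM A).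
  by apply: ler_sum => a _; rewrite nm_wt.
- by move=> x xs; apply: cf => i; exact: Rep_bound (FM i) xs.
Qed.

End PowerSeries.

Section Holo.
Variable R : realType.
Local Notation C := (Cplx R).

Lemma near0P k (P : 'rV[C]_k -> Prop) :
  (\forall x \near (0 : 'rV[C]_k), P x) <->
  exists2 r : R, 0 < r & forall x : 'rV[C]_k, (forall i, nm (x ord0 i) < r) -> P x.
Proof.
split=> [/nbhs_ballP[e /= e0 he]|[r r0 hr]].
  have eE : e = ((complex.Re e)%:C)%C.
    by case: e e0 he => a b; rewrite ltcE /= => /andP[/eqP -> _].
  exists (complex.Re e); first by rewrite -ltcR -eE.
  move=> x xe; apply: he; split => // i j; rewrite (ord1 i) /ball/= mxE sub0r normrN.
  by rewrite eE nm_ltc.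
apply/nbhs_ballP; exists ((r%:C)%C); first by rewrite /= ltcR.
move=> x [_ hx]; apply: hr => i; have := hx ord0 i.
by rewrite /ball/= mxE sub0r normrN nm_ltc.
Qed.

(* f is holomorphic on a neighbourhood of 0: near 0 it is the sum of a power
   series. The sum is taken along the filter of finite sets of multi-indices;
   in C this unordered convergence is the same as absolute convergence. The
   values of f away from 0 are irrelevant. *)
Definition holomorphic_at0 k (f : 'rV[C]_k -> C) := exists c : multiindex k -> C,
  \forall x \near (0 : 'rV[C]_k),
    partial_sum (fun a => c a * monomial x a) @ totally --> f x.

Lemma holoP k (f : 'rV[C]_k -> C) :
  holomorphic_at0 f <-> exists s M, 0 < s /\ Rep s M f.
Proof.
split=> [[c /near0P[r r0 hr]]|[s [M [s0 [c [cM cf]]]]]]; last first.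
  exists c; apply/near0P; exists s => // x xs; apply/has_sumP; apply: cf => i.
  exact/ltW.
pose s := r / 2; have s0 : 0 < s by rewrite /s; lra.
have sr : s < r by rewrite /s; lra.
have hs (x : 'rV[C]_k) : (forall i, nm (x ord0 i) <= s) -> has_sum (fun a => c a * monomial x a) (f x).
  by move=> xs; apply/has_sumP; apply: hr => i; exact: le_lt_trans (xs i) sr.
have hx i : nm ((const_mx s%:C%C : 'rV[C]_k) ord0 i) <= s.
  by rewrite mxE nm_real// ltW.
have [M hM] := has_sum_absbnd (hs _ hx).
exists s, M; split => //; exists c; split => //.
apply: absbnd_le hM => a; rewrite /wt rmorph_prod /monomial.
by under [X in _ <= nm (_ * X)]eq_bigr do rewrite mxE -rmorphXn.
Qed.

Lemma holo_eq k (f g : 'rV[C]_k -> C) :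
  (\forall x \near (0 : 'rV[C]_k), f x = g x) -> holomorphic_at0 f -> holomorphic_at0 g.
Proof.
move=> fg [c hc]; exists c; near=> x.
have <- : f x = g x by near: x.
by near: x.
Unshelve. all: by end_near. Qed.

Lemma Rep2 k (f g : 'rV[C]_k -> C) : holomorphic_at0 f -> holomorphic_at0 g ->
  exists s M N, [/\ 0 < s, Rep s M f & Rep s N g].
Proof.
move=> /holoP[s [M [s0 hf]]] /holoP[t [N [t0 hg]]].
have m0 : 0 < Num.min s t by rewrite lt_min s0.
exists (Num.min s t), M, N; split=> //; [apply: Rep_le hf|apply: Rep_le hg] => //.
  by rewrite ge_min lexx.
by rewrite ge_min lexx orbT.
Qed.

Lemma holoD k (f g : 'rV[C]_k -> C) : holomorphic_at0 f -> holomorphic_at0 g ->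
  holomorphic_at0 (fun x => f x + g x).
Proof.
move=> hf hg; have [s [M [N [s0 fM gN]]]] := Rep2 hf hg.
by apply/holoP; exists s, (M + N); split => //; exact: RepD.
Qed.

Lemma holoM k (f g : 'rV[C]_k -> C) : holomorphic_at0 f -> holomorphic_at0 g ->
  holomorphic_at0 (fun x => f x * g x).
Proof.
move=> hf hg; have [s [M [N [s0 fM gN]]]] := Rep2 hf hg.
by apply/holoP; exists s, (M * N); split => //; exact: RepM.
Qed.

Lemma holo_cst k (z : C) : holomorphic_at0 (fun _ : 'rV[C]_k => z).
Proof. by apply/holoP; exists 1, (nm z); split => //; exact: Rep_cst. Qed.

Lemma Rep_common m n (F : 'rV[C]_m -> 'rV[C]_n) (r : R) : 0 < r ->
  (forall i, holomorphic_at0 (fun x => F x ord0 i)) -> F 0 = 0 ->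
  exists2 s, 0 < s & forall i, Rep s r (fun x => F x ord0 i).
Proof.
move=> r0 hF F0.
have /choice[t ht] i : exists t, 0 < t /\ Rep t r (fun x => F x ord0 i).
  have /holoP[s [M [s0 hs]]] := hF i; have M0 := Rep_ge0 hs.
  pose t := Num.min s (s * r / (M + 1)).
  have t0 : 0 < t.
    by rewrite lt_min s0/= divr_gt0 ?mulr_gt0// ltr_wpDl.
  have ts : t <= s by rewrite ge_min lexx.
  exists t; split=> //.
  have [c [cM cF]] : Rep t (t / s * M) (fun x => F x ord0 i).
    by apply: Rep_small => //; rewrite F0 mxE.
  exists c; split => // A; apply: le_trans (cM A) _.
  have : t <= s * r / (M + 1) by rewrite ge_min lexx orbT.
  rewrite ler_pdivlMr ?ltr_wpDl// => h.
  rewrite mulrAC ler_pdivrMr//.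
  have : 0 <= t by exact: ltW.
  lra.
pose s := \big[Num.min/1]_i t i.
have s0 : 0 < s by rewrite /s; elim/big_ind: _ => // [x y x0 y0|i _]; [rewrite lt_min x0|case: (ht i)].
exists s => // i; have [_ ] := ht i; apply: Rep_le => //.
by rewrite /s (bigD1 i)//= ge_min lexx.
Qed.

Lemma holo_comp m n (f : 'rV[C]_n -> C) (F : 'rV[C]_m -> 'rV[C]_n) :
  holomorphic_at0 f -> (forall i, holomorphic_at0 (fun x => F x ord0 i)) -> F 0 = 0 ->
  holomorphic_at0 (f \o F).
Proof.
move=> /holoP[r [M [r0 fM]]] hF F0; have [s s0 hs] := Rep_common r0 hF F0.
by apply/holoP; exists s, M; split => //; exact: Rep_comp fM hs.
Qed.

Lemma near_comp m n (P : 'rV[C]_n -> Prop) (F : 'rV[C]_m -> 'rV[C]_n) :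
  (forall i, holomorphic_at0 (fun x => F x ord0 i)) -> F 0 = 0 ->
  (\forall y \near (0 : 'rV[C]_n), P y) -> \forall x \near (0 : 'rV[C]_m), P (F x).
Proof.
move=> hF F0 /near0P[r r0 hP].
have r20 : 0 < r / 2 by lra.
have [s s0 hs] := Rep_common r20 hF F0.
apply/near0P; exists s => // x xs; apply: hP => i.
have : nm (F x ord0 i) <= r / 2 by apply: (Rep_bound s0 (hs i)) => j; exact: ltW.
lra.
Qed.

Lemma pow_deriv_bound (z h : C) (t : R) n : nm z <= t -> nm (z + h) <= t ->
  t ^+ 2 * nm ((z + h) ^+ n - z ^+ n - h * (n%:R * z ^+ n.-1))
    <= nm h ^+ 2 * (n ^ 2)%:R * t ^+ n.
Proof.
move=> zt zht; have t0 : 0 <= t by exact: le_trans (nm_ge0 _) zt.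
have h2 : 0 <= nm h ^+ 2 by rewrite exprn_ge0 ?nm_ge0.
elim: n => [|n IH].
  by rewrite !expr0 subrr mul0r mulr0 subr0 nm0 !mulr0 mul0r.
set E := (X in nm X) in IH.
have -> : (z + h) ^+ n.+1 - z ^+ n.+1 - h * (n.+1%:R * z ^+ n.+1.-1)
    = (z + h) * E + n%:R * z ^+ n.-1 * h ^+ 2.
  rewrite /E; case: n {IH E} => [|n] /=.
    by rewrite !expr0 !expr1; ring.
  rewrite -[n.+2%:R]natr1 !exprS expr0 mulr1.
  move: (n.+1%:R : C) ((z + h) ^+ n) (z ^+ n) => N P Q; ring.
apply: (@le_trans _ _ (t ^+ 2 * (t * nm E + n%:R * nm z ^+ n.-1 * nm h ^+ 2))).
  rewrite ler_wpM2l ?exprn_ge0// (le_trans (nmD _ _))// !nmM !nmX nm_nat lerD//.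
  by rewrite ler_wpM2r ?nm_ge0.
have zn : n%:R * (t ^+ 2 * nm z ^+ n.-1) <= n%:R * t ^+ n.+1.
  case: n {IH E} => [|n]; first by rewrite !mul0r.
  rewrite ler_wpM2l// -[n.+2]addn2 addnC exprD ler_wpM2l ?exprn_ge0//.
  by rewrite lerXn2r ?nnegrE ?nm_ge0.
apply: (@le_trans _ _ (t * (nm h ^+ 2 * (n ^ 2)%:R * t ^+ n) + nm h ^+ 2 * (n%:R * t ^+ n.+1))).
  have := ler_wpM2l t0 IH; have := ler_wpM2l h2 zn.
  set a := nm h ^+ 2; set b := nm z ^+ n.-1; set d := nm E; set u := t ^+ 2.
  lra.
have -> : t * (nm h ^+ 2 * (n ^ 2)%:R * t ^+ n) + nm h ^+ 2 * (n%:R * t ^+ n.+1)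
   = nm h ^+ 2 * (n ^ 2 + n)%:R * t ^+ n.+1 .
  rewrite natrD [t ^+ n.+1]exprS; move: (nm h ^+ 2) ((n ^ 2)%:R : R) (n%:R : R) (t ^+ n) => p q u v; ring.
rewrite ler_wpM2r ?exprn_ge0// ler_wpM2l// ler_nat.
by rewrite !expnS !expn0 !muln1; nia.
Qed.

Lemma sqr_le_pow4 (t : R) n : 0 <= t -> (n ^ 2)%:R * t ^+ n <= (4 * t) ^+ n.
Proof.
move=> t0; rewrite exprMn ler_wpM2r ?exprn_ge0// -natrX ler_nat.
rewrite -[4%N]/(2 ^ 2)%N -expnM mulnC expnM leq_sqr.
exact/ltnW/ltn_expl.
Qed.

Lemma leS_pow2 n : (n.+1 <= 2 ^ n)%N.
Proof. exact: ltn_expl. Qed.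

Lemma Rep_deriv k (f : 'rV[C]_k -> C) (s M : R) (i : 'I_k) : 0 < s -> Rep s M f ->
  exists2 g, Rep (s / 2) (M / s) g &
    forall (x : 'rV[C]_k) h, (forall j, nm (x ord0 j) <= s / 8) -> nm h <= s / 8 ->
      (s / 4) ^+ 2 * nm (f (h *: delta_mx ord0 i + x) - f x - h * g x) <= nm h ^+ 2 * M.
Proof.
move=> s0 [c [cM cf]].
have s20 : 0 < s / 2 by lra.
have sn0 : (s%:C)%C != 0 :> C by rewrite eq_complex /= negb_and gt_eqF.
pose e : multiindex k := [ffun j => (j == i : nat)].
have wte : wt s e = s.
  rewrite /wt (bigD1 i)//= ffunE eqxx expr1 big1 ?mulr1// => j /negPf ji.
  by rewrite ffunE ji.
have addI : injective (fun b : multiindex k => b + e).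
  move=> b b' /ffunP h; apply/ffunP => j; have := h j; rewrite !ffunE !natrDE.
  exact: addIn.
pose d (b : multiindex k) : C := (b i).+1%:R * c (b + e).
have half n : n.+1%:R * (s / 2) ^+ n <= s ^+ n.
  rewrite expr_div_n mulrA ler_pdivrMr ?exprn_gt0// mulrC ler_wpM2l ?exprn_ge0 ?(ltW s0)//.
  by rewrite -natrX ler_nat; exact: leS_pow2.
have wt2 (b : multiindex k) : (b i).+1%:R * wt (s / 2) b <= wt s b.
  rewrite /wt (bigD1 i)//= [leRHS](bigD1 i)//= mulrA; apply: ler_pM => //.
  - by rewrite mulr_ge0// exprn_ge0// ltW.
  - by rewrite prodr_ge0// => j _; rewrite exprn_ge0// ltW.
  - apply: ler_prod => j _; rewrite exprn_ge0 ?(ltW s20)//=; apply: powle => //; lra.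
have dM : absbnd (fun b => d b * (wt (s / 2) b)%:C%C) (M / s).
  have := absbndZ ((s^-1)%:C)%C cM; rewrite nm_real ?invr_ge0 ?(ltW s0)// mulrC.
  apply: (@absbnd_inj _ _ _ _ _ (fun b : multiindex k => b + e)) => [b b' _ _|b].
    exact: addI.
  rewrite nm_wt// /d nmM nm_nat [in leRHS]nmM nm_real ?invr_ge0 ?(ltW s0)// nm_wt//.
  rewrite wtD wte.
  rewrite (_ : s^-1 * _ = nm (c (b + e)) * wt s b); last first.
    by field; rewrite gt_eqF.
  by rewrite mulrAC mulrC ler_wpM2l ?nm_ge0.
pose g x := xget 0 [set y | has_sum (fun b => d b * monomial x b) y].
have hg (x : 'rV[C]_k) : (forall j, nm (x ord0 j) <= s / 2) -> has_sum (fun b => d b * monomial x b) (g x).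
  move=> xs; have [y hy] := absbnd_has_sum (absbnd_monomial s20 xs dM).
  by rewrite /g; case: xgetP => [z ->//|/(_ y)].
exists g; first by exists d; split.
move=> x h xs hs.
pose rest (a : multiindex k) := \prod_(j | j != i) x ord0 j ^+ a j.
pose z := x ord0 i.
have mono_x (a : multiindex k) : monomial x a = z ^+ a i * rest a by rewrite /monomial (bigD1 i).
have mono_xh (a : multiindex k) : monomial (h *: delta_mx ord0 i + x) a = (z + h) ^+ a i * rest a.
  rewrite /monomial (bigD1 i)//= !mxE !eqxx/= mulr1 addrC; congr (_ * _).
  by apply: eq_bigr => j /negPf ji; rewrite !mxE eqxx ji/= mulr0 add0r.
have hx : has_sum (fun a : multiindex k => c a * ((a i)%:R * z ^+ (a i).-1 * rest a)) (g x).
  apply: (@has_sum_inj _ _ _ (fun b : multiindex k => b + e)) => //.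
    move=> a ha; case Ea : (a i) => [|n]; first by rewrite !mul0r mulr0.
    case: (ha [ffun j => a j - (j == i)]%N); apply/ffunP => j.
    rewrite !ffunE natrDE; case: eqP => [->|_]; last by rewrite subn0 addn0.
    by rewrite Ea subn1 addn1.
  have xs2 : forall j, nm (x ord0 j) <= s / 2.
    move=> j; apply: le_trans (xs j) _; lra.
  apply: has_sum_ext (hg x xs2) => b.
  have -> : (b + e) i = (b i).+1 by rewrite !ffunE eqxx natrDE addn1.
  have -> : rest (b + e) = rest b.
    by apply: eq_bigr => j /negPf ji; rewrite !ffunE ji natrDE addn0.
  by rewrite /d mono_x/= mulrAC [in RHS]mulrA [c _ * _]mulrC -!mulrA [_ * c _]mulrC !mulrA.
have xs1 j : nm (x ord0 j) <= s by apply: le_trans (xs j) _; lra.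
have xhs j : nm ((h *: delta_mx ord0 i + x) ord0 j) <= s.
  rewrite !mxE eqxx /=; case: (j == i).
    by rewrite mulr1 (le_trans (nmD _ _))//; have := xs j; lra.
  by rewrite mulr0 add0r.
have := has_sumD (has_sumD (cf _ xhs) (has_sumN (cf _ xs1))) (has_sumN (has_sumZ h hx)).
have t40 : 0 < (s / 4) ^+ 2 by rewrite exprn_gt0//; lra.
move=> hsum; rewrite mulrC -ler_pdivlMr//.
apply: has_sum_le hsum _ => A; rewrite ler_pdivlMr// mulr_suml.
apply: (@le_trans _ _ (\sum_(a <- A) nm h ^+ 2 * nm (c a * (wt s a)%:C%C))); last first.
  by rewrite -mulr_sumr ler_wpM2l// exprn_ge0// nm_ge0.
apply: ler_sum => a _; rewrite nm_wt//.
set E := (z + h) ^+ a i - z ^+ a i - h * ((a i)%:R * z ^+ (a i).-1).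
rewrite (_ : _ + _ = c a * (E * rest a)); last by rewrite /E mono_x mono_xh; ring.
rewrite !nmM [leRHS]mulrCA -[leLHS]mulrA ler_wpM2l ?nm_ge0//.
have hE : (s / 4) ^+ 2 * nm E <= nm h ^+ 2 * s ^+ a i.
  have zt : nm z <= s / 4 by apply: le_trans (xs i) _; lra.
  have zht : nm (z + h) <= s / 4.
    by rewrite (le_trans (nmD _ _))//; have := xs i; rewrite -/z; lra.
  apply: le_trans (pow_deriv_bound (a i) zt zht) _.
  rewrite -mulrA ler_wpM2l ?exprn_ge0 ?nm_ge0//.
  have s40 : 0 <= s / 4 by lra.
  apply: le_trans (sqr_le_pow4 (a i) s40) _.
  by rewrite (_ : 4 * (s / 4) = s)//; field.
rewrite mulrAC [_ * (s / 4) ^+ 2]mulrC /wt (bigD1 i)//= [leRHS]mulrA; apply: ler_pM => //.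
- by rewrite mulr_ge0 ?nm_ge0// ltW.
- exact: nm_ge0.
- rewrite /rest nm_prod; apply: ler_prod => j _; rewrite nmX exprn_ge0 ?nm_ge0//=.
  by rewrite lerXn2r ?nnegrE ?nm_ge0// ltW.
Qed.

Lemma holo_derive k (f : 'rV[C]_k -> C) (i : 'I_k) :
  holomorphic_at0 f -> holomorphic_at0 ('D_(delta_mx ord0 i) f).
Proof.
move=> /holoP[s [M [s0 fM]]].
have [g gM hg] := Rep_deriv i s0 fM.
have M0 := Rep_ge0 fM.
apply: (@holo_eq _ g); last by apply/holoP; exists (s / 2), (M / s); split => //; lra.
apply/near0P; exists (s / 8); first lra.
move=> x xs; apply/esym; rewrite /derive.
apply: cvg_lim => //; apply/cvgrPdist_lt => eps eps0.
have eE : eps = ((complex.Re eps)%:C)%C.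
  by case: eps eps0 => a b; rewrite ltcE /= => /andP[/eqP -> _].
set r := complex.Re eps in eE.
have r0 : 0 < r by rewrite -ltcR -eE.
pose del := Num.min (s / 8) (r * (s / 4) ^+ 2 / (M + 1)).
have t40 : 0 < (s / 4) ^+ 2 by rewrite exprn_gt0//; lra.
have del0 : 0 < del.
  by rewrite lt_min !divr_gt0// ?mulr_gt0//; lra.
near=> h.
have h0 : h != 0 by near: h; exact: nbhs_dnbhs_neq.
have hdel : nm h < del.
  by rewrite -nm_ltc; near: h; apply: dnbhs0_lt; rewrite ltcR.
have nh0 : 0 < nm h by rewrite -ltcR -nmE normr_gt0.
have h8 : nm h <= s / 8 by rewrite (le_trans (ltW hdel))// ge_min lexx.
have hr : nm h * (M + 1) < r * (s / 4) ^+ 2.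
  by rewrite -ltr_pdivlMr ?ltr_wpDl// (lt_le_trans hdel)// ge_min lexx orbT.
have := hg x h (fun j => ltW (xs j)) h8.
rewrite eE nm_ltc /= /shift/=.
set q := f _ - f x - _ => hq.
rewrite (_ : _ - _ = - (h^-1 * q)); last first.
  by rewrite /q mulrBr mulrA mulVf// mul1r opprB.
rewrite nmN nmM -(ltr_pM2l nh0) mulrA -nmM divff// nm1 mul1r -(ltr_pM2l t40).
apply: le_lt_trans hq _.
rewrite [nm h ^+ 2]expr2 -[ltLHS]mulrA [ltRHS]mulrCA ltr_pM2l// [ltRHS]mulrC.
apply: le_lt_trans hr; rewrite ler_pM2l//; lra.
Unshelve. all: by end_near. Qed.

End Holo.

Section Germs.
Variable R : realType.
Local Notation C := (Cplx R).
Local Open Scope quotient_scope.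

Section ring.
Variable k : nat.

Definition hol : {pred ('rV[C]_k -> C)} := fun f => `[< holomorphic_at0 f >].

Fact hol_subring_closed : subring_closed hol.
Proof.
split=> [|f g|f g].
- exact/asboolP/holo_cst.
- move=> /asboolP hf /asboolP hg; apply/asboolP.
  have := holoD hf (holoM (@holo_cst R k (-1)) hg).
  by congr holomorphic_at0; apply/funext => x; rewrite mulN1r.
- by move=> /asboolP hf /asboolP hg; apply/asboolP; have := holoM hf hg.
Qed.

HB.instance Definition _ := GRing.isSubringClosed.Build ('rV[C]_k -> C) hol hol_subring_closed.

Record holfun := HolFun { holfun_val :> 'rV[C]_k -> C; _ : holfun_val \in hol }.
HB.instance Definition _ := [isSub for holfun_val].
HB.instance Definition _ := [Choice of holfun by <:].
HB.instance Definition _ := [SubChoice_isSubComNzRing of holfun by <:].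

Lemma holfunP (f : holfun) : holomorphic_at0 f.
Proof. by case: f => f hf; apply/asboolP. Qed.

Definition mk_holfun (f : 'rV[C]_k -> C) (hf : holomorphic_at0 f) : holfun :=
  HolFun (introT (asboolP _) hf).

Definition null_germ : {pred holfun} := fun f => `[< \forall x \near (0 : 'rV[C]_k), f x = 0 >].

Fact null_germ_idealr : idealr_closed null_germ.
Proof.
split.
- by apply/asboolP; near=> x.
- apply/asboolP => /nbhs_singleton /= /eqP; apply/negP; exact: oner_neq0.
- move=> f g h /asboolP hg /asboolP hh; apply/asboolP; near=> x => /=.
  have gx : g x = 0 by near: x.
  have hx : h x = 0 by near: x.
  by transitivity (f x * g x + h x) => //; rewrite gx hx mulr0 addr0.
Unshelve. all: by end_near. Qed.

HB.instance Definition _ := isIdealr.Build holfun null_germ null_germ_idealr.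

(* O_{C^k}: functions holomorphic near 0, modulo equality on a neighbourhood
   of 0. *)
Definition germ := {ideal_quot null_germ}.
HB.instance Definition _ := GRing.ComNzRing.on germ.
HB.instance Definition _ := NzRingQuotient.on germ.

Lemma germ_eqP (f g : holfun) :
  \pi_germ f = \pi_germ g <-> \forall x \near (0 : 'rV[C]_k), f x = g x.
Proof.
split=> [/eqP|fg].
  rewrite -(Quotient.idealrBE null_germ) => /asboolP; apply: filterS => x /= /eqP.
  by rewrite subr_eq0 => /eqP.
apply/eqP; rewrite -(Quotient.idealrBE null_germ); apply/asboolP.
by apply: filterS fg => x /= fgx; apply/eqP; rewrite subr_eq0; apply/eqP.
Qed.

Lemma repr_germ (f : holfun) :
  \forall x \near (0 : 'rV[C]_k), repr (\pi_germ f) x = f x.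
Proof. by apply/germ_eqP; rewrite reprK. Qed.

Definition germ_at0 (g : germ) : C := repr g 0.

Definition cst_germ (c : C) : germ := \pi_germ (mk_holfun (@holo_cst R k c)).

Fact cst_germ1 : cst_germ 1 = 1.
Proof. by rewrite -(rmorph1 \pi_germ); apply/germ_eqP; near=> x. Unshelve. all: by end_near. Qed.

Fact cst_germD a b : cst_germ (a + b) = cst_germ a + cst_germ b.
Proof. by rewrite -rmorphD; apply/germ_eqP; near=> x. Unshelve. all: by end_near. Qed.

Fact cst_germM a b : cst_germ (a * b) = cst_germ a * cst_germ b.
Proof. by rewrite -rmorphM; apply/germ_eqP; near=> x. Unshelve. all: by end_near. Qed.

HB.instance Definition _ := @GRing.Zmodule_isLmodule.Build C germ
  (fun c g => cst_germ c * g)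
  (fun a b g => etrans (mulrA _ _ _) (congr1 ( *%R^~ g) (esym (cst_germM a b))))
  (fun g => etrans (congr1 ( *%R^~ g) cst_germ1) (mul1r g))
  (fun a g h => mulrDr _ g h)
  (fun g a b => etrans (congr1 ( *%R^~ g) (cst_germD a b)) (mulrDl _ _ g)).
HB.instance Definition _ := @GRing.Lmodule_isLalgebra.Build C germ
  (fun c g h => mulrA (cst_germ c) g h).
HB.instance Definition _ := @GRing.Lalgebra_isComAlgebra.Build C germ.

Definition partial (i : 'I_k) (g : germ) : germ :=
  \pi_germ (mk_holfun (holo_derive i (holfunP (repr g)))).

Lemma partial_pi i (f : holfun) :
  partial i (\pi_germ f) = \pi_germ (mk_holfun (holo_derive i (holfunP f))).
Proof.
apply/germ_eqP; apply: filterS (near_join (repr_germ f)) => x.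
exact: near_eq_derive.
Qed.

End ring.

Section pullback.
Variables m n : nat.

(* A germ (C^m, 0) -> (C^n, 0), given by its components. *)
Record mapgerm := MapGerm {
  mapgerm_comp :> 'I_n -> germ m;
  mapgerm_at0 : forall i, germ_at0 (mapgerm_comp i) = 0 }.

Definition mapgerm_fun (F : mapgerm) (x : 'rV[C]_m) : 'rV[C]_n :=
  \row_i repr (F i) x.

Fact mapgerm_holo F i : holomorphic_at0 (fun x => mapgerm_fun F x ord0 i).
Proof. by under eq_fun do rewrite mxE; exact: holfunP. Qed.

Fact mapgerm_fun0 F : mapgerm_fun F 0 = 0.
Proof. by apply/rowP => i; rewrite !mxE; exact: mapgerm_at0. Qed.

(* g |-> g \o F; the values do not depend on the representatives: pullback_pi. *)
Definition pullback (F : mapgerm) (g : germ n) : germ m :=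
  \pi_(germ m) (mk_holfun (holo_comp (holfunP (repr g)) (mapgerm_holo F) (mapgerm_fun0 F))).

Variable F : mapgerm.

Lemma pullback_pi (f : holfun n) :
  pullback F (\pi_(germ n) f) =
  \pi_(germ m) (mk_holfun (holo_comp (holfunP f) (mapgerm_holo F) (mapgerm_fun0 F))).
Proof.
apply/germ_eqP; exact: near_comp (mapgerm_holo F) (mapgerm_fun0 F) (repr_germ f).
Qed.

Fact pullback_zmod_morphism : zmod_morphism (pullback F).
Proof.
elim/quotW => f; elim/quotW => g.
rewrite -rmorphB !pullback_pi -rmorphB; apply/germ_eqP; near=> x => //.
Unshelve. all: by end_near. Qed.

Fact pullback_monoid_morphism : monoid_morphism (pullback F).
Proof.
split.
  rewrite -(rmorph1 \pi_(germ n)) pullback_pi -(rmorph1 \pi_(germ m)).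
  by apply/germ_eqP; near=> x.
elim/quotW => f; elim/quotW => g.
rewrite -rmorphM !pullback_pi -rmorphM; apply/germ_eqP; near=> x => //.
Unshelve. all: by end_near. Qed.

HB.instance Definition _ := GRing.isZmodMorphism.Build (germ n) (germ m) (pullback F)
  pullback_zmod_morphism.
HB.instance Definition _ := GRing.isMonoidMorphism.Build (germ n) (germ m) (pullback F)
  pullback_monoid_morphism.

End pullback.
End Germs.

Section Modules.
Variable A : comNzRingType.

Definition submodule (E : lmodType A) (V : set E) :=
  V 0 /\ forall a u v, V u -> V v -> V (a *: u + v).

Definition span (E : lmodType A) (X : set E) : set E := smallest (@submodule E) X.

Lemma span_submodule (E : lmodType A) (X : set E) : submodule (span X).
Proof.
split=> [V [[V0 _] _]//|a u v hu hv V hV].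
by have [[_ VD] _] := hV; apply: VD; [exact: hu|exact: hv].
Qed.

Definition finite_supp (S : Type) (N : zmodType) (v : S -> N) :=
  finite_set [set s | v s != 0].

(* The free module on S is the module of finitely supported functions S -> A,
   and its tensor product with N is the module of finitely supported functions
   S -> N. For d t = the image in A^(S) of the basis element t (so that d t has
   finite support), free_diff d is the map A^(T) (x) N -> A^(S) (x) N that d
   induces; N := A^o gives A^(T) -> A^(S) itself. *)
Definition free_diff (S T : choiceType) (d : T -> S -> A) (N : lmodType A)
    (v : T -> N) : S -> N :=
  fun s => \sum_(t \in setT) d t s *: v t.

(* A resolution  ... -> P_1 -> P_0 -> E/W -> 0  by free modules P_j of arbitrary
   rank, with bases fr_basis j. *)
Record free_resolution (E : lmodType A) (W : set E) := FreeResolution {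
  fr_basis : nat -> choiceType;
  fr_aug : fr_basis 0 -> E;
  fr_d : forall j, fr_basis j.+1 -> fr_basis j -> A^o;
  fr_d_fin : forall j t, finite_supp (@fr_d j t);
  fr_surj : forall x : E, exists v : fr_basis 0 -> A^o,
    finite_supp v /\ W (x - \sum_(s \in setT) v s *: fr_aug s);
  fr_exact0 : forall v : fr_basis 0 -> A^o, finite_supp v ->
    W (\sum_(s \in setT) v s *: fr_aug s) <->
    exists2 w : fr_basis 1 -> A^o, finite_supp w & v = free_diff (@fr_d 0) w;
  fr_exactS : forall j (v : fr_basis j.+1 -> A^o), finite_supp v ->
    free_diff (@fr_d j) v = 0 <->
    exists2 w : fr_basis j.+2 -> A^o, finite_supp w & v = free_diff (@fr_d j.+1) w }.

(* Tor_j(E/W, N) is the homology in degree j of the complex P (x) N, that is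
   tor_cycles P N j modulo tor_boundaries P N j. *)
Definition tor_cycles (E : lmodType A) (W : set E) (P : free_resolution W)
    (N : lmodType A) (j : nat) : set (fr_basis P j -> N) :=
  match j with
  | 0 => [set v | finite_supp v]
  | i.+1 => [set v | finite_supp v /\ free_diff (@fr_d _ _ P i) v = 0]
  end.

Definition tor_boundaries (E : lmodType A) (W : set E) (P : free_resolution W)
    (N : lmodType A) (j : nat) : set (fr_basis P j -> N) :=
  [set free_diff (@fr_d _ _ P j) w | w in [set w : fr_basis P j.+1 -> N | finite_supp w]].

Lemma free_sum_supp (S : choiceType) (v : S -> A^o) (E : lmodType A) (e : S -> E)
    (F : {fset S}) : (forall s, s \notin F -> v s = 0) ->
  \sum_(s \in setT) v s *: e s = \sum_(s <- F) v s *: e s.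
Proof. by move=> vF; apply: fsbigTE => s sF; rewrite vF// scale0r. Qed.

Lemma finite_suppP (S : choiceType) (N : zmodType) (v : S -> N) :
  finite_supp v <-> exists F : {fset S}, forall s, s \notin F -> v s = 0.
Proof.
split=> [fv|[F hF]].
  by exists (fset_set [set s | v s != 0]) => s; rewrite in_fset_set// notin_setE /= => /negP/negPn/eqP.
by apply: (finite_subfset F) => s /=; apply: contra_neqT => /hF.
Qed.

Definition syzygies (S : choiceType) (E : lmodType A) (W : set E) (e : S -> E) :=
  [set v : S -> A^o | finite_supp v /\ W (\sum_(s \in setT) v s *: e s)].

Lemma syzygies_exact (S : choiceType) (E : lmodType A) (W : set E) (e : S -> E) :
  submodule W -> forall v : S -> A^o, finite_supp v ->
     (W (\sum_(s \in setT) v s *: e s) <->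
      exists2 w : syzygies W e -> A^o, finite_supp w &
        v = free_diff (fun t : syzygies W e => val t) w).
Proof.
move=> [W0 WD] v fv; set K := syzygies W e.
split=> [Wv|[w /finite_suppP[F hF] ->]].
  pose t0 : K := SigSub (mem_set (conj fv Wv : K v)).
  exists (fun t => (t == t0)%:R).
    by apply/finite_suppP; exists [fset t0]%fset => t; rewrite inE => /negPf ->.
  apply/funext => s; rewrite /free_diff (@fsbigTE _ _ _ _ [fset t0]%fset).
    by rewrite big_seq_fset1 eqxx [_ *: _]mulr1.
  by move=> t; rewrite inE => /negPf ->; rewrite scaler0.
have K0 : K 0.
  split; first by apply/finite_suppP; exists fset0.
  by rewrite (@fsbig1 _ _ _ _ _ _)// => s _; rewrite scale0r.
have KD a u u' : K u -> K u' -> K (a *: u + u').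
  move=> [/finite_suppP[F1 h1] W1] [/finite_suppP[F2 h2] W2].
  have h1' s : s \notin (F1 `|` F2)%fset -> u s = 0.
    by rewrite inE negb_or => /andP[/h1].
  have h2' s : s \notin (F1 `|` F2)%fset -> u' s = 0.
    by rewrite inE negb_or => /andP[_ /h2].
  have h s : s \notin (F1 `|` F2)%fset -> (a *: u + u') s = 0.
    by move=> sF; rewrite -[LHS]/(a * u s + u' s) h1'// h2'// mulr0 addr0.
  split; first by apply/finite_suppP; exists (F1 `|` F2)%fset.
  move: W1 W2; rewrite (free_sum_supp e h) (free_sum_supp e h1') (free_sum_supp e h2').
  move=> W1 W2; have := WD a _ _ W1 W2; congr W.
  rewrite scaler_sumr -big_split/=; apply: eq_bigr => s _.
  by rewrite -[in RHS]/(a * u s + u' s) scalerDl scalerA.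
have -> : free_diff (fun t : K => val t) w = \sum_(t <- F) w t *: (val t : S -> A^o).
  apply/funext => s; rewrite /free_diff (@fsbigTE _ _ _ _ F)/=; last first.
    by move=> t /hF ->; rewrite scaler0.
  by rewrite fct_sumE; apply: eq_bigr => t _; exact: mulrC.
have [] : K (\sum_(t <- F) w t *: (val t : S -> A^o)); last by [].
elim/big_rec: _ => // t u _ Ku; apply: KD => //.
by case: t => t /= /set_mem.
Qed.

Record res_stage := ResStage {
  rs_src : choiceType;
  rs_tgt : choiceType;
  rs_d : rs_src -> rs_tgt -> A^o;
  rs_fin : forall t, finite_supp (rs_d t) }.

Fact val_syzygy_fin (S : choiceType) (E : lmodType A) (W : set E) (e : S -> E)
  (t : syzygies W e) : finite_supp (val t : S -> A^o).
Proof. by case: t => t /= /set_mem[]. Qed.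

Definition rs0 (E : lmodType A) (W : set E) :=
  @ResStage (@syzygies E E W id) E (fun t => val t) (@val_syzygy_fin _ _ _ _).

Definition rsS (st : res_stage) :=
  let K := @syzygies (rs_src st) (rs_tgt st -> A^o) [set 0] (@rs_d st) in
  @ResStage K (rs_src st) (fun t => val t) (@val_syzygy_fin _ _ _ _).

Definition rs (E : lmodType A) (W : set E) (j : nat) := iter j rsS (rs0 W).

Lemma free_diffE (S T : choiceType) (d : T -> S -> A^o) (w : T -> A^o) :
  finite_supp w -> free_diff d w = \sum_(t \in setT) w t *: (d t : S -> A^o).
Proof.
move=> /finite_suppP[F hF]; rewrite (free_sum_supp _ hF).
apply/funext => s; rewrite /free_diff (@fsbigTE _ _ _ _ F)/=; last first.
  by move=> t /hF ->; rewrite scaler0.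
by rewrite fct_sumE; apply: eq_bigr => t _; exact: mulrC.
Qed.

Lemma free_resolution_exists (E : lmodType A) (W : set E) :
  submodule W -> inhabited (free_resolution W).
Proof.
move=> subW; constructor.
have null_sub (S : choiceType) : @submodule (S -> A^o) [set 0].
  by split=> // a u v -> ->; rewrite scaler0 addr0.
apply: (@FreeResolution E W (fun j => rs_tgt (rs W j)) id (fun j => @rs_d (rs W j))).
- by move=> j t; exact: (@rs_fin (rs W j)).
- move=> x; exists (fun y => (y == x)%:R); split.
    by apply/finite_suppP; exists [fset x]%fset => y; rewrite inE => /negPf ->.
  rewrite (@free_sum_supp _ _ _ _ [fset x]%fset).
    by rewrite big_seq_fset1 eqxx scale1r subrr; case: subW.
  by move=> y; rewrite inE => /negPf ->.
- exact: syzygies_exact.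
- move=> j v fv; rewrite free_diffE//.
  exact: (@syzygies_exact (rs_src (rs W j)) _ [set 0] (@rs_d (rs W j)) (null_sub _)).
Qed.

End Modules.

Section Dimension.
Variables (K : fieldType) (A : comAlgType K).

(* dim_K (V/W) = d for K-subspaces W of V: the classes of e form a basis of
   V/W. *)
Definition quotient_dim (E : lmodType A) (V W : set E) (d : nat) :=
  exists2 e : 'I_d -> E, forall i, V (e i) &
    forall v, V v -> exists! c : 'rV[K]_d, W (v - \sum_i (c ord0 i)%:A *: e i).

(* dim_K Tor_j(E/W, N) = b. Tor_j does not depend on the free resolution, and
   free_resolution_exists shows that the quantifier is not void. *)
Definition tor_dim (E : lmodType A) (W : set E) (N : lmodType A) (j b : nat) :=
  forall P : free_resolution W,
    quotient_dim (@tor_cycles A E W P N j) (@tor_boundaries A E W P N j) b.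
End Dimension.

(* B seen as an A-module through phi. *)
Definition restrict_scalars (A B : comNzRingType) (phi : {rmorphism A -> B}) : Type := B.

Section RestrictScalars.
Variables (A B : comNzRingType) (phi : {rmorphism A -> B}).
HB.instance Definition _ := GRing.Zmodule.on (restrict_scalars phi).
HB.instance Definition _ := @GRing.Zmodule_isLmodule.Build A (restrict_scalars phi)
  (fun a (b : B) => phi a * b)
  (fun a a' b => etrans (mulrA _ _ _) (congr1 ( *%R^~ b) (esym (rmorphM phi a a'))))
  (fun b => etrans (congr1 ( *%R^~ b) (rmorph1 phi)) (mul1r b))
  (fun a b b' => mulrDr _ b b')
  (fun b a a' => etrans (congr1 ( *%R^~ b) (rmorphD phi a a')) (mulrDl _ _ b)).
End RestrictScalars.

Section Singularities.
Variable R : realType.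
Local Notation C := (Cplx R).

Definition jacobian_ideal k (g : germ R k) : set (germ R k)^o :=
  span (range (fun i => partial i g : (germ R k)^o)).

Definition milnor_number k (g : germ R k) (mu : nat) :=
  quotient_dim setT (jacobian_ideal g) mu.

Definition isolated_singularity k (g : germ R k) := exists mu, milnor_number g mu.

Definition Der_log n (f : germ R n) : set 'rV[germ R n]_n :=
  [set chi | \sum_i chi ord0 i * partial i f = 0].

Variables m n : nat.
Implicit Type F : mapgerm R m n.

Definition tangent_map F (xi : 'rV[germ R m]_m) : 'rV[germ R m]_n :=
  \row_i \sum_j xi ord0 j * partial j (F i).

(* chi |-> chi \o F *)
Definition along F (chi : 'rV[germ R n]_n) : 'rV[germ R m]_n :=
  map_mx (pullback F) chi.

(* tF(theta_{C^m}) + F^*(Der(-log f)), as a submodule of theta(F) = O_{C^m}^n *)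
Definition TKf (f : germ R n) F : set 'rV[germ R m]_n :=
  [set u + v | u in range (tangent_map F) & v in span (along F @` Der_log f)].

Definition tau_Kf (f : germ R n) F (tau : nat) := quotient_dim setT (TKf f F) tau.

(* dim_C Tor_j(O_{C^n}/J_f, O_{C^m}) = b, Tor being over O_{C^n} *)
Definition betti (f : germ R n) F (j b : nat) :=
  tor_dim (jacobian_ideal f) (restrict_scalars (pullback F)) j b.
End Singularities.

(* Main.v *)
From HB Require Import structures.
Require Import Defs.
From mathcomp Require Import all_boot all_order all_algebra.
From mathcomp Require Import ssrAC finmap complex generic_quotient.
From mathcomp Require Import boolp classical_sets functions cardinality fsbigop reals.
From mathcomp Require Import topology normedtype derive.
From mathcomp Require Import lra ring zify.

(** Let [A] be the ring of germs on C^m, [phi] in [A^n] the gradient of [f]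
    pulled back along [F], and [g] in [A^m] the gradient of [f o F]. By the
    chain rule, [g = phi * D^T] with [D] the matrix of the [d_j F_k]
    ([comp_gradE]). Pairing with [phi] maps theta(F) = [A^n] onto the ideal
    [(phi)], maps the image of tF onto the Jacobian ideal [(g)], and kills
    F^*(Der(-log f)). With Z the module of syzygies of [phi] this gives an exact
    sequence

      0 -> Z / F^*(Der(-log f)) -> T^1_{K_f} F -> A/(g) -> A/(phi) -> 0

    whose outer terms are Tor_1 and Tor_0: over the ring of germs on C^n the
    Jacobian algebra has the presentation with one generator, relations given by
    the partial derivatives of [f], and second syzygies Der(-log f), and any two
    free resolutions have the same homology after tensoring
    ([homology_iso_exists]). The formula is the vanishing of the alternating sum
    of the dimensions.

    Two points need the isolated singularity. Both rest on the fact that every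
    relation [xi . g = 0] is a Koszul relation [xi = g (c - c^T)]
    ([koszul_row]).
    - Injectivity on the left: if [tF xi] is a syzygy of [phi], then [xi] is a
      relation among the [g_j], hence Koszul, so that
      [tF xi = phi (y - y^T)] with [y = D^T c D]. Such a vector is a combination
      of the pullbacks of the vector fields
      [(d_k f) e_l - (d_l f) e_k], which kill [f] ([tangent_ker]).
    - Finiteness of Tor_1: a syzygy with entries in [(g)] lies in
      F^*(Der(-log f)) by a similar computation ([ker_ideal_log]), so that Tor_1
      is a quotient of a subspace of the finite-dimensional space [(A/(g))^n].
      This avoids any appeal to noetherianity.

    The Koszul property of [g] is the depth sensitivity of the Koszul complex.
    Since [A/(g)] is finite-dimensional, a nonzero polynomial in each coordinate
    [x_i] lies in [(g)], hence so does a power [x_i^N], the other factor of the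
    polynomial being a unit ([coord_power_mem]). The powers [x_i^N] form a
    regular sequence of length [m], because [x_i] can be set to zero and divided
    out ([regular_powers]). An element [x] of the ideal acts by zero on Koszul
    homology, through an explicit homotopy; hence the vanishing of H_(p+1) modulo
    [x] implies that of H_p ([acyclic_mod_step]). Starting from H_(m+1) = 0 over
    the quotient by all [x_i^N], one reaches H_1 = 0 over [A]. *)

Set Implicit Arguments.
Unset Strict Implicit.
Unset Printing Implicit Defensive.
Import Order.TTheory GRing.Theory Num.Theory numFieldNormedType.Exports.
Local Open Scope classical_set_scope.
Local Open Scope ring_scope.

Local Notation span := Defs.span.

(** * The Koszul complex and relations among generators of an ideal *)

Section Koszul.
Variable A : comNzRingType.

(** The exterior algebra on [m] generators, split along the first one [e]: a
    pair [(a, b)] stands for [a + e /\ b]. The recursion replaces all sign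
    bookkeeping over subsets of the generators. *)
Fixpoint koszul (m : nat) : lmodType A :=
  if m is m'.+1 then (koszul m' * koszul m')%type : lmodType A else A^o.

Definition ftail (T : Type) m (g : 'I_m.+1 -> T) : 'I_m -> T := fun i => g (lift ord0 i).

Fixpoint kdiff m : ('I_m -> A) -> koszul m -> koszul m :=
  match m with
  | 0 => fun _ _ => 0
  | m'.+1 => fun g w =>
      (kdiff (ftail g) w.1 + g ord0 *: w.2, - kdiff (ftail g) w.2)
  end.

Fixpoint kwedge m : ('I_m -> A) -> koszul m -> koszul m :=
  match m with
  | 0 => fun _ _ => 0
  | m'.+1 => fun c w =>
      (kwedge (ftail c) w.1, c ord0 *: w.1 - kwedge (ftail c) w.2)
  end.

Fixpoint kdeg m (p : nat) : koszul m -> Prop :=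
  match m with
  | 0 => fun w => if p is 0 then True else w = 0
  | m'.+1 => fun w => kdeg p w.1 /\ if p is p'.+1 then kdeg p' w.2 else w.2 = 0
  end.

(** Membership in [I] times the Koszul complex. Working with elements modulo [I]
    instead of over the quotient ring keeps a single complex throughout. *)
Fixpoint kin m (I : set A) : koszul m -> Prop :=
  match m with
  | 0 => fun w => I w
  | m'.+1 => fun w => kin I w.1 /\ kin I w.2
  end.

Definition ideal_set (I : set A) := I 0 /\ forall a u v, I u -> I v -> I (a * u + v).

Definition kcons m (a b : koszul m) : koszul m.+1 := (a, b).

Lemma koszul_cases m (P : koszul m.+1 -> Prop) :
  (forall a b, P (kcons a b)) -> forall w, P w.
Proof. by move=> h [a b]; exact: h. Qed.

Lemma kcons_linear m c (a b a' b' : koszul m) :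
  c *: kcons a b + kcons a' b' = kcons (c *: a + a') (c *: b + b').
Proof. by []. Qed.

Lemma kcons0 m : kcons 0 0 = 0 :> koszul m.+1.
Proof. by []. Qed.

Lemma kconsD m (a b a' b' : koszul m) : kcons a b + kcons a' b' = kcons (a + a') (b + b').
Proof. by []. Qed.

Lemma kconsN m (a b : koszul m) : - kcons a b = kcons (- a) (- b).
Proof. by []. Qed.

Lemma kconsZ m c (a b : koszul m) : c *: kcons a b = kcons (c *: a) (c *: b).
Proof. by []. Qed.

Lemma kdiffE m (g : 'I_m.+1 -> A) a b :
  kdiff g (kcons a b) = kcons (kdiff (ftail g) a + g ord0 *: b) (- kdiff (ftail g) b).
Proof. by []. Qed.

Lemma kwedgeE m (c : 'I_m.+1 -> A) a b :
  kwedge c (kcons a b) = kcons (kwedge (ftail c) a) (c ord0 *: a - kwedge (ftail c) b).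
Proof. by []. Qed.

Lemma kdiff_linear m (g : 'I_m -> A) a u v :
  kdiff g (a *: u + v) = a *: kdiff g u + kdiff g v.
Proof.
elim: m g a u v => [|m IH] g a u v; first by rewrite [RHS]addr0 scaler0.
elim/koszul_cases: u => u1 u2; elim/koszul_cases: v => v1 v2.
rewrite kcons_linear !kdiffE kcons_linear !IH; congr kcons.
  by rewrite !scalerDr !scalerA [g ord0 * a]mulrC addrACA.
by rewrite scalerN opprD.
Qed.

Lemma kwedge_linear m (c : 'I_m -> A) a u v :
  kwedge c (a *: u + v) = a *: kwedge c u + kwedge c v.
Proof.
elim: m c a u v => [|m IH] c a u v; first by rewrite [RHS]addr0 scaler0.
elim/koszul_cases: u => u1 u2; elim/koszul_cases: v => v1 v2.
rewrite kcons_linear !kwedgeE kcons_linear !IH; congr kcons.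
by rewrite !scalerDr !scalerA [c ord0 * a]mulrC scalerN opprD addrACA.
Qed.

Lemma kdiff0 m (g : 'I_m -> A) : kdiff g 0 = 0.
Proof. by have := kdiff_linear g (-1) 0 0; rewrite scaler0 addr0 scaleN1r addNr. Qed.
Lemma kwedge0 m (g : 'I_m -> A) : kwedge g 0 = 0.
Proof. by have := kwedge_linear g (-1) 0 0; rewrite scaler0 addr0 scaleN1r addNr. Qed.
Lemma kdiffZ m (g : 'I_m -> A) a u : kdiff g (a *: u) = a *: kdiff g u.
Proof. by have := kdiff_linear g a u 0; rewrite kdiff0 !addr0. Qed.
Lemma kdiffD m (g : 'I_m -> A) u v : kdiff g (u + v) = kdiff g u + kdiff g v.
Proof. by have := kdiff_linear g 1 u v; rewrite !scale1r. Qed.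
Lemma kdiffN m (g : 'I_m -> A) u : kdiff g (- u) = - kdiff g u.
Proof. by rewrite -scaleN1r kdiffZ scaleN1r. Qed.
Lemma kdiffB m (g : 'I_m -> A) u v : kdiff g (u - v) = kdiff g u - kdiff g v.
Proof. by rewrite kdiffD kdiffN. Qed.
Lemma kwedgeZ m (g : 'I_m -> A) a u : kwedge g (a *: u) = a *: kwedge g u.
Proof. by have := kwedge_linear g a u 0; rewrite kwedge0 !addr0. Qed.
Lemma kwedgeD m (g : 'I_m -> A) u v : kwedge g (u + v) = kwedge g u + kwedge g v.
Proof. by have := kwedge_linear g 1 u v; rewrite !scale1r. Qed.
Lemma kwedgeN m (g : 'I_m -> A) u : kwedge g (- u) = - kwedge g u.
Proof. by rewrite -scaleN1r kwedgeZ scaleN1r. Qed.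

Lemma kdiff_kdiff m (g : 'I_m -> A) w : kdiff g (kdiff g w) = 0.
Proof.
elim: m g w => [//|m IH] g w; elim/koszul_cases: w => a b; rewrite !kdiffE.
by rewrite kdiffD kdiffZ kdiffN !IH add0r scalerN subrr !oppr0 kcons0.
Qed.

(** The homotopy behind depth sensitivity: because of it, the ideal generated by the
    [g_i] kills the Koszul homology. *)
Lemma kdiff_kwedge m (g c : 'I_m -> A) w :
  kdiff g (kwedge c w) + kwedge c (kdiff g w) = (\sum_i c i * g i) *: w.
Proof.
elim: m g c w => [|m IH] g c w; first by rewrite big_ord0 scale0r [LHS]addr0.
rewrite big_ord_recl; elim/koszul_cases: w => a b.
rewrite !(kdiffE, kwedgeE) kconsD kconsZ -!/(ftail _); congr kcons.
    rewrite kwedgeD kwedgeZ scalerBr scalerA scalerDl -(IH (ftail g) (ftail c) a).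
  rewrite [g ord0 * _]mulrC; move: (kdiff _ _) (kwedge _ _) (_ *: a) (_ *: kwedge _ _) => x y z t.
  by rewrite !addrA [LHS](ACl (2 * 1 * 4 * (3 * 5))%AC)/= addNr addr0.
rewrite kdiffB kdiffZ kwedgeN opprB opprK !scalerDr scalerA scalerDl -(IH (ftail g) (ftail c) b).
move: (kdiff _ (kwedge _ _)) (kwedge _ (kdiff _ b)) (c ord0 *: kdiff _ _) (_ *: b) => x y z t.
by rewrite !addrA [LHS](ACl (4 * 1 * 5 * (3 * 2))%AC)/= subrr addr0.
Qed.

Lemma kdegE m p (a b : koszul m) :
  kdeg p (kcons a b) = (kdeg p a /\ if p is p'.+1 then kdeg p' b else b = 0).
Proof. by []. Qed.

Lemma kinE m I (a b : koszul m) : kin I (kcons a b) = (kin I a /\ kin I b).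
Proof. by []. Qed.

Lemma kdeg0 m p : @kdeg m p 0.
Proof.
by elim: m p => [|m IH] p; rewrite ?kdegE; [case: p | split; [exact: IH | case: p]].
Qed.

Lemma kdegD m p (c : A) (u v : koszul m) : kdeg p u -> kdeg p v -> kdeg p (c *: u + v).
Proof.
elim: m p u v => [|m IH] p u v; first by case: p => // p /= -> ->; rewrite scaler0 addr0.
elim/koszul_cases: u => u1 u2; elim/koszul_cases: v => v1 v2.
rewrite kcons_linear !kdegE => -[h1 h2] [h3 h4]; split; first exact: IH.
by case: p {h1 h3} h2 h4 => [-> ->|p]; [rewrite scaler0 addr0 | exact: IH].
Qed.

Lemma kdegN m p (u : koszul m) : kdeg p u -> kdeg p (- u).
Proof. by move=> /(kdegD (-1))/(_ (kdeg0 _ _)); rewrite addr0 scaleN1r. Qed.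

Lemma kdeg_sub m p (u v : koszul m) : kdeg p u -> kdeg p v -> kdeg p (u - v).
Proof. by move=> hu /kdegN /(kdegD 1 hu); rewrite scale1r. Qed.

Lemma kdiff_deg0 m (g : 'I_m -> A) w : kdeg 0 w -> kdiff g w = 0.
Proof.
elim: m g w => [//|m IH] g w; elim/koszul_cases: w => a b.
by rewrite kdegE kdiffE => -[/IH -> ->]; rewrite scaler0 addr0 kdiff0 oppr0.
Qed.

Lemma kdiff_deg m p (g : 'I_m -> A) w : kdeg p.+1 w -> kdeg p (kdiff g w).
Proof.
elim: m p g w => [|m IH] p g w; first by move=> _; exact: kdeg0.
elim/koszul_cases: w => a b; rewrite kdiffE !kdegE => -[ha hb]; split.
  by rewrite addrC; apply: kdegD => //; exact: IH.
by case: p hb {ha} => [/kdiff_deg0 -> | p /IH hb]; [rewrite oppr0 | exact: kdegN].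
Qed.

Lemma kwedge_deg m p (c : 'I_m -> A) w : kdeg p w -> kdeg p.+1 (kwedge c w).
Proof.
elim: m p c w => [//|m IH] p c w.
elim/koszul_cases: w => a b; rewrite kwedgeE !kdegE => -[ha hb]; split.
  exact: IH.
apply: kdegD => //; apply: kdegN.
by case: p hb {ha} => [-> | p /IH hb]; [rewrite kwedge0; exact: kdeg0 |].
Qed.

Lemma kdeg_top m p (w : koszul m) : (m < p)%N -> kdeg p w -> w = 0.
Proof.
elim: m p w => [|m IH] [//|p] w; first by [].
elim/koszul_cases: w => a b mp; rewrite kdegE => -[h1 h2]; rewrite (IH p _ mp h2) (IH p.+1 _ _ h1)//.
exact: ltnW mp.
Qed.

Lemma kin0 m I : ideal_set I -> @kin m I 0.
Proof. by move=> -[I0 _]; elim: m => [//|m IH]; rewrite kinE. Qed.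

Lemma kinD m I (c : A) (u v : koszul m) :
  ideal_set I -> kin I u -> kin I v -> kin I (c *: u + v).
Proof.
move=> [_ ID]; elim: m u v => [u v|m IH u v]; first exact: ID.
elim/koszul_cases: u => u1 u2; elim/koszul_cases: v => v1 v2.
by rewrite kcons_linear !kinE => -[h1 h2] [h3 h4]; split; exact: IH.
Qed.

Lemma kin_sub m I (u v : koszul m) : ideal_set I -> kin I u -> kin I v -> kin I (u - v).
Proof. by move=> hI hu hv; rewrite addrC -scaleN1r; exact: kinD. Qed.

Lemma kin_diff m I (g : 'I_m -> A) w : ideal_set I -> kin I w -> kin I (kdiff g w).
Proof.
move=> hI; elim: m g w => [|m IH] g w; first by move=> _; exact: kin0.
elim/koszul_cases: w => a b; rewrite kdiffE !kinE => -[ha hb]; split.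
  by rewrite addrC; apply: kinD => //; exact: IH.
by rewrite -sub0r; apply: kin_sub (kin0 _ _) (IH _ _ _).
Qed.

Lemma kin_wedge m I (c : 'I_m -> A) w : ideal_set I -> kin I w -> kin I (kwedge c w).
Proof.
move=> hI; elim: m c w => [|m IH] c w; first by move=> _; exact: kin0.
elim/koszul_cases: w => a b; rewrite kwedgeE !kinE => -[ha hb]; split; first exact: IH.
rewrite -[_ *: _]addr0 -addrA; apply: kinD => //; rewrite sub0r -sub0r.
exact: kin_sub (kin0 _ _) (IH _ _ _).
Qed.

Lemma kin_regular m I (x : A) (w : koszul m) :
  (forall u, I (x * u) -> I u) -> kin I (x *: w) -> kin I w.
Proof.
move=> xI; elim: m w => [w|m IH w]; first exact: xI.
by elim/koszul_cases: w => a b; rewrite kconsZ !kinE => -[/IH ha /IH hb].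
Qed.

(** The ideal [I + (x)]. *)
Definition add_gen (I : set A) (x : A) : set A := fun u => exists v, I (u - x * v).

Lemma add_gen_ideal I x : ideal_set I -> ideal_set (add_gen I x).
Proof.
move=> [I0 ID]; split; first by exists 0; rewrite mulr0 subr0.
move=> a u v [u' hu] [v' hv]; exists (a * u' + v').
have -> : a * u + v - x * (a * u' + v') = a * (u - x * u') + (v - x * v') by ring.
exact: ID.
Qed.

(** The multiplier [z] can be chosen homogeneous, which the lifting in
    [acyclic_mod_step] needs. *)
Lemma kin_add_gen m p I x (w : koszul m) : ideal_set I -> kdeg p w ->
  kin (add_gen I x) w -> exists2 z, kdeg p z & kin I (w - x *: z).
Proof.
move=> hI; elim: m p w => [|m IH] p w.
  case: p => [_ [v hv]|p /= -> _]; first by exists v.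
  by exists 0 => //; rewrite scaler0 subr0; case: hI.
elim/koszul_cases: w => a b; rewrite kdegE kinE => -[ha hb] [ia ib].
have [a' da' ia'] := IH _ _ ha ia.
have [b' db' ib'] : exists2 b', if p is p'.+1 then kdeg p' b' else b' = 0 &
    kin I (b - x *: b').
  case: p hb {ha da'} => [-> |p hb]; last exact: IH.
  by exists 0 => //; rewrite scaler0 subr0; exact: kin0.
by exists (kcons a' b'); rewrite ?kdegE// kconsZ kconsN kconsD kinE.
Qed.

(** The Koszul homology of [g] with coefficients in the quotient by [I] vanishes
    in degree [p]. *)
Definition acyclic_mod m (g : 'I_m -> A) (I : set A) (p : nat) :=
  forall w, kdeg p w -> kin I (kdiff g w) ->
  exists2 z, kdeg p.+1 z & kin I (w - kdiff g z).

(** For a cycle [w] modulo [I], the homotopy gives [d (c /\ w) = x w] modulo [I].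
    So [c /\ w] is a cycle modulo [I + (x)], hence of the form [d z + x y] modulo
    [I]; applying [d] yields [x w = x d y] modulo [I], and [x] can be cancelled.
    This is the surjectivity of the connecting map in the long exact sequence of
    multiplication by [x]. *)
Lemma acyclic_mod_step m (g : 'I_m -> A) (I : set A) (x : A) (c : 'I_m -> A) p :
  ideal_set I -> (forall u, I (x * u) -> I u) -> x = \sum_i c i * g i ->
  acyclic_mod g (add_gen I x) p.+1 -> acyclic_mod g I p.
Proof.
move=> hI xI xE hp w dw iw.
have hx := kdiff_kwedge g c w; rewrite -xE in hx.
have dcw := kwedge_deg c dw.
have icw : kin (add_gen I x) (kdiff g (kwedge c w)).
  have -> : kdiff g (kwedge c w) = x *: w - kwedge c (kdiff g w) by rewrite -hx addrK.
  have sub (u : koszul m) : kin I u -> kin (add_gen I x) u.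
    elim: (m) u => [u hu|k IH u]; first by exists 0; rewrite mulr0 subr0.
    by elim/koszul_cases: u => a b; rewrite !kinE => -[/IH ? /IH ?].
  have hI' := add_gen_ideal x hI.
  apply: kin_sub => //; last by apply: sub; exact: kin_wedge.
  elim: (m) (w) => [u|k IH u]; last by elim/koszul_cases: u => a b; rewrite kconsZ kinE.
  by exists u; rewrite subrr; case: hI.
have [z dz iz] := hp _ dcw icw.
have [y dy iy] := kin_add_gen hI (kdeg_sub dcw (kdiff_deg g dz)) iz.
exists y => //; apply: (kin_regular xI).
have := kin_diff g hI iy; rewrite !kdiffB kdiff_kdiff subr0 kdiffZ => iy'.
have := kinD 1 hI (kin_wedge c hI iw) iy'.
by rewrite scale1r addrA [kwedge _ _ + _]addrC hx scalerBr.
Qed.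

Fixpoint regular_seq (I : set A) (xs : seq A) : Prop :=
  if xs is x :: xs' then
    (forall u, I (x * u) -> I u) /\ regular_seq (add_gen I x) xs'
  else True.

(** Descending induction from the degrees above the top degree [m], where the
    complex vanishes: each element of the regular sequence lowers the degree in
    which the homology is known to vanish by one. *)
Lemma regular_seq_acyclic m (g : 'I_m -> A) I xs p :
  ideal_set I -> regular_seq I xs ->
  (forall x, x \in xs -> exists c : 'I_m -> A, x = \sum_i c i * g i) ->
  (m < size xs + p)%N -> acyclic_mod g I p.
Proof.
elim: xs I p => [|x xs IH] I p hI.
  move=> _ _ mp w /(kdeg_top mp) -> _; exists 0; first exact: kdeg0.
  by rewrite kdiff0 subr0; exact: kin0.
move=> [xI hxs] hc mp; have [c xE] := hc x (mem_head _ _).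
apply: acyclic_mod_step xI xE _ => //; apply: IH => //.
- exact: add_gen_ideal.
- by move=> y hy; apply: hc; rewrite inE hy orbT.
- by rewrite addnS.
Qed.

Fixpoint kconst m (a : A) : koszul m :=
  if m is m'.+1 then kcons (kconst m' a) 0 else a.

(** The element [sum_i u_i e_i] of degree one. *)
Fixpoint kform m : ('I_m -> A) -> koszul m :=
  if m is m'.+1 then fun u => kcons (kform (ftail u)) (kconst m' (u ord0)) else fun=> 0.

Lemma kconstS m a : kconst m.+1 a = kcons (kconst m a) 0.
Proof. by []. Qed.

Lemma kformS m (u : 'I_m.+1 -> A) : kform u = kcons (kform (ftail u)) (kconst m (u ord0)).
Proof. by []. Qed.

Lemma kconst_linear m c a b : kconst m (c * a + b) = c *: kconst m a + kconst m b.
Proof.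
by elim: m => [//|m IH]; rewrite !kconstS kcons_linear -IH scaler0 addr0.
Qed.

Lemma kconst0 m : kconst m 0 = 0.
Proof. by elim: m => [//|m IH]; rewrite kconstS IH. Qed.

Lemma kconst_eq0 m a : kconst m a = 0 -> a = 0.
Proof. by elim: m => [//|m IH] [/IH]. Qed.

Lemma kdeg_const m a : kdeg 0 (kconst m a).
Proof. by elim: m => [|m IH]. Qed.

Lemma kconstP m (w : koszul m) : kdeg 0 w -> exists a, w = kconst m a.
Proof.
elim: m w => [w _|m IH w]; first by exists w.
by elim/koszul_cases: w => a b; rewrite kdegE => -[/IH[c ->] ->]; exists c.
Qed.

Lemma kform_linear m c (u v : 'I_m -> A) :
  kform (fun i => c * u i + v i) = c *: kform u + kform v.
Proof.
elim: m u v => [|m IH] u v; first by rewrite [RHS]addr0 scaler0.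
by rewrite !kformS kcons_linear -kconst_linear -IH.
Qed.

Lemma kdeg_form m (u : 'I_m -> A) : kdeg 1 (kform u).
Proof. by elim: m u => [//|m IH] u; split; [exact: IH | exact: kdeg_const]. Qed.

Lemma kdiff_form m (g u : 'I_m -> A) : kdiff g (kform u) = kconst m (\sum_i u i * g i).
Proof.
elim: m g u => [|m IH] g u; first by rewrite big_ord0.
rewrite kformS kdiffE IH kdiff_deg0 ?oppr0; last exact: kdeg_const.
by rewrite big_ord_recl mulrC kconstS kconst_linear addrC.
Qed.

Lemma kform_inj m (u v : 'I_m -> A) : kform u = kform v -> u =1 v.
Proof.
elim: m u v => [u v _ []//|m IH] u v.
rewrite !kformS => -[/IH h1 h2] i.
case: (unliftP ord0 i) => [j ->|->]; first exact: h1.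
apply/eqP; rewrite -subr_eq0; apply/eqP/(@kconst_eq0 m).
by rewrite addrC -mulN1r kconst_linear -h2 scaleN1r addNr.
Qed.

Lemma kformP m (w : koszul m) : kdeg 1 w -> exists u, w = kform u.
Proof.
elim: m w => [w -> | m IH w]; first by exists (fun=> 0).
elim/koszul_cases: w => a b; rewrite kdegE => -[/IH[u ->] /kconstP[c ->]].
exists (fun i => if unlift ord0 i is Some j then u j else c).
rewrite kformS unlift_none; congr kcons; congr kform.
by apply/boolp.funext => j; rewrite /ftail liftK.
Qed.

(** The boundaries of degree one are the antisymmetric combinations of the [g_i];
    writing the coefficients as [c - c^T] makes them alternating in every
    characteristic. *)
Lemma kdiff_deg2 m (g : 'I_m -> A) w : kdeg 2 w ->
  exists c : 'M[A]_m, kdiff g w = kform (fun j => \sum_i g i * (c i j - c j i)).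
Proof.
elim: m g w => [|m IH] g w; first by move=> _; exists 0.
elim/koszul_cases: w => a b; rewrite kdegE => -[/(IH (ftail g))[c ca] /kformP[u ->]].
exists (\matrix_(i, j) match unlift ord0 i, unlift ord0 j with
  | None, Some j' => u j' | Some i', Some j' => c i' j' | _, None => 0 end).
rewrite kdiffE ca kdiff_form kformS; congr kcons.
  rewrite addrC -kform_linear; congr kform; apply/boolp.funext => j.
  rewrite [in RHS]/ftail big_ord_recl !mxE unlift_none liftK subr0; congr (_ + _).
  by apply: eq_bigr => i _; rewrite !mxE !liftK.
rewrite big_ord_recl !mxE unlift_none subrr mulr0 add0r -[- _]addr0.
rewrite -[in LHS](kconst0 m) -scaleN1r -kconst_linear addr0 mulN1r -sumrN.
congr kconst; apply: eq_bigr => i _.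
by rewrite !mxE unlift_none liftK sub0r mulrN mulrC.
Qed.

(** Depth sensitivity in degree one: a regular sequence of length [m] brings the
    vanishing down from degree [m + 1] to degree one, and the relation [xi], viewed
    as a cycle of degree one, is then the boundary of a form of degree two. *)
Theorem koszul_relations m (g : 'I_m -> A) (ys : seq A) (xi : 'I_m -> A) :
  regular_seq [set 0] ys -> size ys = m ->
  (forall y, y \in ys -> exists c : 'I_m -> A, y = \sum_i c i * g i) ->
  \sum_i xi i * g i = 0 ->
  exists c : 'M[A]_m, forall j, xi j = \sum_i g i * (c i j - c j i).
Proof.
move=> hy sy yg xi0.
have id0 : ideal_set [set 0 : A].
  by split=> // a u v /= -> ->; rewrite mulr0 addr0.
have kin00 k (w : koszul k) : kin [set 0] w -> w = 0.
  elim: k w => [//|k IH] w; elim/koszul_cases: w => a b.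
  by rewrite kinE => -[/IH -> /IH ->].
have [|||z dz /kin00] := @regular_seq_acyclic m g _ ys 1 id0 hy yg _ (kform xi).
- by rewrite sy addn1.
- exact: kdeg_form.
- by rewrite kdiff_form xi0 kconst0; exact: kin0.
have [c ->] := kdiff_deg2 g dz => /eqP; rewrite subr_eq0 => /eqP /kform_inj h.
by exists c.
Qed.

End Koszul.

(** An abstract form of a ring of power series: [E i] sets the variable [x i] to
    zero, and the remainder is divisible by [x i]. *)
Section RegularPowers.
Variables (A : comNzRingType) (m : nat) (x : 'I_m -> A) (E : 'I_m -> {rmorphism A -> A}).
Hypothesis E_same : forall i, E i (x i) = 0.
Hypothesis E_other : forall i j, i != j -> E i (x j) = x j.
Hypothesis x_regular : forall i u, x i * u = 0 -> u = 0.
Hypothesis E_divides : forall i u, exists v, u = E i u + x i * v.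

(** The ideal [I] is compatible with the decomposition of the ring into series
    without [x i] and multiples of [x i]. This passes to [I + (x j ^+ n)] for [j]
    different from [i], and makes [x i] a nonzerodivisor modulo [I]. *)
Definition split_stable (I : set A) i :=
  forall u v, I (E i u + x i * v) -> I (E i u) /\ I v.

Lemma E_idem i u : E i (E i u) = E i u.
Proof. by have [v {2}->] := E_divides i u; rewrite rmorphD rmorphM E_same mul0r addr0. Qed.

Lemma split_stable_regular I i n u : ideal_set I -> split_stable I i -> I (x i ^+ n * u) -> I u.
Proof.
move=> hI hi; elim: n => [|n IH]; first by rewrite mul1r.
rewrite exprS -mulrA => h; apply: IH.
by have := hi 0 (x i ^+ n * u); rewrite rmorph0 add0r => /(_ h)[].
Qed.

Lemma split_stable0 i : split_stable [set 0] i.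
Proof.
move=> u v /= h; have := congr1 (E i) h.
rewrite rmorphD rmorphM E_same mul0r addr0 rmorph0 E_idem => Eu.
by move: h; rewrite Eu add0r => /x_regular.
Qed.

Lemma split_stable_add_gen I i j n : ideal_set I -> i != j ->
  split_stable I i -> split_stable (add_gen I (x j ^+ n)) i.
Proof.
move=> hI ij hi u v [w].
have [w' {1}->] := E_divides i w.
have Exn : E i (x j ^+ n) = x j ^+ n by rewrite rmorphXn E_other.
have -> : E i u + x i * v - x j ^+ n * (E i w + x i * w')
  = E i (u - x j ^+ n * w) + x i * (v - x j ^+ n * w').
  by rewrite rmorphB rmorphM Exn; ring.
move=> /hi[]; rewrite rmorphB rmorphM Exn => h1 h2.
by split; [exists (E i w) | exists w'].
Qed.

Lemma regular_powers (n : 'I_m -> nat) (s : seq 'I_m) :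
  uniq s -> regular_seq [set 0] [seq x i ^+ n i | i <- s].
Proof.
suff h I : ideal_set I -> (forall i, i \in s -> split_stable I i) ->
    uniq s -> regular_seq I [seq x i ^+ n i | i <- s].
  apply: h => [|i _]; last exact: split_stable0.
  by split=> // a u v /= -> ->; rewrite mulr0 addr0.
elim: s I => [//|i s IH] I hI hs /= /andP[i_s us]; split.
  by move=> u; apply: split_stable_regular => //; apply: hs; exact: mem_head.
apply: IH => //; first exact: add_gen_ideal.
move=> j js; apply: split_stable_add_gen => //.
  by apply: contraNneq i_s => <-.
by apply: hs; rewrite inE js orbT.
Qed.

End RegularPowers.

(** * Dimensions of subquotients *)

Section Dim.
Variables (K : fieldType).

Section OneAlgebra.
Variable A : comAlgType K.
Implicit Types E : lmodType A.

Definition ksubspace E (V : set E) :=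
  V 0 /\ forall (c : K) u v, V u -> V v -> V (c%:A *: u + v).

Definition klinear_on E (V : set E) d (k : E -> 'rV[K]_d) :=
  forall (c : K) u v, V u -> V v -> k (c%:A *: u + v) = c *: k u + k v.

(** A linear surjection from [V] to row vectors with kernel [W]: an isomorphism of
    the quotient with a coordinate space, in a form that avoids quotient
    types. *)
Definition coordinates E (V W : set E) d (k : E -> 'rV[K]_d) :=
  [/\ klinear_on V k, forall r, exists2 v, V v & k v = r &
      forall v, V v -> (k v = 0 <-> W v)].

Lemma ksubD E (V : set E) u v : ksubspace V -> V u -> V v -> V (u + v).
Proof. by move=> [_ VD] hu hv; have := VD 1 _ _ hu hv; rewrite !scale1r. Qed.

Lemma ksubZ E (V : set E) c u : ksubspace V -> V u -> V (c%:A *: u).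
Proof. by move=> [V0 VD] hu; have := VD c _ _ hu V0; rewrite addr0. Qed.

Lemma ksubN E (V : set E) u : ksubspace V -> V u -> V (- u).
Proof. by move=> hV /(ksubZ (-1) hV); rewrite scaleN1r scaleN1r. Qed.

Lemma ksubB E (V : set E) u v : ksubspace V -> V u -> V v -> V (u - v).
Proof. by move=> hV hu hv; apply: ksubD => //; exact: ksubN. Qed.

Lemma ksub_sum E (V : set E) d (e : 'I_d -> E) (c : 'I_d -> K) : ksubspace V ->
  (forall i, V (e i)) -> V (\sum_i (c i)%:A *: e i).
Proof.
move=> hV he; elim/big_ind: _ => [|u v hu hv|i _].
- by case: hV.
- exact: ksubD.
- exact: ksubZ.
Qed.

Lemma setT_ksubspace E : ksubspace (setT : set E).
Proof. by split. Qed.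

Lemma submodule_ksubspace E (V : set E) : submodule V -> ksubspace V.
Proof. by move=> [V0 VD]; split=> // c u v; exact: VD. Qed.

Lemma klinear_on0 E (V : set E) d (k : E -> 'rV[K]_d) :
  ksubspace V -> klinear_on V k -> k 0 = 0.
Proof.
move=> [V0 _] /(_ (-1) 0 0 V0 V0).
by rewrite scaler0 addr0 scaleN1r addNr.
Qed.

Lemma klinear_onD E (V : set E) d (k : E -> 'rV[K]_d) u v :
  klinear_on V k -> V u -> V v -> k (u + v) = k u + k v.
Proof. by move=> kl hu hv; have := kl 1 _ _ hu hv; rewrite !scale1r. Qed.

Lemma klinear_onB E (V : set E) d (k : E -> 'rV[K]_d) u v :
  klinear_on V k -> V u -> V v -> k (u - v) = k u - k v.
Proof.
move=> kl hu hv; have := kl (-1) _ _ hv hu; rewrite !scaleN1r.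
by rewrite addrC => ->; rewrite addrC.
Qed.

Lemma klinear_on_sum E (V : set E) d (k : E -> 'rV[K]_d) n (e : 'I_n -> E) (c : 'I_n -> K) :
  ksubspace V -> klinear_on V k -> (forall i, V (e i)) ->
  k (\sum_i (c i)%:A *: e i) = \sum_i c i *: k (e i).
Proof.
move=> hV kl he.
suff [] : V (\sum_i (c i)%:A *: e i) /\ k (\sum_i (c i)%:A *: e i) = \sum_i c i *: k (e i) by [].
elim/big_rec2: _ => [|i u v _ [hv <-]]; first by rewrite (klinear_on0 hV kl); split=> //; case: hV.
by split; [case: hV => _; apply | rewrite kl].
Qed.

Lemma quotient_dimP E (V W : set E) d : ksubspace V -> ksubspace W -> W `<=` V ->
  quotient_dim V W d <-> exists k : E -> 'rV[K]_d, coordinates V W k.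
Proof.
move=> hV hW WV; split=> [[e eV he]|[k [kl ks kk]]].
  pose comb (c : 'rV[K]_d) := \sum_i (c ord0 i)%:A *: e i.
  have combV c : V (comb c) by exact: ksub_sum.
  have comb_lin c r s : comb (c *: r + s) = c%:A *: comb r + comb s.
    rewrite /comb scaler_sumr -big_split/=; apply: eq_bigr => i _.
    by rewrite !mxE scalerDl scalerDl scalerA -[_ *: _ * _]scalerAl mul1r scalerA.
  have uniq v c c' : V v -> W (v - comb c) -> W (v - comb c') -> c = c'.
    by move=> /he[c0 [_ h]] /h <- /h <-.
  pose k v := xget 0 [set c | W (v - comb c)].
  have kP v : V v -> W (v - comb (k v)).
    by move=> /he[c [hc _]]; rewrite /k; case: xgetP => [? -> //|/(_ c)].
  exists k; split.
  - move=> c u v hu hv; apply: (uniq (c%:A *: u + v)).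
    + by case: hV => _; apply.
    + by apply: kP; case: hV => _; apply.
    + rewrite comb_lin opprD addrACA -scalerBr.
      by case: hW => _; apply; exact: kP.
  - move=> r; exists (comb r) => //; apply: (uniq (comb r)) => //; first exact: kP.
    by rewrite subrr; case: hW.
  - have comb0 : comb 0 = 0 by rewrite /comb big1// => i _; rewrite mxE !scale0r.
    move=> v hv; split=> [kv|Wv]; first by have := kP v hv; rewrite kv comb0 subr0.
    by apply: (uniq v) => //; [exact: kP | rewrite comb0 subr0].
have /choice[e he] : forall i, exists v, V v /\ k v = delta_mx 0 i.
  by move=> i; have [v] := ks (delta_mx 0 i); exists v.
have eV i : V (e i) by case: (he i).
exists e => // v hv.
have kc (c : 'rV[K]_d) : k (\sum_i (c ord0 i)%:A *: e i) = c.
  rewrite (klinear_on_sum _ hV kl eV) [RHS]row_sum_delta.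
  by apply: eq_bigr => i _; case: (he i) => _ ->.
have iff (c : 'rV[K]_d) : W (v - \sum_i (c ord0 i)%:A *: e i) <-> k v = c.
  have hc : V (\sum_i (c ord0 i)%:A *: e i) by exact: ksub_sum.
  rewrite -kk; last exact: ksubB.
  rewrite (klinear_onB kl)// kc; split=> [/eqP|->]; last exact: subrr.
  by rewrite subr_eq0 => /eqP.
by exists (k v); split=> [|c /iff]; first exact/iff.
Qed.

(** A matrix of maximal rank among those with row space in [S] spans [S], since a
    vector outside its row space would raise the rank. *)
Lemma subspace_rows d (S : set 'rV[K]_d) :
  S 0 -> (forall c u v, S u -> S v -> S (c *: u + v)) ->
  exists M : 'M[K]_d, forall v, S v <-> (v <= M)%MS.
Proof.
move=> S0 SD.
pose P r := `[< exists M : 'M[K]_d, (forall v, (v <= M)%MS -> S v) /\ \rank M = r >].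
have exP : exists r, P r.
  exists 0%N; apply/asboolP; exists 0; split; last by rewrite mxrank0.
  by move=> v; rewrite submx0 => /eqP ->.
have boundP r : P r -> (r <= d)%N by move=> /asboolP[M [_ <-]]; exact: rank_leq_row.
case: (ex_maxnP exP boundP) => r /asboolP[M [MS Mr]] rmax.
exists M => v; split=> [Sv|]; last exact: MS.
have : P (\rank (M + v)%MS).
  apply/asboolP; exists (M + v)%MS; split=> // u /sub_addsmxP[[u1 u2] /= ->].
  rewrite addrC [u2]mx11_scalar mul_scalar_mx; apply: SD => //.
  by apply: MS; exact: submxMl.
move=> /rmax h; apply: submx_trans (addsmxSr M v) _.
by rewrite -(geq_leqif (mxrank_leqif_sup (addsmxSl M v))) Mr.
Qed.

Lemma subspace_quotient_dim E (U W : set E) d (k : E -> 'rV[K]_d) :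
  ksubspace U -> ksubspace W -> W `<=` U -> klinear_on U k ->
  (forall u, U u -> (k u = 0 <-> W u)) ->
  exists M : 'M[K]_d, (forall r, (exists2 u, U u & k u = r) <-> (r <= M)%MS) /\
    quotient_dim U W (\rank M).
Proof.
move=> hU hW WU kl kk.
have [||M hM] := @subspace_rows d [set k u | u in U].
- by exists 0; [case: hU | exact: klinear_on0 kl].
- by move=> c _ _ [u hu <-] [v hv <-]; exists (c%:A *: u + v); [case: hU => _; apply | exact: kl].
exists M; split=> //; apply/quotient_dimP => //.
exists (fun u => k u *m pinvmx (row_base M)); split.
- by move=> c u v hu hv; rewrite kl// mulmxDl scalemxAl.
- move=> r; have /hM[u hu ku] : (r *m row_base M <= M)%MS.
    by apply: submx_trans (submxMl _ _) _; rewrite eq_row_base.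
  by exists u => //; rewrite ku mulmxKp// row_base_free.
- move=> u hu; rewrite -kk//; split=> [h|->]; last by rewrite mul0mx.
  rewrite -[k u](@mulmxKpV _ _ _ _ _ (row_base M)) ?h ?mul0mx// eq_row_base.
  by apply/hM; exists u.
Qed.

Lemma quotient_dim_split E (V U W : set E) d :
  ksubspace V -> ksubspace U -> ksubspace W -> W `<=` U -> U `<=` V ->
  quotient_dim V W d ->
  exists d1 d2, [/\ quotient_dim U W d1, quotient_dim V U d2 & d = (d1 + d2)%N].
Proof.
move=> hV hU hW WU UV /quotient_dimP[]//; first exact: subset_trans UV.
move=> k [kl ks kk].
have klU : klinear_on U k by move=> c u v /UV hu /UV hv; exact: kl.
have kkU u : U u -> (k u = 0 <-> W u) by move=> /UV; exact: kk.
have [M [hM dU]] := subspace_quotient_dim hU hW WU klU kkU.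
exists (\rank M), (\rank (cokermx M)); split=> //; last first.
  by rewrite mxrank_coker subnKC// rank_leq_col.
apply/quotient_dimP => //.
exists (fun v => k v *m col_base (cokermx M)); split.
- by move=> c u v hu hv; rewrite kl// mulmxDl scalemxAl.
- move=> r; have /submxP[D rD] := submx_full r (col_base_full (cokermx M)).
  by have [v hv kv] := ks D; exists v => //; rewrite kv.
- move=> v hv.
  have -> : (k v *m col_base (cokermx M) = 0) <-> (k v *m cokermx M = 0).
    have -> : k v *m cokermx M = k v *m col_base (cokermx M) *m row_base (cokermx M).
      by rewrite -mulmxA mulmx_base.
    split=> [->|h]; first by rewrite mul0mx.
    by apply: (row_free_inj (row_base_free (cokermx M))); rewrite h mul0mx.
  rewrite (rwP eqP) -submxE -hM; split=> [[u hu kuv]|hu]; last by exists v.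
  rewrite -[v](subrK u); apply: ksubD => //; apply/WU/kk; first exact: ksubB (UV _ hu).
  by rewrite (klinear_onB kl)// ?kuv ?subrr//; exact: UV.
Qed.

Lemma quotient_dim_extend E (V U W : set E) d1 d2 :
  ksubspace V -> ksubspace U -> ksubspace W -> W `<=` U -> U `<=` V ->
  quotient_dim U W d1 -> quotient_dim V U d2 -> quotient_dim V W (d1 + d2).
Proof.
move=> hV hU hW WU UV /quotient_dimP[]// k1 [kl1 ks1 kk1] dVU.
have [k2 [kl2 ks2 kk2]] := (quotient_dimP d2 hV hU UV).1 dVU.
have /choice[e' he] : forall i, exists v, V v /\ k2 v = delta_mx 0 i.
  by move=> i; have [v] := ks2 (delta_mx 0 i); exists v.
have eV' i : V (e' i) by case: (he i).
pose comb (c : 'rV[K]_d2) := \sum_i (c ord0 i)%:A *: e' i.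
have combV c : V (comb c) by exact: ksub_sum.
have comb_lin c r s : comb (c *: r + s) = c%:A *: comb r + comb s.
  rewrite /comb scaler_sumr -big_split/=; apply: eq_bigr => i _.
  by rewrite !mxE scalerDl scalerDl scalerA -[_ *: _ * _]scalerAl mul1r scalerA.
have kc c : k2 (comb c) = c.
  rewrite (klinear_on_sum _ hV kl2 eV') [RHS]row_sum_delta.
  by apply: eq_bigr => i _; case: (he i) => _ ->.
have restU v : V v -> U (v - comb (k2 v)).
  move=> hv; apply/kk2; first exact: ksubB.
  by rewrite (klinear_onB kl2)// kc subrr.
apply/quotient_dimP => //; first exact: subset_trans UV.
exists (fun v => row_mx (k1 (v - comb (k2 v))) (k2 v)); split.
- move=> c u v hu hv; rewrite scale_row_mx add_row_mx kl2//; congr row_mx.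
  rewrite comb_lin opprD addrACA -scalerBr kl1//; exact: restU.
- move=> r; have [u hu ku] := ks1 (lsubmx r).
  have k2u : k2 u = 0 by apply/kk2 => //; exact: UV.
  have k2v : k2 (u + comb (rsubmx r)) = rsubmx r.
    by rewrite (klinear_onD kl2)// ?kc ?k2u ?add0r//; exact: UV.
  exists (u + comb (rsubmx r)); first by apply: ksubD => //; exact: UV.
  by rewrite k2v addrK ku hsubmxK.
- have comb0 : comb 0 = 0 by rewrite /comb big1// => i _; rewrite mxE !scale0r.
  move=> v hv; split=> [|Wv].
    rewrite -(@row_mx0 K 1 d1 d2) => /eq_row_mx[h1 h2].
    have /kk1 := restU v hv; rewrite h1 h2 comb0 subr0 => <- //.
  have k2v : k2 v = 0 by apply/kk2 => //; exact: WU.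
  rewrite k2v comb0 subr0 (_ : k1 v = 0) ?row_mx0//; apply/kk1 => //; exact: WU.
Qed.

End OneAlgebra.

Section TwoAlgebras.
Variables A A' : comAlgType K.

(** The map [phi] induces an isomorphism of the quotients; this form carries a
    known dimension from the target back to the source, and
    [quotient_dim_push] carries it forward. The two spaces may live over different
    algebras, as is the case for germs on C^n and on C^m. *)
Lemma quotient_dim_pull (E : lmodType A) (E' : lmodType A') (V W : set E) (V' W' : set E')
    (phi : E -> E') d :
  ksubspace V -> ksubspace W -> W `<=` V -> ksubspace V' -> ksubspace W' -> W' `<=` V' ->
  (forall (c : K) u v, V u -> V v -> phi (c%:A *: u + v) = c%:A *: phi u + phi v) ->
  (forall v, V v -> V' (phi v)) ->
  (forall v, V v -> (W' (phi v) <-> W v)) ->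
  (forall v', V' v' -> exists2 v, V v & W' (v' - phi v)) ->
  quotient_dim V' W' d -> quotient_dim V W d.
Proof.
move=> hV hW WV hV' hW' WV' phil phiV phiW phis /quotient_dimP[]// k [kl ks kk].
apply/quotient_dimP => //; exists (k \o phi); split.
- by move=> c u v hu hv /=; rewrite phil// kl//; exact: phiV.
- move=> r; have [v' hv' <-] := ks r; have [v hv hvv'] := phis _ hv'.
  exists v => //=; apply/esym/eqP; rewrite -subr_eq0; apply/eqP.
  rewrite -(klinear_onB kl)//; last exact: phiV.
  by apply/kk => //; exact: WV'.
- by move=> v hv /=; rewrite -phiW//; apply: kk; exact: phiV.
Qed.

Lemma quotient_dim_push (E : lmodType A) (E' : lmodType A') (V W : set E) (V' W' : set E')
    (phi : E -> E') d :
  ksubspace V -> ksubspace W -> W `<=` V -> ksubspace V' -> ksubspace W' -> W' `<=` V' ->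
  (forall (c : K) u v, V u -> V v -> phi (c%:A *: u + v) = c%:A *: phi u + phi v) ->
  (forall v, V v -> V' (phi v)) ->
  (forall v, V v -> (W' (phi v) <-> W v)) ->
  (forall v', V' v' -> exists2 v, V v & W' (v' - phi v)) ->
  quotient_dim V W d -> quotient_dim V' W' d.
Proof.
move=> hV hW WV hV' hW' WV' phil phiV phiW phis /quotient_dimP[]// k [kl ks kk].
have /choice[s hs] : forall v', exists v, V' v' -> V v /\ W' (v' - phi v).
  move=> v'; case: (pselect (V' v')) => [/phis[v hv hvv']|h]; first by exists v.
  by exists 0.
have phiB u v : V u -> V v -> phi (v - u) = phi v - phi u.
  by move=> hu hv; have := phil (-1) _ _ hu hv; rewrite !scaleN1r ![- _ + _]addrC.
have kE v' v : V' v' -> V v -> W' (v' - phi v) -> k (s v') = k v.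
  move=> hv' hv h; have [hs1 hs2] := hs _ hv'.
  apply/eqP; rewrite -subr_eq0; apply/eqP; rewrite -(klinear_onB kl)//.
  apply/kk; first exact: ksubB.
  apply/phiW; first exact: ksubB.
  by rewrite phiB// -(subrKA v') -opprB addrC; apply: ksubB.
apply/quotient_dimP => //; exists (k \o s); split.
- move=> c u' v' hu' hv' /=; have [hu1 hu2] := hs _ hu'; have [hv1 hv2] := hs _ hv'.
  rewrite -kl//; apply: kE.
  + by case: hV' => _; apply.
  + by case: hV => _; apply.
  + by rewrite phil// opprD addrACA -scalerBr; case: hW' => _; apply.
- move=> r; have [v hv <-] := ks r; exists (phi v); first exact: phiV.
  by apply: kE => //; [exact: phiV | rewrite subrr; case: hW'].
- move=> v' hv' /=; have [h1 h2] := hs _ hv'; rewrite kk// -phiW//; split=> h.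
    by rewrite -[v'](subrK (phi (s v'))); exact: ksubD.
  by rewrite -[phi _](subrK v') -opprB; apply: ksubD => //; exact: ksubN.
Qed.

End TwoAlgebras.
End Dim.

(** * Invariance of Tor under the choice of a resolution *)

Section FreeModules.
Variable A : comNzRingType.
Implicit Types S T U : choiceType.

Definition finite_columns S T (d : T -> S -> A^o) := forall t, finite_supp (d t).

Definition basis_vector T (t : T) : T -> A^o := fun s => (s == t)%:R.

Definition combination (E : lmodType A) S (e : S -> E) (v : S -> A^o) : E :=
  \sum_(s \in setT) v s *: e s.

Lemma free_diff_fset S T (d : T -> S -> A^o) (N : lmodType A) (v : T -> N) (F : {fset T}) :
  (forall t, t \notin F -> v t = 0) ->
  free_diff d v = fun s => \sum_(t <- F) d t s *: v t.
Proof.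
move=> vF; apply/funext => s; rewrite /free_diff; apply: fsbigTE => t tF.
by rewrite vF// scaler0.
Qed.

Lemma finite_supp_basis T (t : T) : finite_supp (basis_vector t).
Proof.
by apply/finite_suppP; exists [fset t]%fset => s; rewrite inE /basis_vector => /negPf ->.
Qed.

Lemma finite_supp_lin T (N : lmodType A) a (u v : T -> N) :
  finite_supp u -> finite_supp v -> finite_supp (fun t => a *: u t + v t).
Proof.
move=> /finite_suppP[F hF] /finite_suppP[G hG]; apply/finite_suppP.
exists (F `|` G)%fset => t; rewrite inE negb_or => /andP[tF tG].
by rewrite hF// hG// scaler0 addr0.
Qed.

Lemma finite_supp0 T (N : lmodType A) : finite_supp (0 : T -> N).
Proof. by apply/finite_suppP; exists fset0. Qed.

Lemma finite_suppD T (N : lmodType A) (u v : T -> N) :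
  finite_supp u -> finite_supp v -> finite_supp (u + v).
Proof.
move=> hu hv; have := finite_supp_lin 1 hu hv.
by congr finite_supp; apply/funext => t; rewrite scale1r.
Qed.

Lemma finite_suppB T (N : lmodType A) (u v : T -> N) :
  finite_supp u -> finite_supp v -> finite_supp (u - v).
Proof.
move=> hu hv; have := finite_supp_lin (-1) hv hu.
by congr finite_supp; apply/funext => t; rewrite scaleN1r addrC.
Qed.

Lemma finite_supp_columns S T (d : T -> S -> A^o) (F : {fset T}) : finite_columns d ->
  exists G : {fset S}, forall t, t \in F -> forall s, s \notin G -> d t s = 0.
Proof.
move=> dfin.
have /choice[g hg] : forall t, exists G : {fset S}, forall s, s \notin G -> d t s = 0.
  by move=> t; apply/finite_suppP; exact: dfin.
exists (\bigcup_(t <- F) g t)%fset => t tF s sG; apply: (hg t).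
apply: contraNN sG; apply/fsubsetP; exact: bigfcup_sup.
Qed.

Lemma free_diff_fin S T (d : T -> S -> A^o) (N : lmodType A) (v : T -> N) :
  finite_columns d -> finite_supp v -> finite_supp (free_diff d v).
Proof.
move=> dfin /finite_suppP[F hF]; have [G hG] := finite_supp_columns F dfin.
apply/finite_suppP; exists G => s sG; rewrite (free_diff_fset d hF).
by rewrite big_seq big1// => t tF; rewrite (hG t)// scale0r.
Qed.

(** Tensoring with [N] is functorial: composition of maps of free modules, given by
    matrices with finite columns, goes to composition. *)
Lemma free_diff_comp S T U (d : T -> S -> A^o) (d' : U -> T -> A^o) (N : lmodType A)
    (v : U -> N) : finite_columns d' -> finite_supp v ->
  free_diff d (free_diff d' v) = free_diff (fun u => free_diff d (d' u)) v.
Proof.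
move=> dfin /finite_suppP[F hF]; have [G hG] := finite_supp_columns F dfin.
have hG' t : t \notin G -> free_diff d' v t = 0.
  move=> tG; rewrite (free_diff_fset d' hF) big_seq big1// => u uF.
  by rewrite (hG u)// scale0r.
rewrite (free_diff_fset d hG') [RHS](free_diff_fset _ hF); apply/funext => s.
rewrite (free_diff_fset d' hF).
under eq_bigr do rewrite scaler_sumr.
rewrite exchange_big/= big_seq [RHS]big_seq; apply: eq_bigr => u uF.
rewrite (free_diff_fset d (hG u uF)) scaler_suml; apply: eq_bigr => t _.
by rewrite scalerA.
Qed.

Lemma free_diff_lin S T (d : T -> S -> A^o) (N : lmodType A) a (u v : T -> N) :
  finite_supp u -> finite_supp v ->
  free_diff d (fun t => a *: u t + v t) = fun s => a *: free_diff d u s + free_diff d v s.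
Proof.
move=> /finite_suppP[F hF] /finite_suppP[G hG].
have hu t : t \notin (F `|` G)%fset -> u t = 0.
  by rewrite inE negb_or => /andP[/hF].
have hv t : t \notin (F `|` G)%fset -> v t = 0.
  by rewrite inE negb_or => /andP[_ /hG].
have huv t : t \notin (F `|` G)%fset -> a *: u t + v t = 0.
  by move=> tF; rewrite hu// hv// scaler0 addr0.
rewrite (free_diff_fset d hu) (free_diff_fset d hv) (free_diff_fset d huv).
apply/funext => s; rewrite scaler_sumr -big_split/=; apply: eq_bigr => t _.
by rewrite scalerDr !scalerA mulrC.
Qed.

Lemma free_diff0 S T (d : T -> S -> A^o) (N : lmodType A) : free_diff d (0 : T -> N) = 0.
Proof.
by rewrite (@free_diff_fset _ _ d _ _ fset0)//; apply/funext => s; rewrite big_seq_fset0.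
Qed.

Lemma free_diff0l S T (N : lmodType A) (v : T -> N) :
  free_diff ((fun=> 0) : T -> S -> A^o) v = 0.
Proof.
apply/funext => s; rewrite /free_diff (@fsbig1 _ _ _ _ _ _)// => t _.
by rewrite -[(0 : S -> A^o) s]/(0 : A) scale0r.
Qed.

Lemma free_diffD S T (d : T -> S -> A^o) (N : lmodType A) (u v : T -> N) :
  finite_supp u -> finite_supp v -> free_diff d (u + v) = free_diff d u + free_diff d v.
Proof.
move=> hu hv; rewrite -[free_diff d u]scale1r -[LHS]/(free_diff d (fun t => u t + v t)).
by rewrite -[RHS](free_diff_lin d 1 hu hv); congr free_diff; apply/funext => t; rewrite scale1r.
Qed.

Lemma free_diffB S T (d : T -> S -> A^o) (N : lmodType A) (u v : T -> N) :
  finite_supp u -> finite_supp v -> free_diff d (u - v) = free_diff d u - free_diff d v.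
Proof.
move=> hu hv.
have -> : u - v = fun t => -1 *: v t + u t by apply/funext => t; rewrite scaleN1r addrC.
by rewrite (free_diff_lin d (-1) hv hu); apply/funext => s; rewrite scaleN1r addrC.
Qed.

Lemma free_diff_addl S T (d d' : T -> S -> A^o) (N : lmodType A) (v : T -> N) :
  finite_supp v -> free_diff (d + d') v = free_diff d v + free_diff d' v.
Proof.
move=> /finite_suppP[F hF]; rewrite !(free_diff_fset _ hF); apply/funext => s.
by rewrite -[RHS]big_split/=; apply: eq_bigr => t _; rewrite -scalerDl.
Qed.

Lemma free_diff_subl S T (d d' : T -> S -> A^o) (N : lmodType A) (v : T -> N) :
  finite_supp v -> free_diff (d - d') v = free_diff d v - free_diff d' v.
Proof.
move=> /finite_suppP[F hF]; rewrite !(free_diff_fset _ hF); apply/funext => s.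
by rewrite -[RHS]sumrB/=; apply: eq_bigr => t _; rewrite -scalerBl.
Qed.

Lemma free_diff_basis S T (d : T -> S -> A^o) (t : T) : free_diff d (basis_vector t) = d t.
Proof.
rewrite (@free_diff_fset _ _ d _ _ [fset t]%fset); last first.
  by move=> s; rewrite inE /basis_vector => /negPf ->.
by apply/funext => s; rewrite big_seq_fset1 /basis_vector eqxx [LHS]mulr1.
Qed.

Lemma finite_supp_delta T (N : lmodType A) (t : T) (x : N) :
  finite_supp (fun s => if s == t then x else 0).
Proof. by apply/finite_suppP; exists [fset t]%fset => s; rewrite inE => /negPf ->. Qed.

Lemma free_diff_delta S T (d : T -> S -> A^o) (N : lmodType A) (t : T) (x : N) :
  free_diff d (fun s => if s == t then x else 0) = fun s => d t s *: x.
Proof.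
rewrite (@free_diff_fset _ _ d _ _ [fset t]%fset); last first.
  by move=> s; rewrite inE => /negPf ->.
by apply/funext => s; rewrite big_seq_fset1 eqxx.
Qed.

Lemma free_diff_map S T (d : T -> S -> A^o) (N : lmodType A) (h : N -> N) (v : T -> N) :
  (forall a x y, h (a *: x + y) = a *: h x + h y) -> finite_supp v ->
  finite_supp (fun t => h (v t)) /\
  free_diff d (fun t => h (v t)) = fun s => h (free_diff d v s).
Proof.
move=> hl.
have h0 : h 0 = 0 by have := hl (-1) 0 0; rewrite scaler0 addr0 scaleN1r addNr.
move=> /finite_suppP[F hF].
have hF' t : t \notin F -> h (v t) = 0 by move=> /hF ->.
split; first by apply/finite_suppP; exists F.
rewrite (free_diff_fset d hF) (free_diff_fset d hF'); apply/funext => s.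
elim/big_rec2: _ => [|t x y _ ->]; first by rewrite h0.
by rewrite hl.
Qed.

Lemma free_diff_id T (N : lmodType A) (v : T -> N) : finite_supp v ->
  free_diff (@basis_vector T) v = v.
Proof.
move=> /finite_suppP[F hF]; rewrite (free_diff_fset _ hF); apply/funext => s.
have [sF|sF] := boolP (s \in F).
  rewrite (big_fsetD1 s)//= /basis_vector eqxx scale1r big_seq big1 ?addr0// => t.
  by rewrite !inE eq_sym => /andP[/negPf -> _]; rewrite scale0r.
rewrite hF// big_seq big1// => t tF; rewrite /basis_vector.
by rewrite (_ : (s == t) = false) ?scale0r//; apply: contraNF sF => /eqP ->.
Qed.

Lemma combination_fset (E : lmodType A) S (e : S -> E) (v : S -> A^o) (F : {fset S}) :
  (forall s, s \notin F -> v s = 0) -> combination e v = \sum_(s <- F) v s *: e s.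
Proof. exact: free_sum_supp. Qed.

Lemma combination_basis (E : lmodType A) S (e : S -> E) (s : S) :
  combination e (basis_vector s) = e s.
Proof.
rewrite (@combination_fset _ _ _ _ [fset s]%fset).
  by rewrite big_seq_fset1 /basis_vector eqxx scale1r.
by move=> t; rewrite inE /basis_vector => /negPf ->.
Qed.

Lemma combinationB (E : lmodType A) S (e : S -> E) (u v : S -> A^o) :
  finite_supp u -> finite_supp v ->
  combination e (u - v) = combination e u - combination e v.
Proof.
move=> /finite_suppP[F hF] /finite_suppP[G hG].
have hu t : t \notin (F `|` G)%fset -> u t = 0.
  by rewrite inE negb_or => /andP[/hF].
have hv t : t \notin (F `|` G)%fset -> v t = 0.
  by rewrite inE negb_or => /andP[_ /hG].
have huv t : t \notin (F `|` G)%fset -> (u - v) t = 0.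
  by move=> tF; rewrite -[LHS]/(u t - v t) hu// hv// subr0.
rewrite (combination_fset e hu) (combination_fset e hv) (combination_fset e huv).
by rewrite -sumrB; apply: eq_bigr => t _; rewrite -scalerBl.
Qed.

Lemma combination_comp (E : lmodType A) S T (e : S -> E) (d : T -> S -> A^o) (v : T -> A^o) :
  finite_columns d -> finite_supp v ->
  combination e (free_diff d v) = combination (fun t => combination e (d t)) v.
Proof.
move=> dfin /finite_suppP[F hF]; have [G hG] := finite_supp_columns F dfin.
have hG' t : t \notin G -> free_diff d v t = 0.
  move=> tG; rewrite (free_diff_fset d hF) big_seq big1// => u uF.
  by rewrite (hG u)// scale0r.
rewrite (combination_fset e hG') (combination_fset _ hF).
rewrite (free_diff_fset d hF).
under eq_bigr do rewrite scaler_suml.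
rewrite exchange_big/= big_seq [RHS]big_seq; apply: eq_bigr => u uF.
rewrite (combination_fset e (hG u uF)) scaler_sumr; apply: eq_bigr => t _.
by rewrite scalerA; congr (_ *: _); exact: mulrC.
Qed.

Lemma submoduleB (E : lmodType A) (W : set E) u v : submodule W -> W u -> W v -> W (u - v).
Proof. by move=> [_ WD] hu hv; rewrite addrC -scaleN1r; exact: WD. Qed.

Lemma submoduleD (E : lmodType A) (W : set E) u v : submodule W -> W u -> W v -> W (u + v).
Proof. by move=> [_ WD] hu hv; rewrite -[u]scale1r; exact: WD. Qed.

Lemma submoduleZ (E : lmodType A) (W : set E) a u : submodule W -> W u -> W (a *: u).
Proof. by move=> [W0 WD] hu; rewrite -[_ *: _]addr0; exact: WD. Qed.

Lemma submodule_sum (E : lmodType A) (W : set E) (I : Type) (r : seq I) (P : pred I) (u : I -> E) :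
  submodule W -> (forall i, P i -> W (u i)) -> W (\sum_(i <- r | P i) u i).
Proof.
move=> hW hu; elim/big_ind: _ => //; first by case: hW.
by move=> x y; exact: submoduleD.
Qed.

Lemma combination_submodule (E : lmodType A) (W : set E) S (e : S -> E) v :
  submodule W -> finite_supp v -> (forall s, W (e s)) -> W (combination e v).
Proof.
move=> hW /finite_suppP[F hF] he; rewrite (combination_fset e hF).
by apply: submodule_sum => // s _; exact: submoduleZ.
Qed.

(** The part of a free resolution that determines Tor_0 and Tor_1. An explicit
    presentation can thus be compared with the beginning of any resolution. *)
Record presentation (E : lmodType A) (W : set E) := Presentation {
  basis0 : choiceType; basis1 : choiceType; basis2 : choiceType;
  paug : basis0 -> E;
  pd0 : basis1 -> basis0 -> A^o;
  pd1 : basis2 -> basis1 -> A^o;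
  pfin0 : finite_columns pd0;
  pfin1 : finite_columns pd1;
  psurj : forall x : E, exists2 v : basis0 -> A^o,
    finite_supp v & W (x - combination paug v);
  pexact0 : forall v : basis0 -> A^o, finite_supp v ->
    W (combination paug v) <->
    exists2 w : basis1 -> A^o, finite_supp w & v = free_diff pd0 w;
  pexact1 : forall v : basis1 -> A^o, finite_supp v ->
    free_diff pd0 v = 0 <->
    exists2 w : basis2 -> A^o, finite_supp w & v = free_diff pd1 w }.

Section Compare.
Variables (E : lmodType A) (W : set E).
Hypothesis Wsub : submodule W.

Lemma pd0_aug (P : presentation W) (t : basis1 P) : W (combination (@paug _ _ P) (pd0 t)).
Proof.
apply/(pexact0 (pfin0 t)); exists (basis_vector t); first exact: finite_supp_basis.
by rewrite free_diff_basis.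
Qed.

Lemma pd0_pd1 (P : presentation W) (t : basis2 P) : free_diff (@pd0 _ _ P) (pd1 t) = 0.
Proof.
apply/(pexact1 (pfin1 t)); exists (basis_vector t); first exact: finite_supp_basis.
by rewrite free_diff_basis.
Qed.

Lemma chain_map (P Q : presentation W) :
  exists (f0 : basis0 P -> basis0 Q -> A^o) (f1 : basis1 P -> basis1 Q -> A^o) (f2 : basis2 P -> basis2 Q -> A^o),
  [/\ [/\ finite_columns f0, finite_columns f1 & finite_columns f2],
      forall t, W (paug t - combination (@paug _ _ Q) (f0 t)),
      forall t, free_diff (@pd0 _ _ Q) (f1 t) = free_diff f0 (pd0 t) &
      forall t, free_diff (@pd1 _ _ Q) (f2 t) = free_diff f1 (pd1 t)].
Proof.
have /choice[f0 hf0] (t : basis0 P) : exists v : basis0 Q -> A^o,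
    finite_supp v /\ W (paug t - combination (@paug _ _ Q) v).
  by have [v] := psurj Q (paug t); exists v.
have fin0 : finite_columns f0 by move=> t; case: (hf0 t).
have /choice[f1 hf1] (t : basis1 P) : exists v : basis1 Q -> A^o,
    finite_supp v /\ free_diff (@pd0 _ _ Q) v = free_diff f0 (pd0 t).
  have ffin := free_diff_fin fin0 (pfin0 t).
  have [|v] := (pexact0 ffin).1; last by exists v.
  rewrite combination_comp//; last exact: pfin0.
  have := combination_submodule Wsub (pfin0 t) (fun s => (hf0 s).2).
  move=> /(submoduleB Wsub (pd0_aug t)); congr W.
  have /finite_suppP[F hF] := pfin0 t.
  rewrite !(combination_fset _ hF) -sumrB; apply: eq_bigr => s _.
  by rewrite -scalerBr opprB addrC subrK.
have fin1 : finite_columns f1 by move=> t; case: (hf1 t).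
have /choice[f2 hf2] (t : basis2 P) : exists v : basis2 Q -> A^o,
    finite_supp v /\ free_diff (@pd1 _ _ Q) v = free_diff f1 (pd1 t).
  have ffin := free_diff_fin fin1 (pfin1 t).
  have [|v] := (pexact1 ffin).1; last by exists v.
  rewrite free_diff_comp//; last exact: pfin1.
  rewrite (_ : (fun u => _) = fun s => free_diff f0 (pd0 s)); last first.
    by apply/funext => s; case: (hf1 s).
  rewrite -free_diff_comp; [|exact: pfin0|exact: pfin1].
  by rewrite pd0_pd1 free_diff0.
exists f0, f1, f2; split.
- by split=> // t; case: (hf2 t).
- by move=> t; case: (hf0 t).
- by move=> t; case: (hf1 t).
- by move=> t; case: (hf2 t).
Qed.

Lemma homotopy (P : presentation W) (a0 : basis0 P -> basis0 P -> A^o) (a1 : basis1 P -> basis1 P -> A^o) :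
  finite_columns a0 -> finite_columns a1 ->
  (forall t, W (paug t - combination (@paug _ _ P) (a0 t))) ->
  (forall t, free_diff (@pd0 _ _ P) (a1 t) = free_diff a0 (pd0 t)) ->
  exists (s0 : basis0 P -> basis1 P -> A^o) (s1 : basis1 P -> basis2 P -> A^o),
  [/\ finite_columns s0, finite_columns s1,
      forall t, basis_vector t - a0 t = free_diff (@pd0 _ _ P) (s0 t) &
      forall t, basis_vector t - a1 t = free_diff (@pd1 _ _ P) (s1 t) + free_diff s0 (pd0 t)].
Proof.
move=> fin0 fin1 ha0 ha1.
have /choice[s0 hs0] (t : basis0 P) : exists v : basis1 P -> A^o,
    finite_supp v /\ basis_vector t - a0 t = free_diff (@pd0 _ _ P) v.
  have hf := finite_suppB (finite_supp_basis t) (fin0 t).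
  have [|v] := (pexact0 hf).1; last by exists v.
  rewrite combinationB//; last exact: finite_supp_basis.
  by rewrite combination_basis.
have fins0 : finite_columns s0 by move=> t; case: (hs0 t).
have /choice[s1 hs1] (t : basis1 P) : exists v : basis2 P -> A^o,
    finite_supp v /\
    basis_vector t - a1 t - free_diff s0 (pd0 t) = free_diff (@pd1 _ _ P) v.
  have h1 := finite_suppB (finite_supp_basis t) (fin1 t).
  have h2 := free_diff_fin fins0 (pfin0 t).
  have [|v] := (pexact1 (finite_suppB h1 h2)).1; last by exists v.
  rewrite free_diffB// free_diffB//; last exact: finite_supp_basis.
  rewrite free_diff_basis ha1 free_diff_comp//; last exact: pfin0.
  rewrite (_ : (fun u => _) = (@basis_vector _) - a0); last first.
    by apply/funext => s; case: (hs0 s).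
  have h := pfin0 t.
  by rewrite free_diff_subl// free_diff_id// subrr.
exists s0, s1; split=> //.
- by move=> t; case: (hs1 t).
- by move=> t; case: (hs0 t).
- by move=> t; case: (hs1 t) => _ <-; rewrite subrK.
Qed.

Section Homology.
Variable N : lmodType A.

Definition cycles1 (P : presentation W) : set (basis1 P -> N) :=
  [set v | finite_supp v /\ free_diff (@pd0 _ _ P) v = 0].
Definition boundaries1 (P : presentation W) : set (basis1 P -> N) :=
  [set free_diff (@pd1 _ _ P) w | w in [set w | finite_supp w]].
Definition cycles0 (P : presentation W) : set (basis0 P -> N) := [set v | finite_supp v].
Definition boundaries0 (P : presentation W) : set (basis0 P -> N) :=
  [set free_diff (@pd0 _ _ P) w | w in [set w | finite_supp w]].

Definition homology_iso (X Y : choiceType) (V W : set (X -> N)) (V' W' : set (Y -> N))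
    (f : X -> Y -> A^o) :=
  [/\ finite_columns f,
      forall v, V v -> V' (free_diff f v),
      forall v, V v -> (W' (free_diff f v) <-> W v) &
      forall v', V' v' -> exists2 v, V v & W' (v' - free_diff f v)].

(** A self-map of the presentation that lifts the identity acts as the identity on
    homology after tensoring, because the homotopy is tensored along. *)
Lemma homotopy_cycles (P : presentation W) (a0 : basis0 P -> basis0 P -> A^o) (a1 : basis1 P -> basis1 P -> A^o) :
  finite_columns a0 -> finite_columns a1 ->
  (forall t, W (paug t - combination (@paug _ _ P) (a0 t))) ->
  (forall t, free_diff (@pd0 _ _ P) (a1 t) = free_diff a0 (pd0 t)) ->
  (forall v, cycles0 v -> boundaries0 (v - free_diff a0 v)) /\
  (forall v, cycles1 v -> boundaries1 (v - free_diff a1 v)).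
Proof.
move=> fin0 fin1 ha0 ha1; have [s0 [s1 [fs0 fs1 h0 h1]]] := homotopy fin0 fin1 ha0 ha1.
split=> [v fv|v [fv dv]].
  exists (free_diff s0 v); first exact: free_diff_fin.
  rewrite free_diff_comp// -[X in X - _](free_diff_id fv) -free_diff_subl//.
  by congr (free_diff _ v); apply/funext => t; rewrite -h0.
exists (free_diff s1 v); first exact: free_diff_fin.
rewrite free_diff_comp// -[X in X - _](free_diff_id fv) -free_diff_subl//.
rewrite (_ : basis_vector (T:=_) - a1 = (fun u => free_diff (@pd1 _ _ P) (s1 u)) +
   (fun u => free_diff s0 (pd0 u))); last by apply/funext => t; exact: h1.
rewrite [RHS]free_diff_addl// -[X in _ = _ + X]free_diff_comp//; last exact: pfin0.
by rewrite dv free_diff0 addr0.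
Qed.

Lemma free_diff_square S T U (V : choiceType) (d : T -> S -> A^o) (f : U -> T -> A^o)
    (f' : V -> S -> A^o) (d' : U -> V -> A^o) (v : U -> N) :
  finite_columns f -> finite_columns d' ->
  (forall t, free_diff d (f t) = free_diff f' (d' t)) -> finite_supp v ->
  free_diff d (free_diff f v) = free_diff f' (free_diff d' v).
Proof.
by move=> ff fd h fv; rewrite (free_diff_comp d ff fv) (free_diff_comp f' fd fv) (funext h).
Qed.

(** Comparison maps exist in both directions, and their composites lift the
    identity. *)
Lemma homology_iso_exists (P Q : presentation W) :
  (exists f : basis0 P -> basis0 Q -> A^o,
    homology_iso (@cycles0 P) (@boundaries0 P) (@cycles0 Q) (@boundaries0 Q) f) /\
  (exists f : basis1 P -> basis1 Q -> A^o,
    homology_iso (@cycles1 P) (@boundaries1 P) (@cycles1 Q) (@boundaries1 Q) f).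
Proof.
have [f0 [f1 [f2 [[ff0 ff1 ff2] fa f01 f12]]]] := chain_map P Q.
have [g0 [g1 [g2 [[fg0 fg1 fg2] ga g01 g12]]]] := chain_map Q P.
have augc (P1 Q1 : presentation W) (f : basis0 P1 -> basis0 Q1 -> A^o) (g : basis0 Q1 -> basis0 P1 -> A^o) :
  finite_columns f -> finite_columns g ->
  (forall t, W (paug t - combination (@paug _ _ Q1) (f t))) ->
  (forall t, W (paug t - combination (@paug _ _ P1) (g t))) ->
  forall t, W (paug t - combination (@paug _ _ P1) (free_diff g (f t))).
  move=> ff fg hf hg t; rewrite combination_comp//.
  rewrite -[X in W X](subrKA (combination (@paug _ _ Q1) (f t))).
  apply: submoduleD => //.
  have := combination_submodule Wsub (ff t) hg; congr W.
  have /finite_suppP[F hF] := ff t.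
  rewrite !(combination_fset _ hF) -sumrB; apply: eq_bigr => s _.
  by rewrite -scalerBr.
have compc (P1 Q1 : presentation W) (f : basis0 P1 -> basis0 Q1 -> A^o) (g : basis0 Q1 -> basis0 P1 -> A^o)
   (f' : basis1 P1 -> basis1 Q1 -> A^o) (g' : basis1 Q1 -> basis1 P1 -> A^o) :
  finite_columns f -> finite_columns g -> finite_columns f' -> finite_columns g' ->
  (forall t, free_diff (@pd0 _ _ Q1) (f' t) = free_diff f (pd0 t)) ->
  (forall t, free_diff (@pd0 _ _ P1) (g' t) = free_diff g (pd0 t)) ->
  forall t, free_diff (@pd0 _ _ P1) (free_diff g' (f' t)) =
    free_diff (fun s => free_diff g (f s)) (pd0 t).
  move=> cf cg cf' cg' hf hg t; rewrite free_diff_comp//.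
  rewrite (_ : (fun u => _) = fun s => free_diff g (pd0 s)); last exact/funext.
  rewrite -free_diff_comp//; last exact: pfin0.
  by rewrite hf free_diff_comp//; exact: pfin0.
have fin_comp S T U (f : T -> S -> A^o) (g : U -> T -> A^o) :
    finite_columns f -> finite_columns g -> finite_columns (fun u => free_diff f (g u)).
  by move=> hf hg u; exact: free_diff_fin.
have [hP0 hP1] := homotopy_cycles (fin_comp _ _ _ _ _ fg0 ff0) (fin_comp _ _ _ _ _ fg1 ff1)
  (augc _ _ _ _ ff0 fg0 fa ga) (compc _ _ _ _ _ _ ff0 fg0 ff1 fg1 f01 g01).
have [hQ0 hQ1] := homotopy_cycles (fin_comp _ _ _ _ _ ff0 fg0) (fin_comp _ _ _ _ _ ff1 fg1)
  (augc _ _ _ _ fg0 ff0 ga fa) (compc _ _ _ _ _ _ fg0 ff0 fg1 ff1 g01 f01).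
have bsub S T (d : T -> S -> A^o) (u v : S -> N) :
  [set free_diff d w | w in [set w | finite_supp w]] u ->
  [set free_diff d w | w in [set w | finite_supp w]] (v - u) ->
  [set free_diff d w | w in [set w | finite_supp w]] v.
  move=> [w1 fw1 <-] [w2 fw2 h]; exists (w2 + w1); first exact: finite_suppD.
  by rewrite free_diffD// h subrK.
have fd0 X : finite_columns (@pd0 _ _ X) by exact: pfin0.
have fd1 X : finite_columns (@pd1 _ _ X) by exact: pfin1.
split.
  exists f0; split=> //.
  - by move=> v fv; exact: free_diff_fin.
  - move=> v fv; split=> [[w fw hw]|[w fw <-]]; last first.
      exists (free_diff f1 w); first exact: free_diff_fin.
      exact: free_diff_square.
    apply: bsub (hP0 v fv); rewrite -free_diff_comp//.
    exists (free_diff g1 w); first exact: free_diff_fin.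
    by rewrite -hw; exact: free_diff_square.
  - move=> v fv; exists (free_diff g0 v); first exact: free_diff_fin.
    by rewrite free_diff_comp//; exact: hQ0.
have cyc P1 Q1 (f : basis0 P1 -> basis0 Q1 -> A^o) (f' : basis1 P1 -> basis1 Q1 -> A^o) : finite_columns f' ->
   (forall t, free_diff (@pd0 _ _ Q1) (f' t) = free_diff f (pd0 t)) ->
   forall v, cycles1 v -> cycles1 (free_diff f' v).
  move=> cf' h v [fv dv]; split; first exact: free_diff_fin.
  by rewrite (free_diff_square cf' _ h)// dv free_diff0.
exists f1; split=> //.
- exact: cyc f01.
- move=> v cv; have [fv dv] := cv; split=> [[w fw hw]|[w fw <-]]; last first.
    exists (free_diff f2 w); first exact: free_diff_fin.
    exact: free_diff_square.
  apply: bsub (hP1 v cv); rewrite -free_diff_comp//.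
  exists (free_diff g2 w); first exact: free_diff_fin.
  by rewrite -hw; exact: free_diff_square.
- move=> v cv; have [fv dv] := cv; exists (free_diff g1 v); first exact: (cyc _ _ _ _ fg1 g01).
  by rewrite free_diff_comp//; exact: hQ1.
Qed.

Lemma finite_supp_submodule (S : choiceType) : submodule [set v : S -> N | finite_supp v].
Proof.
split; first exact: finite_supp0.
by move=> a u v; exact: finite_supp_lin.
Qed.

Lemma boundaries_submodule (S T : choiceType) (d : T -> S -> A^o) :
  submodule [set free_diff d w | w in [set w : T -> N | finite_supp w]].
Proof.
split; first by exists 0; [exact: finite_supp0 | exact: free_diff0].
move=> a _ _ [u fu <-] [v fv <-]; exists (fun t => a *: u t + v t).
  exact: finite_supp_lin.
exact: free_diff_lin.
Qed.

Lemma cycles1_submodule (P : presentation W) : submodule (@cycles1 P).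
Proof.
split; first by split; [exact: finite_supp0 | exact: free_diff0].
move=> a u v [fu du] [fv dv]; split; first exact: finite_supp_lin.
rewrite (free_diff_lin _ a fu fv) du dv.
by apply/funext => s; rewrite scaler0 addr0.
Qed.

Lemma boundaries1_cycles1 (P : presentation W) : @boundaries1 P `<=` @cycles1 P.
Proof.
move=> _ [w fw <-]; have fin1 := @pfin1 _ _ P.
split; first exact: free_diff_fin.
rewrite (free_diff_comp _ fin1 fw) (funext (@pd0_pd1 P)).
exact: free_diff0l.
Qed.

Lemma boundaries0_cycles0 (P : presentation W) : @boundaries0 P `<=` @cycles0 P.
Proof. by move=> _ [w fw <-]; apply: free_diff_fin => //; exact: pfin0. Qed.

End Homology.
End Compare.
End FreeModules.

(** * The chain rule for sums of power series *)

Section Analysis.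
Variable R : realType.
Local Notation C := (Cplx R).

(** A quadratic error bound instead of a limit: such bounds compose, which gives the
    chain rule, and they imply the value of the directional derivative. *)
Definition has_deriv k (f : 'rV[C]_k -> C) (i : 'I_k) (x : 'rV[C]_k) (c : C) :=
  exists r K : R, 0 < r /\ forall h, nm h <= r ->
    nm (f (h *: delta_mx ord0 i + x) - f x - h * c) <= K * nm h ^+ 2.

Lemma has_deriv_derive k (f : 'rV[C]_k -> C) i x c :
  has_deriv f i x c -> 'D_(delta_mx ord0 i) f x = c.
Proof.
move=> [r [K0 [r0 hK0]]].
pose K := Num.max K0 0.
have K_ge0 : 0 <= K by rewrite le_max lexx orbT.
have hK h : nm h <= r -> nm (f (h *: delta_mx ord0 i + x) - f x - h * c) <= K * nm h ^+ 2.
  move=> /hK0 /le_trans; apply; rewrite ler_wpM2r ?exprn_ge0 ?nm_ge0//.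
  by rewrite le_max lexx.
rewrite /derive; apply: cvg_lim => //; apply/cvgrPdist_lt => eps eps0.
have eE : eps = ((complex.Re eps)%:C)%C.
  by case: eps eps0 => a b; rewrite ltcE /= => /andP[/eqP -> _].
set e := complex.Re eps in eE.
have e0 : 0 < e by rewrite -ltcR -eE.
pose del := Num.min r (e / (K + 1)).
have del0 : 0 < del by rewrite lt_min r0 divr_gt0// ltr_wpDl.
near=> h.
have h0 : h != 0 by near: h; exact: nbhs_dnbhs_neq.
have hdel : nm h < del.
  by rewrite -nm_ltc; near: h; apply: dnbhs0_lt; rewrite ltcR.
have nh0 : 0 < nm h by rewrite -ltcR -nmE normr_gt0.
have hr : nm h <= r by rewrite (le_trans (ltW hdel))// ge_min lexx.
have he : nm h * (K + 1) < e.
  by rewrite -ltr_pdivlMr ?ltr_wpDl// (lt_le_trans hdel)// ge_min lexx orbT.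
have := hK h hr; rewrite eE nm_ltc /= /shift/=.
set q := f _ - f x - _ => hq.
rewrite (_ : _ - _ = - (h^-1 * q)); last first.
  by rewrite /q mulrBr mulrA mulVf// mul1r opprB.
rewrite nmN nmM -(ltr_pM2l nh0) mulrA -nmM divff// nm1 mul1r.
apply: le_lt_trans hq _.
rewrite [nm h ^+ 2]expr2 mulrCA ltr_pM2l//; apply: le_lt_trans he.
by rewrite mulrC ler_wpM2l// ?lerDl// ltW.
Unshelve. all: by end_near. Qed.

Lemma Rep_deriv_has_deriv k (f g : 'rV[C]_k -> C) (s M : R) (i : 'I_k) (x : 'rV[C]_k) :
  0 < s -> (forall h, nm h <= s / 8 ->
    (s / 4) ^+ 2 * nm (f (h *: delta_mx ord0 i + x) - f x - h * g x) <= nm h ^+ 2 * M) ->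
  has_deriv f i x (g x).
Proof.
move=> s0 hf; exists (s / 8), (M / (s / 4) ^+ 2); split; first lra.
move=> h /hf; rewrite mulrC -ler_pdivlMr ?exprn_gt0//; last lra.
by rewrite [nm h ^+ 2 * _]mulrC mulrAC.
Qed.

Lemma nm_sum_le n (u : 'I_n -> C) (b : R) : (forall i, nm (u i) <= b) ->
  nm (\sum_i u i) <= n%:R * b.
Proof.
move=> ub; apply: le_trans (nm_sum _ _) _.
apply: le_trans (ler_sum _ (fun i _ => ub i)) _.
by rewrite sumr_const card_ord mulr_natl.
Qed.

(** The points of a path from [x] to [y] that moves one coordinate at a time, so
    that estimates on partial derivatives add up to an estimate on [f y - f x]. *)
Definition staircase k (x y : 'rV[C]_k) (i : nat) : 'rV[C]_k :=
  \row_l (if (l < i)%N then y ord0 l else x ord0 l).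

Lemma staircaseS k (x y : 'rV[C]_k) (i : 'I_k) :
  staircase x y i.+1 = (y ord0 i - x ord0 i) *: delta_mx ord0 i + staircase x y i.
Proof.
apply/rowP => l; rewrite !mxE eqxx/= ltnS leq_eqVlt.
case: (eqVneq l i) => [->|li]; first by rewrite eqxx ltnn /= mulr1 subrK.
rewrite (_ : (nat_of_ord l == nat_of_ord i) = false); last exact/negbTE.
by rewrite mulr0 add0r.
Qed.

Lemma staircase_sum k (f : 'rV[C]_k -> C) (x y : 'rV[C]_k) :
  f y - f x = \sum_(i < k) (f (staircase x y i.+1) - f (staircase x y i)).
Proof.
rewrite -(big_mkord predT (fun i => f (staircase x y i.+1) - f (staircase x y i))).
rewrite telescope_sumr//; congr (f _ - f _); apply/rowP => l; rewrite mxE//.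
by rewrite ltn_ord.
Qed.

Lemma staircase_bound k (x y : 'rV[C]_k) i (r : R) :
  (forall l, nm (x ord0 l) <= r) -> (forall l, nm (y ord0 l) <= r) ->
  forall l, nm (staircase x y i ord0 l) <= r.
Proof. by move=> hx hy l; rewrite mxE; case: ifP. Qed.

Lemma Rep_lipschitz k (f : 'rV[C]_k -> C) (s M : R) : 0 < s -> Rep s M f ->
  exists K, forall (x y : 'rV[C]_k) (d : R),
    (forall l, nm (x ord0 l) <= s / 16) -> (forall l, nm (y ord0 l) <= s / 16) ->
    (forall l, nm (y ord0 l - x ord0 l) <= d) -> nm (f y - f x) <= K * d.
Proof.
move=> s0 fM; have M0 := Rep_ge0 fM.
exists (k%:R * (3 * M / s)) => x y d hx hy hd.
rewrite staircase_sum -mulrA; apply: nm_sum_le => i.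
have [g gM hg] := Rep_deriv i s0 fM.
have hz j l : nm (staircase x y j ord0 l) <= s / 8.
  have : nm (staircase x y j ord0 l) <= s / 16 by exact: staircase_bound.
  lra.
have d0 : 0 <= d := le_trans (nm_ge0 _) (hd i).
have hxy : nm (y ord0 i - x ord0 i) <= s / 8.
  by rewrite (le_trans (nmD _ _))// nmN; have := hx i; have := hy i; lra.
rewrite staircaseS; set h := _ - x ord0 i in hxy *; set z := staircase x y i.
have s20 : 0 < s / 2 by lra.
have gz : nm (g z) <= M / s.
  by apply: (Rep_bound s20 gM) => l; have := hz i l; rewrite -/z; lra.
have hh := hg z h (hz i) hxy.
have hdi : nm h <= d := hd i.
have nh := nm_ge0 h.
rewrite -[f _ - f z](subrK (h * g z)) (le_trans (nmD _ _))// nmM.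
have e1 : nm h * nm (g z) <= d * (M / s) by apply: ler_pM => //; exact: nm_ge0.
have e2 : nm (f (h *: delta_mx ord0 i + z) - f z - h * g z) <= d * (2 * M / s).
  have s2 : 0 < (s / 4) ^+ 2 by rewrite exprn_gt0//; lra.
  rewrite -(ler_pM2l s2); apply: le_trans hh _.
  rewrite (_ : _ * (d * _) = (d * (s / 8)) * M); last by field; lra.
  by rewrite ler_wpM2r// expr2 ler_pM.
by rewrite (_ : 3 * M / s * d = d * (2 * M / s) + d * (M / s)) ?lerD//; ring.
Qed.

(** Along the staircase the partial derivatives are taken at intermediate points;
    replacing them by their values at [x] costs a second-order term because they
    are Lipschitz. *)
Lemma Rep_taylor k (f : 'rV[C]_k -> C) (s M : R) : 0 < s -> Rep s M f ->
  exists (g : 'I_k -> 'rV[C]_k -> C) (K : R),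
  (forall i (x : 'rV[C]_k), (forall l, nm (x ord0 l) <= s / 8) -> has_deriv f i x (g i x)) /\
  forall (x y : 'rV[C]_k) (d : R),
    (forall l, nm (x ord0 l) <= s / 32) -> (forall l, nm (y ord0 l) <= s / 32) ->
    (forall l, nm (y ord0 l - x ord0 l) <= d) ->
    nm (f y - f x - \sum_i (y ord0 i - x ord0 i) * g i x) <= K * d ^+ 2.
Proof.
move=> s0 fM; have M0 := Rep_ge0 fM.
have s20 : 0 < s / 2 by lra.
have /choice[g hg] i : exists g, Rep (s / 2) (M / s) g /\
    forall (x : 'rV[C]_k) h, (forall j, nm (x ord0 j) <= s / 8) -> nm h <= s / 8 ->
      (s / 4) ^+ 2 * nm (f (h *: delta_mx ord0 i + x) - f x - h * g x) <= nm h ^+ 2 * M.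
  by have [g] := Rep_deriv i s0 fM; exists g.
have /choice[L0 hL0] i := Rep_lipschitz s20 (hg i).1.
pose L := \sum_i Num.max (L0 i) 0.
have hL i : L0 i <= L.
  rewrite /L (bigD1 i)//= ler_wpDr ?le_max ?lexx// sumr_ge0// => j _.
  by rewrite le_max lexx orbT.
exists g, (k%:R * (16 * M / s ^+ 2 + L)); split.
  by move=> i x hx; apply: (Rep_deriv_has_deriv s0) => h hh; apply: (hg i).2.
move=> x y d hx hy hd.
rewrite staircase_sum -sumrB -mulrA; apply: nm_sum_le => i.
have hz j l : nm (staircase x y j ord0 l) <= s / 32 by exact: staircase_bound.
have d0 : 0 <= d := le_trans (nm_ge0 _) (hd i).
have hxy : nm (y ord0 i - x ord0 i) <= s / 8.
  by rewrite (le_trans (nmD _ _))// nmN; have := hx i; have := hy i; lra.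
rewrite staircaseS; set h := _ - x ord0 i in hxy *; set z := staircase x y i.
have hz8 l : nm (z ord0 l) <= s / 8 by have := hz i l; rewrite -/z; lra.
have hh := (hg i).2 z h hz8 hxy.
have hdi : nm h <= d := hd i.
have nh := nm_ge0 h.
have gz : nm (g i z - g i x) <= L * d.
  apply: le_trans (hL0 i x z d _ _ _) _.
  - by move=> l; have := hx l; lra.
  - by move=> l; have := hz i l; rewrite -/z; lra.
  - by move=> l; rewrite /z mxE; case: ifP => // _; rewrite subrr nm0.
  - by rewrite ler_wpM2r.
rewrite (_ : _ - h * _ = (f (h *: delta_mx ord0 i + z) - f z - h * g i z)
   + h * (g i z - g i x)); last by ring.
rewrite (le_trans (nmD _ _))// [leRHS]mulrDl nmM lerD//.
  have s2 : 0 < (s / 4) ^+ 2 by rewrite exprn_gt0//; lra.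
  rewrite -(ler_pM2l s2); apply: le_trans hh _.
  rewrite (_ : _ * (16 * _ / _ * _) = d ^+ 2 * M); last by field; lra.
  by rewrite ler_wpM2r// !expr2 ler_pM.
apply: (@le_trans _ _ (d * (L * d))); last by rewrite mulrCA expr2.
by apply: ler_pM => //; exact: nm_ge0.
Qed.

Lemma has_deriv_comp m n (f : 'rV[C]_n -> C) (F : 'rV[C]_m -> 'rV[C]_n) j x
    (c : 'I_n -> C) (G : 'I_n -> C) (r K : R) : 0 < r ->
  (forall (y : 'rV[C]_n) d, d <= r -> (forall l, nm (y ord0 l - F x ord0 l) <= d) ->
    nm (f y - f (F x) - \sum_i (y ord0 i - F x ord0 i) * c i) <= K * d ^+ 2) ->
  (forall i, has_deriv (fun x => F x ord0 i) j x (G i)) ->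
  has_deriv (f \o F) j x (\sum_i c i * G i).
Proof.
move=> r0 hf hF.
have /choice[rho hrho] i : exists p : R * R, 0 < p.1 /\ 0 <= p.2 /\ forall h, nm h <= p.1 ->
    nm (F (h *: delta_mx ord0 j + x) ord0 i - F x ord0 i - h * G i) <= p.2 * nm h ^+ 2.
  have [r1 [K1 [r10 hK1]]] := hF i; exists (r1, Num.max K1 0) => /=.
  split=> //; split; first by rewrite le_max lexx orbT.
  move=> h /hK1 /le_trans; apply; rewrite ler_wpM2r ?exprn_ge0 ?nm_ge0//.
  by rewrite le_max lexx.
pose K2 := \sum_i (rho i).2.
have K20 : 0 <= K2 by apply: sumr_ge0 => i _; case: (hrho i) => _ [].
have hK2 i : (rho i).2 <= K2.
  by rewrite /K2 (bigD1 i)//= lerDl sumr_ge0// => l _; case: (hrho l) => _ [].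
pose NG := \sum_i nm (G i).
have NG0 : 0 <= NG by apply: sumr_ge0 => i _; exact: nm_ge0.
have hNG i : nm (G i) <= NG.
  by rewrite /NG (bigD1 i)//= lerDl sumr_ge0// => l _; exact: nm_ge0.
pose s := \big[Num.min/1]_i (rho i).1.
have s0 : 0 < s.
  rewrite /s; elim/big_ind: _ => // [a b a0 b0|i _]; first by rewrite lt_min a0.
  by case: (hrho i).
have s1 : s <= 1 by rewrite /s; elim/big_rec: _ => // i a _ a1; rewrite ge_min a1 orbT.
have hs i : s <= (rho i).1 by rewrite /s (bigD1 i)//= ge_min lexx.
pose Q := K2 + NG.
have Q0 : 0 <= Q by exact: addr_ge0.
pose NC := \sum_i nm (c i).
have hNC i : nm (c i) <= NC.
  by rewrite /NC (bigD1 i)//= lerDl sumr_ge0// => l _; exact: nm_ge0.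
exists (Num.min s (r / (Q + 1))), (K * Q ^+ 2 + n%:R * (NC * K2)); split.
  by rewrite lt_min s0 divr_gt0// ltr_wpDl.
move=> h; rewrite le_min => /andP[hs' hr'].
have nh := nm_ge0 h.
have est i : nm (F (h *: delta_mx ord0 j + x) ord0 i - F x ord0 i - h * G i) <= K2 * nm h ^+ 2.
  have [_ [_ hi]] := hrho i.
  apply: le_trans (hi h (le_trans hs' (hs i))) _.
  by rewrite ler_wpM2r ?exprn_ge0.
have lip i : nm (F (h *: delta_mx ord0 j + x) ord0 i - F x ord0 i) <= Q * nm h.
  rewrite -[X in nm X](subrK (h * G i)) (le_trans (nmD _ _))// nmM.
  rewrite /Q mulrDl lerD//.
    apply: le_trans (est i) _; rewrite ler_wpM2l// expr2 ler_piMl//.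
    exact: le_trans s1.
  by rewrite mulrC ler_wpM2r.
have Qr : Q * nm h <= r.
  have Q1 : 0 < Q + 1 by exact: ltr_wpDl.
  move: hr'; rewrite ler_pdivlMr// mulrC => /(le_trans _); apply.
  by rewrite ler_wpM2r// lerDl.
have := hf _ _ Qr lip; rewrite exprMn => h1.
set y := F (_ + x) in h1 est *.
rewrite -[(f \o F) _]/(f y) -[(f \o F) x]/(f (F x)).
rewrite (_ : _ - h * _ = (f y - f (F x) - \sum_i (y ord0 i - F x ord0 i) * c i)
   + \sum_i c i * (y ord0 i - F x ord0 i - h * G i)).
  rewrite (le_trans (nmD _ _))// mulrDl lerD//; first by rewrite -mulrA.
  rewrite -mulrA; apply: nm_sum_le => i; rewrite nmM -mulrA.
  by apply: ler_pM => //; exact: nm_ge0.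
have -> : \sum_i c i * (y ord0 i - F x ord0 i - h * G i) =
    \sum_i (y ord0 i - F x ord0 i) * c i - h * \sum_i c i * G i.
  by rewrite mulr_sumr -sumrB; apply: eq_bigr => i _; ring.
by rewrite addrA subrK.
Qed.

End Analysis.

(** * Coordinates, division and units in the ring of germs *)

Section Germs.
Variable R : realType.
Local Notation C := (Cplx R).
Local Open Scope quotient_scope.

Lemma germ_at0_pi k (f : holfun R k) : germ_at0 (\pi_(germ R k) f) = f 0.
Proof. exact: (nbhs_singleton (repr_germ f)). Qed.

Lemma holfun_sumE k (I : Type) (r : seq I) (P : pred I) (f : I -> holfun R k) x :
  (\sum_(i <- r | P i) f i : holfun R k) x = \sum_(i <- r | P i) f i x.
Proof. by elim/big_rec2: _ => // i y z _ <-. Qed.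

Lemma partial_pullback m n (F : mapgerm R m n) (f : germ R n) (j : 'I_m) :
  partial j (pullback F f) = \sum_i pullback F (partial i f) * partial j (F i).
Proof.
elim/quotW: f => f; rewrite pullback_pi partial_pi.
under eq_bigr do rewrite partial_pi pullback_pi /partial -rmorphM.
rewrite -rmorph_sum; apply/germ_eqP.
have [r [M [r0 fM]]] := (holoP _).1 (holfunP f).
have [g [K [hg hK]]] := Rep_taylor r0 fM.
(* Half of the radius r/32 of the second-order estimate: points within r/64 of a
   value of F then stay in its domain. *)
have r640 : 0 < r / 64 by lra.
have [s s0 hs] := Rep_common r640 (mapgerm_holo F) (mapgerm_fun0 F).
have /choice[G hG] i : exists g, forall (x : 'rV[C]_m) h,
    (forall l, nm (x ord0 l) <= s / 8) -> nm h <= s / 8 ->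
    (s / 4) ^+ 2 * nm (mapgerm_fun F (h *: delta_mx ord0 j + x) ord0 i
      - mapgerm_fun F x ord0 i - h * g x) <= nm h ^+ 2 * (r / 64).
  by have [g' _ hg'] := Rep_deriv j s0 (hs i); exists g'.
apply/near0P; exists (s / 8); first lra.
move=> x hx; rewrite holfun_sumE.
have hFx i : nm (mapgerm_fun F x ord0 i) <= r / 64.
  by apply: (Rep_bound s0 (hs i)) => l; have := hx l; lra.
have dF i : has_deriv (fun x => mapgerm_fun F x ord0 i) j x (G i x).
  apply: (Rep_deriv_has_deriv s0) => t ht; apply: hG => // l.
  exact: ltW.
apply: etrans (has_deriv_derive (has_deriv_comp (c := fun i => g i (mapgerm_fun F x))
  (K := K) r640 _ dF)) _.
  move=> y d dr hy; apply: hK => // l; first by have := hFx l; lra.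
  rewrite -[y ord0 l](subrK (mapgerm_fun F x ord0 l)) (le_trans (nmD _ _))//.
  by have := hFx l; have := hy l; lra.
apply: eq_bigr => i _; apply: esym; congr (_ * _).
  apply: (has_deriv_derive (hg i _ _)) => l; have := hFx l; lra.
apply: (has_deriv_derive (i := j)); have := dF i.
by congr has_deriv; apply/funext => y; rewrite mxE.
Qed.

Section Coordinates.
Variable k : nat.

Definition unit_exponent (i : 'I_k) : multiindex k := [ffun j => (j == i : nat)].

Lemma monomial_unit (x : 'rV[C]_k) i : monomial x (unit_exponent i) = x ord0 i.
Proof.
rewrite /monomial (bigD1 i)//= ffunE eqxx expr1 big1 ?mulr1// => j /negPf ji.
by rewrite ffunE ji.
Qed.

Fact holo_coord (i : 'I_k) : holomorphic_at0 (fun x : 'rV[C]_k => x ord0 i).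
Proof.
apply/holoP; exists 1, (wt 1 (unit_exponent i) * nm (1 : C)); split => //.
apply: Rep_ext (Rep_shift (unit_exponent i) ltr01 (@Rep_cst R k 1 1 ltr01)).
by move=> x _; rewrite mulr1 monomial_unit.
Qed.

Definition coord_germ (i : 'I_k) : germ R k := \pi_(germ R k) (mk_holfun (holo_coord i)).

Lemma coord_at0 i : germ_at0 (coord_germ i) = 0.
Proof. by rewrite germ_at0_pi /= mxE. Qed.

Lemma cst_germE (c : C) : c%:A = cst_germ k c :> germ R k.
Proof. exact: mulr1. Qed.

Fact restrict_at0 (i j : 'I_k) : germ_at0 (if j == i then 0 else coord_germ j) = 0.
Proof.
case: ifP => _; last exact: coord_at0.
by rewrite -(rmorph0 \pi_(germ R k)) germ_at0_pi.
Qed.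

Definition hyperplane_proj (i : 'I_k) : mapgerm R k k := MapGerm (restrict_at0 i).

Definition restrict_germ (i : 'I_k) : {rmorphism germ R k -> germ R k} :=
  pullback (hyperplane_proj i).

Lemma hyperplane_proj_fun i : \forall x \near (0 : 'rV[C]_k),
  forall l, mapgerm_fun (hyperplane_proj i) x ord0 l = if l == i then 0 else x ord0 l.
Proof.
apply: (@filter_forall _ _ (fun l x => mapgerm_fun (hyperplane_proj i) x ord0 l =
  if l == i then 0 else x ord0 l) _ (nbhs_filter _)) => l; near=> x; rewrite mxE /=.
case: ifP => _.
  by near: x; rewrite -(rmorph0 \pi_(germ R k)); exact: (repr_germ (0 : holfun R k)).
by near: x; exact: (repr_germ (mk_holfun (holo_coord l))).
Unshelve. all: by end_near. Qed.

Lemma restrict_germ_coord i j : restrict_germ i (coord_germ j) = if j == i then 0 else coord_germ j.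
Proof.
rewrite /= pullback_pi.
case: ifP => ji; [rewrite -(rmorph0 \pi_(germ R k))|]; apply/germ_eqP.
all: apply: filterS (hyperplane_proj_fun i) => x /(_ j); rewrite ji => hx; exact: hx.
Qed.

(** Of the power series of [u], the terms without the [i]-th variable sum to the
    restriction, and the other terms have that variable as a factor. *)
Lemma restrict_germ_divides i (u : germ R k) : exists v, u = restrict_germ i u + coord_germ i * v.
Proof.
elim/quotW: u => f.
have [s [M [s0 [c [cM cf]]]]] := (holoP _).1 (holfunP f).
pose e := unit_exponent i.
have addI : injective (fun b : multiindex k => b + e).
  move=> b b' /ffunP h; apply/ffunP => j; have := h j; rewrite !ffunE !natrDE.
  exact: addIn.
have wte : wt s e = s.
  rewrite /wt (bigD1 i)//= ffunE eqxx expr1 big1 ?mulr1// => j /negPf ji.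
  by rewrite ffunE ji.
pose d (b : multiindex k) : C := c (b + e).
have dM : absbnd (fun b => d b * (wt s b)%:C%C) (M / s).
  have := absbndZ ((s^-1)%:C)%C cM; rewrite nm_real ?invr_ge0 ?(ltW s0)// mulrC.
  apply: (@absbnd_inj _ _ _ _ _ (fun b : multiindex k => b + e)) => [b b' _ _|b].
    exact: addI.
  rewrite nm_wt// [in leRHS]nmM nm_real ?invr_ge0 ?(ltW s0)// nm_wt//.
  rewrite wtD wte (_ : s^-1 * _ = nm (c (b + e)) * wt s b)//.
  by field; rewrite gt_eqF.
pose g x := xget 0 [set y | has_sum (fun b => d b * monomial x b) y].
have hg (x : 'rV[C]_k) : (forall j, nm (x ord0 j) <= s) -> has_sum (fun b => d b * monomial x b) (g x).
  move=> xs; have [y hy] := absbnd_has_sum (absbnd_monomial s0 xs dM).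
  by rewrite /g; case: xgetP => [z ->//|/(_ y)].
have gholo : holomorphic_at0 g.
  by apply/holoP; exists s, (M / s); split => //; exists d.
exists (\pi_(germ R k) (mk_holfun gholo)).
rewrite /= pullback_pi -rmorphM -rmorphD; apply/germ_eqP.
near=> x.
have hF : forall l, mapgerm_fun (hyperplane_proj i) x ord0 l = if l == i then 0 else x ord0 l.
  by near: x; exact: hyperplane_proj_fun.
have hx : forall l, nm (x ord0 l) <= s.
  by near: x; apply/near0P; exists s => // x hx l; exact/ltW.
rewrite -[RHS]/(f (mapgerm_fun (hyperplane_proj i) x) + x ord0 i * g x).
set x' := mapgerm_fun _ _ in hF *.
have hx' l : nm (x' ord0 l) <= s.
  by rewrite hF; case: ifP => // _; rewrite nm0 ltW.
apply/eqP; rewrite -subr_eq0 opprD addrA subr_eq0; apply/eqP.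
have h1 := has_sumD (cf _ hx) (has_sumN (cf _ hx')).
apply: has_sum_unique h1 _.
apply: (@has_sum_inj _ _ _ (fun b : multiindex k => b + e)) => //.
  move=> a ha; rewrite -mulrBr (_ : monomial x a - _ = 0) ?mulr0//.
  apply/eqP; rewrite subr_eq0; apply/eqP; apply: eq_bigr => l _; rewrite hF.
  case: ifP => // /eqP li.
  case Ea : (a l) => [|n]; first by rewrite !expr0.
  case: (ha [ffun j => a j - (j == i)]%N); apply/ffunP => j.
  rewrite !ffunE natrDE; case: eqP => [->|_]; last by rewrite subn0 addn0.
  by rewrite -li Ea subn1 addn1.
apply: has_sum_ext (has_sumZ (x ord0 i) (hg x hx)) => b /=.
rewrite !monomialD !monomial_unit hF eqxx !mulr0 subr0 /d; ring.
Unshelve. all: by end_near. Qed.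

(** Where the coordinate vanishes, the value of the germ is a limit of its values,
    all zero, off the hyperplane; the derivative bound makes this quantitative. *)
Lemma coord_regular i (u : germ R k) : coord_germ i * u = 0 -> u = 0.
Proof.
elim/quotW: u => f; rewrite -rmorphM -(rmorph0 \pi_(germ R k)) => /germ_eqP.
move=> /near0P[r r0 hr]; apply/germ_eqP.
have {}hr (x : 'rV[C]_k) : (forall l, nm (x ord0 l) < r) -> x ord0 i * f x = 0 by exact: hr.
have [s [M [s0 fM]]] := (holoP _).1 (holfunP f).
have M0 := Rep_ge0 fM.
have [g gM hg] := Rep_deriv i s0 fM.
pose t := Num.min (r / 2) (s / 8).
have t0 : 0 < t by rewrite lt_min !divr_gt0.
have tr : t <= r / 2 by rewrite ge_min lexx.
have ts : t <= s / 8 by rewrite ge_min lexx orbT.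
apply/near0P; exists t => // x hx; rewrite -[RHS]/(0 : C).
have [xi0|xi] := eqVneq (x ord0 i) 0; last first.
  have /eqP : x ord0 i * f x = 0 by apply: hr => l; have := hx l; lra.
  by rewrite mulf_eq0 (negPf xi) /= => /eqP.
apply: nm_eq0 => eps eps0.
pose K := M / s + 16 * M / s ^+ 2 * t + 1.
have [s_ge0 t_ge0] : 0 <= s /\ 0 <= t by rewrite !ltW.
have K0 : 0 < K.
  have : 0 <= M / s by exact: divr_ge0.
  have : 0 <= 16 * M / s ^+ 2 * t by rewrite mulr_ge0// divr_ge0 ?mulr_ge0 ?exprn_ge0.
  rewrite /K; lra.
(* A real step along the i-th axis, so small that the error bound [h0 * K] is at
   most [eps / 2]. *)
pose h0 := Num.min t (eps / (2 * K)).
have h00 : 0 < h0 by rewrite lt_min t0 divr_gt0// mulr_gt0.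
have h0t : h0 <= t by rewrite ge_min lexx.
have h0e : h0 * K <= eps / 2.
  have : h0 <= eps / (2 * K) by rewrite ge_min lexx orbT.
  rewrite ler_pdivlMr ?mulr_gt0//; lra.
pose h : C := (h0%:C)%C.
have nh : nm h = h0 by rewrite nm_real// ltW.
have hn0 : h != 0 by rewrite /h eq_complex /= negb_and gt_eqF.
have fh : f (h *: delta_mx ord0 i + x) = 0.
  have /hr : forall l, nm ((h *: delta_mx ord0 i + x) ord0 l) < r.
    move=> l; rewrite !mxE eqxx/=; have := hx l.
    have [->|li] := eqVneq l i; first by rewrite xi0 addr0 mulr1 nh; lra.
    by rewrite mulr0 add0r; lra.
  move=> /eqP; rewrite mulf_eq0 !mxE !eqxx mulr1 xi0 addr0 (negPf hn0) /=.
  by move/eqP.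
have hs8 : nm h <= s / 8 by rewrite nh; lra.
have := hg x h (fun l => le_trans (ltW (hx l)) ts) hs8; rewrite fh sub0r nh => est.
have s20 : 0 < s / 2 by lra.
have gx : nm (g x) <= M / s.
  by apply: (Rep_bound s20 gM) => l; have := hx l; lra.
have s4 : 0 < (s / 4) ^+ 2 by rewrite exprn_gt0//; lra.
have est2 : nm (- f x - h * g x) <= h0 * (16 * M / s ^+ 2 * t).
  rewrite -(ler_pM2l s4); apply: le_trans est _.
  rewrite (_ : _ * (h0 * _) = h0 * t * M); last by field; lra.
  by rewrite ler_wpM2r// expr2 ler_pM// ltW.
have : nm (f x) <= h0 * (16 * M / s ^+ 2 * t) + h0 * (M / s).
  rewrite -nmN -[- f x](subrK (h * g x)) (le_trans (nmD _ _))// lerD//.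
  by rewrite nmM nh ler_wpM2l// ltW.
move=> /le_lt_trans; apply.
by move: h0e; rewrite /K; lra.
Qed.

Lemma geometric_bound (A : {fset nat}) (z : C) : nm z <= 1 / 2 ->
  \sum_(n <- A) nm (z ^+ n) <= 2.
Proof.
move=> hz.
have [N hN] : exists N, forall n, n \in A -> (n < N)%N.
  exists (\max_(n <- A) n).+1 => n nA; rewrite ltnS.
  exact: (@leq_bigmax_seq _ _ xpredT id).
apply: (@le_trans _ _ (\sum_(n < N) (1 / 2) ^+ n)).
  apply: (@le_trans _ _ (\sum_(n <- [fset (nat_of_ord i) | i in 'I_N]%fset) (1 / 2) ^+ n)).
    apply: (@le_trans _ _ (\sum_(n <- A) (1 / 2) ^+ n)).
      apply: ler_sum => n _; rewrite nmX lerXn2r ?nnegrE ?nm_ge0//; lra.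
    apply: ler_sum_fset => [|n]; last by rewrite exprn_ge0//; lra.
    apply/fsubsetP => n nA; apply/imfsetP; exists (Ordinal (hN _ nA)) => //.
  rewrite big_imfset/=; last by move=> a b _ _; exact: val_inj.
  by rewrite big_enum.
suff -> : \sum_(n < N) (1 / 2) ^+ n = 2 - 2 * (1 / 2) ^+ N :> R.
  have : 0 <= (1 / 2 : R) ^+ N by rewrite exprn_ge0//; lra.
  lra.
elim: (N) => [|n IH]; first by rewrite big_ord0 expr0; lra.
by rewrite big_ord_recr/= IH exprS; lra.
Qed.

Lemma geometric_sum (z : C) : nm z <= 1 / 2 -> has_sum (fun n => z ^+ n) (1 - z)^-1.
Proof.
move=> hz.
have [S hS] := absbnd_has_sum (fun A => geometric_bound A hz).
suff SE : S * (1 - z) = 1.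
  have z1 : 1 - z != 0 by apply: contra_eq_neq SE => ->; rewrite mulr0 eq_sym oner_neq0.
  by rewrite -[X in has_sum _ X](_ : S = _)// -[LHS](mulfK z1) SE mul1r.
have h1 : has_sum (fun n => if n is n'.+1 then z ^+ n else 0) (z * S).
  apply: (@has_sum_inj _ _ _ succn) => //; first exact: succn_inj.
    by case=> // n /(_ n).
  by apply: has_sum_ext (has_sumZ z hS) => n; rewrite exprS.
have h2 : has_sum (fun n => if n is n'.+1 then 0 else 1) (1 : C).
  by have := @has_sum_supp1 R _ (fun n => if n is n'.+1 then 0 else 1 : C) 0%N; apply; case.
have h3 : has_sum (fun n => z ^+ n) (z * S + 1).
  by apply: has_sum_ext (has_sumD h1 h2) => -[|n]; rewrite ?add0r ?addr0.
by rewrite mulrBr mulr1 {1}(has_sum_unique hS h3); ring.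
Qed.

(** The inverse is the geometric series in [1 - u / u(0)]. *)
Lemma germ_unit (u : germ R k) : germ_at0 u != 0 -> exists v, u * v = 1.
Proof.
elim/quotW: u => f; rewrite germ_at0_pi => f0.
pose w (x : 'rV[C]_k) := 1 - f x / f 0.
have w_holo : holomorphic_at0 w.
  have := holoD (@holo_cst R k 1) (holoM (holfunP f) (@holo_cst R k (- (f 0)^-1))).
  by congr holomorphic_at0; apply/funext => x; rewrite mulrN.
have w0 : (fun x : 'rV[C]_k => \row_(_ < 1) w x) 0 = 0.
  by apply/rowP => l; rewrite !mxE /w divff// subrr.
have half0 : 0 < 1 / 2 :> R by lra.
have wh l : holomorphic_at0 (fun x : 'rV[C]_k => (\row_(_ < 1) w x) ord0 l).
  by under eq_fun do rewrite mxE.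
have [s s0 /(_ ord0)] := Rep_common half0 wh w0.
under eq_fun do rewrite mxE; move=> hs.
have ws (x : 'rV[C]_k) : (forall l, nm (x ord0 l) <= s) -> nm (w x) <= 1 / 2.
  exact: (Rep_bound s0 hs).
have vs : Rep s 2 (fun x => (1 - w x)^-1).
  apply: (@Rep_series _ _ nat (fun=> 1) (fun n x => w x ^+ n) (fun n => (1 / 2) ^+ n)) => //.
  - by move=> n; exact: RepX.
  - move=> A; have := @geometric_bound A ((1 / 2)%:C)%C.
    rewrite nm_real ?(ltW half0)// => /(_ (lexx _)) /(le_trans _); apply.
    by apply: ler_sum => n _; rewrite nm1 mul1r nmX nm_real// ltW.
  - move=> x /ws hx; apply: has_sum_ext (geometric_sum hx) => n.
    by rewrite mul1r.
have vh : holomorphic_at0 (fun x => (1 - w x)^-1) by apply/holoP; exists s, 2.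
have vh' := holoM vh (@holo_cst R k (f 0)^-1).
exists (\pi_(germ R k) (mk_holfun vh')).
rewrite -rmorphM -(rmorph1 \pi_(germ R k)); apply/germ_eqP/near0P; exists s => // x hx.
have : nm (w x) <= 1 / 2 by apply: ws => l; exact/ltW.
move=> hw; rewrite -[LHS]/(f x * ((1 - w x)^-1 / f 0)) -[RHS]/(1 : C).
have w1 : 1 - w x != 0.
  by rewrite subr_eq0; apply: contraTneq hw => <-; rewrite nm1 -ltNge; lra.
have -> : f x = (1 - w x) * f 0 by rewrite /w opprB addrC subrK divfK.
by rewrite mulrACA mulfV// mulfV// mulr1.
Qed.

End Coordinates.
End Germs.

(** * Relations among generators of an ideal of finite codimension *)

Lemma span_min (A : comNzRingType) (E : lmodType A) (X V : set E) :
  submodule V -> X `<=` V -> span X `<=` V.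
Proof. by move=> hV XV u; apply; split. Qed.

Lemma span_incl (A : comNzRingType) (E : lmodType A) (X : set E) : X `<=` span X.
Proof. by move=> u Xu V [_]; apply. Qed.

Lemma span_range (A : comNzRingType) (E : lmodType A) n (e : 'I_n -> E) u :
  span (range e) u <-> exists c : 'I_n -> A, u = \sum_i c i *: e i.
Proof.
split=> [|[c ->]]; last first.
  by apply: submodule_sum => [|i _]; [exact: span_submodule |
    apply: submoduleZ (span_submodule _) _; apply: span_incl; exists i].
apply: (span_min (V := [set u | exists c : 'I_n -> A, u = \sum_i c i *: e i])).
  split; first by exists (fun=> 0); rewrite big1// => i _; rewrite scale0r.
  move=> a _ _ [c ->] [d ->]; exists (fun i => a * c i + d i).
  by rewrite scaler_sumr -big_split/=; apply: eq_bigr => i _; rewrite scalerDl scalerA.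
move=> _ [i _ <-]; exists (fun j => (j == i)%:R).
rewrite (bigD1 i)//= eqxx scale1r big1 ?addr0// => j /negPf ->.
by rewrite scale0r.
Qed.

Lemma fsbig_ordT (V : nmodType) n (F : 'I_n -> V) : \sum_(i \in [set: 'I_n]) F i = \sum_i F i.
Proof.
have -> : [set: 'I_n] = [set` enum 'I_n].
  by apply/seteqP; split=> i //= _; rewrite mem_enum.
by rewrite -fsbig_seq ?enum_uniq// big_enum.
Qed.

Section GermAlgebra.
Variable R : realType.
Local Notation C := (Cplx R).
Local Open Scope quotient_scope.

Lemma germ_at0D k (u v : germ R k) : germ_at0 (u + v) = germ_at0 u + germ_at0 v.
Proof. by elim/quotW: u => u; elim/quotW: v => v; rewrite -rmorphD !germ_at0_pi. Qed.

Lemma germ_at0M k (u v : germ R k) : germ_at0 (u * v) = germ_at0 u * germ_at0 v.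
Proof. by elim/quotW: u => u; elim/quotW: v => v; rewrite -rmorphM !germ_at0_pi. Qed.

Lemma germ_at0_cst k (c : C) : germ_at0 (c%:A : germ R k) = c.
Proof. by rewrite cst_germE germ_at0_pi. Qed.

Lemma pullback_alg m n (F : mapgerm R m n) (c : C) : pullback F c%:A = c%:A.
Proof. by rewrite !cst_germE pullback_pi; apply/germ_eqP; near=> x. Unshelve. all: by end_near. Qed.

Lemma germ_at0_horner k (i : 'I_k) (q : {poly C}) :
  germ_at0 (horner_alg (coord_germ R i) q) = q.[0].
Proof.
elim/poly_ind: q => [|q c _].
  by rewrite rmorph0 horner0 -(scale0r 1) germ_at0_cst.
rewrite rmorphD rmorphM /= horner_algX horner_algC germ_at0D germ_at0M coord_at0.
by rewrite germ_at0_cst mulr0 hornerD hornerM hornerX mulr0 hornerC.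
Qed.

(** The powers of a coordinate are linearly dependent modulo [J], so [J] contains a
    nonzero polynomial in it. Splitting off the largest power of the variable leaves
    a polynomial with nonzero constant term, which is a unit among germs. *)
Lemma coord_power_mem k (J : set (germ R k)^o) d (i : 'I_k) : submodule J ->
  quotient_dim setT J d -> exists N, J (coord_germ R i ^+ N).
Proof.
move=> hJ /quotient_dimP[]//; first exact: submodule_ksubspace.
move=> kap [kl _ kk]; have hJK := submodule_ksubspace hJ.
pose x : germ R k := coord_germ R i.
pose M : 'M[C]_(d.+1, d) := \matrix_j kap (x ^+ j).
(* [M] has one more row than columns. *)
have : kermx M != 0.
  by rewrite kermx_eq0 /row_free neq_ltn ltnS rank_leq_col.
case/rowV0Pn => c /sub_kermxP cM c0.
have Jc : J (\sum_j (c ord0 j)%:A *: (x ^+ j : (germ R k)^o)).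
  apply/kk => //; rewrite (@klinear_on_sum _ _ _ setT)// -[RHS]cM mulmx_sum_row.
  by apply: eq_bigr => j _; rewrite rowK.
pose p : {poly C} := \sum_(j < d.+1) c ord0 j *: 'X^j.
have p0 : p != 0.
  apply: contraNneq c0 => p0; apply/eqP/rowP => j; rewrite mxE.
  have := congr1 (fun p : {poly C} => p`_j) p0; rewrite coef0 coef_sum (bigD1 j)//=.
  rewrite coefZ coefXn eqxx mulr1 big1 ?addr0// => l lj.
  by rewrite coefZ coefXn [(nat_of_ord j == _)]eq_sym (negbTE (lj : nat_of_ord l != j)) mulr0.
have pE : horner_alg x p = \sum_j (c ord0 j)%:A *: (x ^+ j : (germ R k)^o).
  rewrite rmorph_sum; apply: eq_bigr => j _ /=.
  by rewrite linearZ rmorphXn /= horner_algX -mulr_algl.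
have [N [q + pq]] := multiplicity_XsubC p 0; rewrite p0 /= => q0.
exists N.
have [v hv] : exists v, horner_alg x q * v = 1 by apply: germ_unit; rewrite germ_at0_horner.
have -> : coord_germ R i ^+ N = v * horner_alg x p.
  by rewrite pq subr0 rmorphM rmorphXn /= horner_algX mulrA [v * _]mulrC hv mul1r.
by rewrite pE; exact: (submoduleZ v hJ).
Qed.

Lemma koszul_row m (g : 'rV[germ R m]_m) d :
  quotient_dim setT (span (range (fun i => g ord0 i : (germ R m)^o))) d ->
  forall xi : 'rV[germ R m]_m, xi *m g^T = 0 ->
  exists c : 'M[germ R m]_m, xi = g *m (c - c^T).
Proof.
move=> hd xi xig.
have /choice[N hN] i := coord_power_mem i (span_submodule _) hd.
have [||||c hc] := @koszul_relations _ m (fun i => g ord0 i)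
  [seq coord_germ R i ^+ N i | i <- enum 'I_m] (fun i => xi ord0 i).
- refine (@regular_powers _ _ (coord_germ R (k:=m)) (@restrict_germ R m) _ _ _ _ N _ _).
  + by move=> i; rewrite restrict_germ_coord eqxx.
  + by move=> i j; rewrite restrict_germ_coord eq_sym => /negPf ->.
  + exact: coord_regular.
  + exact: restrict_germ_divides.
  + exact: enum_uniq.
- by rewrite size_map size_enum_ord.
- by move=> _ /mapP[i _ ->]; have /span_range := hN i.
- have := congr1 (fun M : 'M_1 => M ord0 ord0) xig; rewrite !mxE => xig0.
  by rewrite -[RHS]xig0; apply: eq_bigr => i _; rewrite mxE.
- exists c; apply/rowP => j; rewrite hc mxE; apply: eq_bigr => i _.
  by rewrite !mxE.
Qed.

End GermAlgebra.

(** * Vector fields along F and syzygies of the pulled back gradient *)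

(** The setting reduced to algebra: [pb] stands for the pullback of germs along [F],
    [df] for the gradient of [f], and [D] for the matrix of the [d_j F_k]. In the
    comments, [phi] and [g] are the vectors [pulled_grad] and [comp_grad], the latter
    being the gradient of [f o F] by the chain rule. *)
Section LiftableFields.
Variables (K : fieldType) (A B : comAlgType K) (pb : {rmorphism A -> B}) (m n : nat).
Variables (df : 'I_n -> A) (D : 'M[B]_(m, n)).

Definition log_fields : set 'rV[A]_n := [set chi | \sum_i chi ord0 i * df i = 0].
Definition pulled_logs : set 'rV[B]_n := span (map_mx pb @` log_fields).
Definition pulled_grad : 'rV[B]_n := \row_k pb (df k).
Definition comp_grad : 'rV[B]_m := pulled_grad *m D^T.
Definition comp_ideal : set B^o := span (range (fun j => comp_grad ord0 j : B^o)).
Definition grad_syzygies : set 'rV[B]_n := [set u | u *m pulled_grad^T = 0].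
Definition tangent_logs : set 'rV[B]_n :=
  [set u + v | u in range (fun xi : 'rV[B]_m => xi *m D) & v in pulled_logs].

Local Notation J := comp_ideal.
Local Notation L := pulled_logs.
Local Notation T := tangent_logs.

Lemma pulled_logs_submodule : submodule L. Proof. exact: span_submodule. Qed.

Lemma comp_gradT : comp_grad^T = D *m pulled_grad^T.
Proof. by rewrite trmx_mul trmxK. Qed.

Lemma comp_idealP (u : B) : J u <-> exists w : 'rV[B]_m, u%:M = w *m comp_grad^T.
Proof.
rewrite /comp_ideal span_range; split=> [[c ->]|[w hw]].
  exists (\row_j c j); rewrite [RHS]mx11_scalar; congr _%:M; rewrite mxE.
  by apply: eq_bigr => j _; rewrite !mxE.
exists (fun j => w ord0 j); have := congr1 (fun M : 'M_1 => M ord0 ord0) hw.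
rewrite !mxE mulr1n => ->; by apply: eq_bigr => j _; rewrite !mxE.
Qed.

Lemma pulled_log_syzygy (chi : 'rV[A]_n) : log_fields chi -> grad_syzygies (map_mx pb chi).
Proof.
move=> hchi; apply/matrixP => i j; rewrite !ord1 !mxE.
have := congr1 pb hchi; rewrite rmorph0 rmorph_sum => h; rewrite -[RHS]h.
by apply: eq_bigr => k _; rewrite rmorphM !mxE.
Qed.

Lemma grad_syzygies_submodule : submodule grad_syzygies.
Proof.
split; first by rewrite /grad_syzygies /= mul0mx.
by rewrite /grad_syzygies /= => a u v hu hv; rewrite mulmxDl -scalemxAl hu hv scaler0 addr0.
Qed.

Lemma pulled_logs_sub_syzygies : L `<=` grad_syzygies.
Proof.
by apply: span_min grad_syzygies_submodule _ => _ [chi hchi <-]; exact: pulled_log_syzygy.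
Qed.

(** The vector is a combination of the pullbacks of the fields
    [(df k) e_l - (df l) e_k], which annihilate [df]. *)
Lemma koszul_log (y : 'M[B]_n) : L (pulled_grad *m (y - y^T)).
Proof.
pose chi (k l : 'I_n) : 'rV[A]_n :=
  df k *: delta_mx 0 l - df l *: delta_mx 0 k.
have chiP k l : log_fields (chi k l).
  rewrite /log_fields /=.
  under eq_bigr do rewrite !mxE eqxx mulrBl.
  rewrite sumrB (bigD1 l)//= eqxx mulr1 [X in _ - X](bigD1 k)//= eqxx mulr1.
  rewrite big1 => [|i /negPf ->]; last by rewrite mulr0 mul0r.
  rewrite big1 => [|i /negPf ->]; last by rewrite mulr0 mul0r.
  by rewrite !addr0 mulrC subrr.
have -> : pulled_grad *m (y - y^T) = \sum_k \sum_l y k l *: map_mx pb (chi k l).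
  apply/rowP => j; rewrite summxE !mxE.
  under [RHS]eq_bigr do rewrite summxE.
  under [RHS]eq_bigr => k _ do under eq_bigr => l _ do
    rewrite !mxE eqxx rmorphB !rmorphM !rmorph_nat mulrBr.
  under [RHS]eq_bigr do rewrite sumrB.
  rewrite sumrB [X in _ = _ - X]exchange_big -sumrB; apply: eq_bigr => k _ /=.
  rewrite (bigD1 j)//= eqxx mulr1 [X in _ = _ - X](bigD1 j)//= eqxx mulr1.
  rewrite !big1 => [|l|l]; try by rewrite eq_sym => /negPf ->; rewrite !mulr0.
  by rewrite !mxE !addr0 mulrBr ![pb _ * _]mulrC.
apply: submodule_sum pulled_logs_submodule _ => k _.
apply: submodule_sum pulled_logs_submodule _ => l _.
by apply: submoduleZ pulled_logs_submodule _; apply: span_incl; exists (chi k l).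
Qed.

(** For germs, this is where the isolated singularity enters. *)
Hypothesis koszul_comp_grad : forall xi : 'rV[B]_m, xi *m comp_grad^T = 0 ->
  exists c : 'M[B]_m, xi = comp_grad *m (c - c^T).

(** The image of a Koszul relation among the [g_j] is a Koszul relation among the
    [phi_k], with coefficients transported by [D]. *)
Lemma tangent_koszul (c : 'M[B]_m) : L (comp_grad *m (c - c^T) *m D).
Proof.
have := koszul_log (D^T *m c *m D); congr L.
by rewrite !trmx_mul trmxK /comp_grad mulmxBr mulmxBr mulmxBl !mulmxA.
Qed.

Lemma tangent_ker (xi : 'rV[B]_m) : grad_syzygies (xi *m D) -> L (xi *m D).
Proof.
rewrite /grad_syzygies /= => h.
have [|c ->] := @koszul_comp_grad xi; last exact: tangent_koszul.
by rewrite comp_gradT mulmxA.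
Qed.

(** From [g w phi^T = 0] the vector [w phi^T] is a relation among the [g_j], so
    [w phi^T = (c^T - c) D phi^T]. Correcting [w] by a Koszul term therefore makes
    its rows syzygies of [phi], and the ideal [(phi)] multiplies syzygies into
    Koszul relations. *)
Lemma ker_ideal_log (w : 'M[B]_(m, n)) : grad_syzygies (comp_grad *m w) -> L (comp_grad *m w).
Proof.
rewrite /grad_syzygies /= => h.
have [|c hc] := @koszul_comp_grad (pulled_grad *m w^T).
  by apply: (can_inj (@trmxK _ _ _)); rewrite trmx0 !trmx_mul !trmxK mulmxA.
pose z := w + (c - c^T) *m D.
have z0 : z *m pulled_grad^T = 0.
  have := congr1 trmx hc; rewrite [LHS]trmx_mul trmxK [RHS]trmx_mul => hw.
  rewrite mulmxDl hw -mulmxA -comp_gradT.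
  by rewrite linearB /= trmxK -mulmxDl addrC subrKA subrr mul0mx.
have -> : comp_grad *m w = comp_grad *m z - comp_grad *m (c - c^T) *m D.
  by rewrite /z mulmxDr mulmxA addrK.
apply: (submoduleB pulled_logs_submodule) (tangent_koszul c).
have := koszul_log (D^T *m z); congr L.
rewrite mulmxBr -[X in _ - X]trmxK trmx_mul trmxK -mulmxA z0 mulmx0 trmx0 subr0.
by rewrite /comp_grad mulmxA.
Qed.

Definition pulled_ideal : set B^o := [set a | exists u : 'rV[B]_n, a%:M = u *m pulled_grad^T].

Lemma scalar_mx_lin (a u v : B) : (a * u + v)%:M = a *: u%:M + v%:M :> 'M_1.
Proof. by rewrite scale_scalar_mx -raddfD. Qed.

Lemma pulled_ideal_submodule : submodule pulled_ideal.
Proof.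
split; first by exists 0; rewrite mul0mx; apply/matrixP => i j; rewrite !mxE mul0rn.
move=> a u v [x hx] [y hy]; exists (a *: x + y).
by rewrite mulmxDl -scalemxAl -hx -hy -scalar_mx_lin.
Qed.

Lemma comp_ideal_sub_pulled_ideal : J `<=` pulled_ideal.
Proof.
move=> u /comp_idealP[w hw]; exists (w *m D).
by rewrite hw comp_gradT mulmxA.
Qed.

Definition pairing (u : 'rV[B]_n) : B^o := (u *m pulled_grad^T) ord0 ord0.

Lemma pairing_lin a u v : pairing (a *: u + v) = a * pairing u + pairing v.
Proof. by rewrite /pairing mulmxDl -scalemxAl !mxE. Qed.

Lemma pairingM u : (pairing u)%:M = u *m pulled_grad^T.
Proof. by rewrite [RHS]mx11_scalar. Qed.

(** This is the sum of the syzygies of [phi] and of the image of [D]; the defining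
    condition is easier to check than membership in the sum. *)
Definition pairing_preimage : set 'rV[B]_n := [set u | J (pairing u)].

Lemma comp_ideal_submodule : submodule J. Proof. exact: span_submodule. Qed.

Lemma pairing_preimage_submodule : submodule pairing_preimage.
Proof.
split; first by rewrite /pairing_preimage /= /pairing mul0mx mxE; case: comp_ideal_submodule.
by move=> a u v hu hv; rewrite /pairing_preimage /= pairing_lin; case: comp_ideal_submodule => _; apply.
Qed.

Lemma tangent_logs_submodule : submodule T.
Proof.
split.
  exists 0; first by exists 0; rewrite // mul0mx.
  by exists 0; [case: pulled_logs_submodule | rewrite addr0].
move=> a _ _ [_ [xi _ <-] [b hb <-]] [_ [xi' _ <-] [b' hb' <-]].
exists ((a *: xi + xi') *m D); first by exists (a *: xi + xi').
exists (a *: b + b'); first by case: pulled_logs_submodule => _; apply.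
by rewrite mulmxDl -scalemxAl scalerDr addrACA.
Qed.

Lemma tangent_logs_sub_preimage : T `<=` pairing_preimage.
Proof.
move=> _ [_ [xi _ <-] [b /pulled_logs_sub_syzygies hb <-]]; apply/comp_idealP; exists xi.
rewrite pairingM mulmxDl (hb : b *m _ = 0) addr0.
by rewrite comp_gradT mulmxA.
Qed.

Lemma pairing_ideal a : pulled_ideal a -> exists u, pairing u = a.
Proof.
move=> [u hu]; exists u; have := congr1 (fun M : 'M_1 => M ord0 ord0) hu.
by rewrite mxE mulr1n => ->.
Qed.

(** The syzygies with entries in [comp_ideal] have finite codimension among all syzygies,
    and they lie in [pulled_logs] by [ker_ideal_log]. *)
Lemma syzygies_mod_logs_dim mu : quotient_dim setT J mu ->
  exists b, quotient_dim grad_syzygies L b.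
Proof.
move=> hmu.
have JK := submodule_ksubspace comp_ideal_submodule.
have ZK := submodule_ksubspace grad_syzygies_submodule.
have BK := submodule_ksubspace pulled_logs_submodule.
have [kap [kl _ kk]] := (quotient_dimP mu (setT_ksubspace _) JK (fun _ _ => I)).1 hmu.
pose W : set 'rV[B]_n := [set u | grad_syzygies u /\ forall k, J (u ord0 k)].
have WK : ksubspace W.
  split.
    by split=> [|k]; [case: ZK | rewrite mxE; case: JK].
  move=> c u v [hu1 hu2] [hv1 hv2]; split; first by case: ZK => _; apply.
  by move=> k; rewrite !mxE; case: JK => _; apply.
have WZ : W `<=` grad_syzygies by move=> u [].
have WB : W `<=` L.
  move=> u [uZ uJ].
  have /choice[w hw] : forall k, exists w : 'rV[B]_m, (u ord0 k)%:M = w *m comp_grad^T.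
    by move=> k; apply/comp_idealP.
  have uE : u = comp_grad *m (\matrix_(j, k) w k ord0 j).
    apply/rowP => k; have := congr1 (fun M : 'M_1 => M ord0 ord0) (hw k).
    rewrite !mxE mulr1n => ->; apply: eq_bigr => j _.
    by rewrite !mxE mulrC.
  by rewrite uE; apply: ker_ideal_log; rewrite -uE.
(* The coordinates modulo [comp_ideal] of all entries of [u]. *)
pose kap' (u : 'rV[B]_n) : 'rV[K]_(n * mu) := mxvec (\matrix_k kap (u ord0 k)).
have kl' : klinear_on grad_syzygies kap'.
  move=> c u v _ _; rewrite /kap' -linearP; congr mxvec; apply/row_matrixP => k.
  by rewrite !linearP /= !rowK !mxE kl.
have kk' u : grad_syzygies u -> (kap' u = 0 <-> W u).
  move=> hu; split=> [|[_ hJ]].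
    move=> h; split=> // k; apply/kk => //.
    have : \matrix_k kap (u ord0 k) = 0.
      by apply: (can_inj mxvecK); rewrite linear0.
    by move=> /(congr1 (row k)); rewrite rowK row0.
  rewrite /kap' (_ : \matrix_k _ = 0) ?linear0//; apply/row_matrixP => k.
  by rewrite rowK row0; apply/kk.
have [M [_ dM]] := subspace_quotient_dim ZK WK WZ kl' kk'.
by have [d1 [b [_ hb _]]] := quotient_dim_split ZK BK WK WB pulled_logs_sub_syzygies dM; exists b.
Qed.

(** The filtration of [B^n] by [pairing_preimage] and [tangent_logs]: the pairing
    identifies the quotient of [B^n] by [pairing_preimage] with [(phi)/(g)], and the
    next quotient is that of the syzygies by [pulled_logs], because syzygies in
    [tangent_logs] lie in [pulled_logs] by [tangent_ker]. *)
Lemma tangent_logs_dim a b : quotient_dim pulled_ideal J a -> quotient_dim grad_syzygies L b ->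
  quotient_dim setT T (b + a).
Proof.
move=> ha hb.
have JK := submodule_ksubspace comp_ideal_submodule.
have ZK := submodule_ksubspace grad_syzygies_submodule.
have BK := submodule_ksubspace pulled_logs_submodule.
have TK := submodule_ksubspace tangent_logs_submodule.
have JpK := submodule_ksubspace pairing_preimage_submodule.
have IK := submodule_ksubspace pulled_ideal_submodule.
have BT : L `<=` T.
  move=> b' hb'; exists 0; first by exists 0; rewrite // mul0mx.
  by exists b'; rewrite // add0r.
apply: (quotient_dim_extend (setT_ksubspace _) JpK TK tangent_logs_sub_preimage) => //.
- apply: (quotient_dim_push (phi := id) ZK BK pulled_logs_sub_syzygies JpK TK tangent_logs_sub_preimage) hb => //.
  + by move=> v hv; rewrite /pairing_preimage /= /pairing (hv : v *m _ = 0) mxE; case: comp_ideal_submodule.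
  + move=> v hv; split=> [|/BT//].
    move=> [_ [xi _ <-] [b' hb' hv']].
    rewrite -hv'; apply: (submoduleD pulled_logs_submodule _ hb').
    apply: tangent_ker.
    have -> : xi *m D = v - b' by rewrite -hv' addrK.
    exact: submoduleB grad_syzygies_submodule hv (pulled_logs_sub_syzygies hb').
  + move=> u /comp_idealP[xi hxi]; exists (u - xi *m D).
      rewrite /grad_syzygies /= mulmxBl -pairingM hxi comp_gradT mulmxA subrr.
      by [].
    rewrite opprB addrC subrK; exists (xi *m D).
      by exists xi.
    by exists 0; [case: pulled_logs_submodule | rewrite addr0].
- apply: (quotient_dim_pull (phi := pairing) (setT_ksubspace _) JpK _ IK JK
    comp_ideal_sub_pulled_ideal) ha => //.
  + by move=> c u v _ _; exact: pairing_lin.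
  + by move=> v _; exists v; rewrite pairingM.
  + by move=> v' /pairing_ideal[u <-]; exists u => //; rewrite subrr; case: JK.
Qed.

End LiftableFields.

(** * The modules Tor_0 and Tor_1 of the Jacobian algebra *)

Lemma homology_iso_dim (K : fieldType) (D : comAlgType K) (N : lmodType D) (X Y : choiceType)
    (V W : set (X -> N)) (V' W' : set (Y -> N)) (g : X -> Y -> D^o) d :
  submodule V -> submodule W -> W `<=` V -> submodule V' -> submodule W' -> W' `<=` V' ->
  V `<=` [set v | finite_supp v] -> homology_iso V W V' W' g ->
  quotient_dim V' W' d -> quotient_dim V W d.
Proof.
move=> hV hW WV hV' hW' WV' Vf [gfin gV gW gs].
apply: (@quotient_dim_pull K D D (X -> N) (Y -> N) V W V' W' (fun v => free_diff g v) d) => //;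
  try exact: submodule_ksubspace.
by move=> c u v /Vf fu /Vf fv; exact: free_diff_lin.
Qed.

Section TorDims.
Variables (K : fieldType) (A B : comAlgType K) (pb : {rmorphism A -> B}) (n : nat).
Hypothesis pb_alg : forall c : K, pb c%:A = c%:A.
Variable df : 'I_n -> A.
Local Notation N := (restrict_scalars pb).
Local Notation logs := (log_fields df).
Local Notation L := (pulled_logs pb df).
Local Notation Jf := (span (range (fun i => df i : A^o))).

Lemma free_diff_ord (D : comNzRingType) (S : choiceType) (k : nat) (d : 'I_k -> S -> D^o)
    (M : lmodType D) (v : 'I_k -> M) s : free_diff d v s = \sum_i d i s *: v i.
Proof. exact: fsbig_ordT. Qed.

Lemma finite_supp_ord k (M : zmodType) (v : 'I_k -> M) : finite_supp v.
Proof. exact: finite_finset. Qed.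

Lemma finite_supp_unit (M : zmodType) (v : unit -> M) : finite_supp v.
Proof. exact: finite_finset. Qed.

Definition grad_matrix (k : 'I_n) : unit -> A^o := fun=> df k.
Definition log_matrix (chi : logs) : 'I_n -> A^o := fun k => \val chi ord0 k.

Lemma combination_unit (v : unit -> A^o) :
  combination (fun=> 1 : A^o) v = v tt.
Proof.
rewrite (@combination_fset _ _ _ _ _ [fset tt]%fset); last by case=> //; rewrite inE.
by rewrite big_seq_fset1 [LHS]mulr1.
Qed.

Fact gradient_surj (x : A^o) : exists2 v : unit -> A^o,
  finite_supp v & Jf (x - combination (fun=> 1 : A^o) v).
Proof.
exists (fun=> x); first exact: finite_supp_unit.
by rewrite combination_unit subrr; case: (span_submodule (range (fun i => df i : A^o))).
Qed.

Fact gradient_exact0 (v : unit -> A^o) : finite_supp v ->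
  Jf (combination (fun=> 1 : A^o) v) <->
  exists2 w : 'I_n -> A^o, finite_supp w & v = free_diff grad_matrix w.
Proof.
move=> _; rewrite combination_unit span_range.
split=> [[c hc]|[w _ ->]]; last first.
  by exists w; rewrite free_diff_ord; apply: eq_bigr => i _; exact: mulrC.
exists c; first exact: finite_supp_ord.
apply/funext => -[]; rewrite hc free_diff_ord; apply: eq_bigr => i _; exact: mulrC.
Qed.

Lemma log_fin : finite_columns log_matrix.
Proof. by move=> chi; exact: finite_supp_ord. Qed.

Lemma grad_log (chi : logs) : free_diff grad_matrix (log_matrix chi) = 0.
Proof.
apply/funext => s; rewrite free_diff_ord.
case: chi => chi hchi; rewrite -[RHS](set_mem hchi).
by apply: eq_bigr => i _; exact: mulrC.
Qed.

Fact gradient_exact1 (v : 'I_n -> A^o) : finite_supp v ->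
  free_diff grad_matrix v = 0 <->
  exists2 w : logs -> A^o, finite_supp w & v = free_diff log_matrix w.
Proof.
move=> _; split=> [hv|[w fw ->]]; last first.
  rewrite (free_diff_comp _ log_fin fw) (funext grad_log).
  exact: free_diff0l.
have hD : logs (\row_k v k).
  have := congr1 (fun g => g tt) hv; rewrite free_diff_ord => hv'.
  by rewrite /log_fields /= -[RHS]hv'; apply: eq_bigr => i _; rewrite mxE; exact: mulrC.
exists (basis_vector _ (SigSub (mem_set hD) : logs)); first exact: finite_supp_basis.
by rewrite free_diff_basis; apply/funext => k; rewrite /log_matrix /= mxE.
Qed.

(** The relations among the [df k] are by definition the elements of [log_fields]; all of
    them are taken as generators. *)
Definition gradient_presentation : presentation Jf :=
  @Presentation _ _ Jf unit 'I_n logs (fun=> 1) grad_matrix log_matrix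
    (fun k => finite_supp_unit _) log_fin gradient_surj gradient_exact0 gradient_exact1.

Definition resolution_presentation (P : free_resolution Jf) : presentation Jf :=
  @Presentation _ _ Jf (fr_basis P 0) (fr_basis P 1) (fr_basis P 2) (@fr_aug _ _ _ P)
    (@fr_d _ _ _ P 0) (@fr_d _ _ _ P 1) (@fr_d_fin _ _ _ P 0) (@fr_d_fin _ _ _ P 1)
    (fun x => let: ex_intro v (conj h1 h2) := fr_surj P x in ex_intro2 _ _ v h1 h2)
    (@fr_exact0 _ _ _ P) (@fr_exactS _ _ _ P 0).

Lemma restrict_scalarsE (a : A) (b : N) : a *: b = (pb a * b : B).
Proof. by []. Qed.

Lemma grad_matrixN (v : 'I_n -> N) s :
  free_diff grad_matrix v s = pairing pb df (\row_k (v k : B)).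
Proof.
rewrite free_diff_ord /pairing mxE; apply: eq_bigr => k _.
by rewrite restrict_scalarsE !mxE mulrC.
Qed.

Definition row_of (v : 'I_n -> N) : 'rV[B]_n := \row_k (v k : B).
Definition of_row (u : 'rV[B]_n) : 'I_n -> N := fun k => u ord0 k.

Lemma row_ofK v : of_row (row_of v) = v.
Proof. by apply/funext => k; rewrite /of_row mxE. Qed.

Lemma of_rowK u : row_of (of_row u) = u.
Proof. by apply/rowP => k; rewrite mxE. Qed.

Definition log_boundaries : set ('I_n -> N) :=
  [set free_diff log_matrix w | w in [set w : logs -> N | finite_supp w]].

(** The boundaries are a priori only an [A]-submodule; they are a [B]-submodule because
    multiplication by an element of [B] commutes with the differential. *)
Lemma log_boundary_rows : submodule [set u | log_boundaries (of_row u)].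
Proof.
have [b0 bD] := boundaries_submodule N log_matrix.
split; first by congr log_boundaries: b0; apply/funext => k; rewrite /of_row mxE.
move=> a u v [w fw hw] hv.
have hl b (x y : N) : (a * (b *: x + y : N) : N) = b *: (a * x : N) + (a * y : N).
  by rewrite [LHS]mulrDr; congr (_ + _); exact: mulrCA.
have [fw' hw'] := free_diff_map log_matrix hl fw.
have := bD 1 _ _ (ex_intro2 _ _ _ fw' erefl) hv; congr log_boundaries.
apply/funext => k; rewrite hw' hw /of_row !mxE.
by rewrite -[LHS]/(1 *: (a * u ord0 k : N) + (v ord0 k : N)) scale1r.
Qed.

Lemma log_boundariesP v : log_boundaries v <-> L (row_of v).
Proof.
split=> [[w /finite_suppP[G hG] <-]|].
  have -> : row_of (free_diff log_matrix w) =
      \sum_(t <- G) (w t : B) *: map_mx pb (\val t).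
    rewrite (free_diff_fset _ hG); apply/rowP => k.
    rewrite mxE summxE; apply: eq_bigr => t _.
    by rewrite !mxE mulrC.
  elim/big_rec: _ => [|t u _]; first by case: (pulled_logs_submodule pb df).
  case: (pulled_logs_submodule pb df) => _; apply.
  by apply: span_incl; exists (\val t) => //; exact: set_mem (valP t).
rewrite -{2}(row_ofK v); apply: (span_min log_boundary_rows) => _ [chi hchi <-].
pose t0 : logs := SigSub (mem_set hchi).
exists (fun t => if t == t0 then (1 : B) : N else 0); first exact: finite_supp_delta.
rewrite free_diff_delta; apply/funext => k; rewrite /of_row mxE.
exact: mulr1.
Qed.

Lemma grad_cyclesP (v : 'I_n -> N) : free_diff grad_matrix v = 0 <-> grad_syzygies pb df (row_of v).
Proof.
rewrite /grad_syzygies /= -pairingM -(grad_matrixN v tt); split=> [->|].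
  by apply/matrixP => i j; rewrite !mxE mul0rn.
move=> /(congr1 (fun M : 'M_1 => M ord0 ord0)); rewrite !mxE mulr1n => h.
by apply/funext => -[].
Qed.

Lemma gradient_H1 b : quotient_dim (grad_syzygies pb df) L b ->
  quotient_dim (@cycles1 _ _ _ N gradient_presentation)
    (@boundaries1 _ _ _ N gradient_presentation) b.
Proof.
have Bsub := pulled_logs_submodule pb df.
apply: (@quotient_dim_pull _ _ _ ('I_n -> N) 'rV[B]_n _ _ _ _ row_of).
- exact/submodule_ksubspace/cycles1_submodule.
- exact/submodule_ksubspace/boundaries_submodule.
- exact: (@boundaries1_cycles1 _ _ _ N gradient_presentation).
- exact/submodule_ksubspace/grad_syzygies_submodule.
- exact/submodule_ksubspace.
- exact: pulled_logs_sub_syzygies.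
- move=> c u v _ _; apply/rowP => k; rewrite !mxE.
  by rewrite -[LHS]/(pb c%:A * u k + v k) pb_alg.
- by move=> v [_ /grad_cyclesP].
- by move=> v _; rewrite -log_boundariesP.
- move=> u hu; exists (of_row u); last first.
    by rewrite of_rowK subrr; case: Bsub.
  by split; [exact: finite_supp_ord | apply/grad_cyclesP; rewrite of_rowK].
Qed.

Lemma gradient_H0 b : quotient_dim setT (pulled_ideal pb df) b ->
  quotient_dim (@cycles0 _ _ _ N gradient_presentation)
    (@boundaries0 _ _ _ N gradient_presentation) b.
Proof.
have Isub := pulled_ideal_submodule pb df.
apply: (@quotient_dim_pull _ _ _ _ B^o _ _ _ _ (fun v : unit -> N => v tt : B)).
- exact/submodule_ksubspace/finite_supp_submodule.
- exact/submodule_ksubspace/boundaries_submodule.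
- exact: (@boundaries0_cycles0 _ _ _ N gradient_presentation).
- by split.
- exact/submodule_ksubspace.
- by [].
- move=> c u v _ _.
  by rewrite -[LHS]/(pb c%:A * u tt + v tt) pb_alg.
- by [].
- move=> v _; split=> [/pairing_ideal[u hu]|[w _ <-]].
    exists (fun k => u ord0 k : N); first exact: finite_supp_ord.
    apply/funext => -[]; rewrite grad_matrixN -hu; congr pairing.
    by apply/rowP => k; rewrite mxE.
  by rewrite grad_matrixN; exists (\row_k (w k : B)); rewrite pairingM.
- move=> a _; exists (fun=> a : N); first exact: finite_supp_unit.
  by rewrite subrr; case: Isub.
Qed.

Lemma tor0_dim b : quotient_dim setT (pulled_ideal pb df) b -> tor_dim Jf N 0 b.
Proof.
move=> /gradient_H0 hb P.
have Jsub := span_submodule (range (fun i => df i : A^o)).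
have [[g hg] _] := homology_iso_exists Jsub N (resolution_presentation P) gradient_presentation.
apply: (homology_iso_dim _ _ _ _ _ _ _ hg) hb.
- exact: finite_supp_submodule.
- exact: boundaries_submodule.
- exact: (@boundaries0_cycles0 _ _ _ N (resolution_presentation P)).
- exact: finite_supp_submodule.
- exact: boundaries_submodule.
- exact: (@boundaries0_cycles0 _ _ _ N gradient_presentation).
- by [].
Qed.

Lemma tor1_dim b : quotient_dim (grad_syzygies pb df) L b -> tor_dim Jf N 1 b.
Proof.
move=> /gradient_H1 hb P.
have Jsub := span_submodule (range (fun i => df i : A^o)).
have [_ [g hg]] := homology_iso_exists Jsub N (resolution_presentation P) gradient_presentation.
apply: (homology_iso_dim _ _ _ _ _ _ _ hg) hb.
- exact: (@cycles1_submodule _ _ _ N (resolution_presentation P)).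
- exact: boundaries_submodule.
- exact: (@boundaries1_cycles1 _ _ _ N (resolution_presentation P)).
- exact: cycles1_submodule.
- exact: boundaries_submodule.
- exact: (@boundaries1_cycles1 _ _ _ N gradient_presentation).
- by move=> v [].
Qed.

End TorDims.

(** * The formula for germs *)

Section Gradient.
Variable R : realType.
Variables (m n : nat) (f : germ R n) (F : mapgerm R m n).

Definition jacobian_mx : 'M[germ R m]_(m, n) := \matrix_(j, k) partial j (F k).

Lemma comp_gradE j :
  comp_grad (pullback F) (fun i => partial i f) jacobian_mx ord0 j =
  partial j (pullback F f).
Proof.
rewrite mxE partial_pullback; apply: eq_bigr => k _.
by rewrite !mxE.
Qed.

Lemma TKfE : TKf f F = tangent_logs (pullback F) (fun i => partial i f) jacobian_mx.
Proof.
have tE xi : tangent_map F xi = xi *m jacobian_mx.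
  by apply/rowP => k; rewrite !mxE; apply: eq_bigr => j _; rewrite mxE.
by rewrite /TKf (funext tE).
Qed.

End Gradient.

Theorem theorem1p5 (R : realType) (n m : nat) (f : germ R n) (F : mapgerm R m n)
  (hf : germ_at0 f = 0) (hfF : isolated_singularity (pullback F f)) :
  exists tau mu beta0 beta1 : nat,
    [/\ tau_Kf f F tau,
        milnor_number (pullback F f) mu,
        betti f F 0 beta0,
        betti f F 1 beta1 &
        tau%:Z = mu%:Z - beta0%:Z + beta1%:Z].
Proof.
have [mu hmu] := hfF.
pose pb : {rmorphism germ R n -> germ R m} := pullback F.
pose df i := partial i f.
pose D := jacobian_mx F.
have hJ : quotient_dim setT (comp_ideal pb df D) mu.
  rewrite /comp_ideal; have -> // : (fun j => comp_grad pb df D ord0 j : (germ R m)^o) =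
    (fun j => partial j (pullback F f)).
  by apply/funext => j; rewrite comp_gradE.
have kosz := koszul_row hJ.
have [b hb] := syzygies_mod_logs_dim kosz hJ.
have [a [b0 [ha hb0 muE]]] := quotient_dim_split (@setT_ksubspace _ _ _)
  (submodule_ksubspace (pulled_ideal_submodule pb df))
  (submodule_ksubspace (comp_ideal_submodule pb df D))
  (@comp_ideal_sub_pulled_ideal _ _ _ pb _ _ df D) (fun _ _ => I) hJ.
exists (b + a)%N, mu, b0, b; split=> //.
- by rewrite /tau_Kf TKfE; exact: (tangent_logs_dim kosz ha hb).
- exact: (tor0_dim (@pullback_alg R m n F) hb0).
- exact: (tor1_dim (@pullback_alg R m n F) hb).
- by rewrite muE !PoszD addrK addrC.
Qed.
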